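(* Let $g\in L_p(\mathbb{R})$, $1<p\le 2$. Then the operator $$(Gg)(x)=\int_{-\infty}^\infty K_{i\tau}(2\sqrt{2x})\,\mathrm{Im}\left[J_{i\tau}(2\sqrt{2x})\right]\frac{g(\tau)}{\sinh(\pi\tau/2)}\,d\tau$$ is well-defined and for all $x>0$ $$|(Gg)(x)|\le 2^{1/(4p)-1}\,p^{-1/(2p)}\,x^{-1/(4p)}\,B\left(\frac{1}{4p},\frac{1}{4p}\right)\|g\|_{L_p(\mathbb{R})}.$$
   Context: $J_\mu$ is the Bessel function of the first kind, $K_\mu$ the modified Bessel function of the second kind (Macdonald function), and $B(a,b)$ is Euler's beta-function. *)

(* Defs.v *)
(* MathComp-Analysis, with the complex numbers R[i] of mathcomp-real-closed. *)
From HB Require Import structures.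
From mathcomp Require Import all_boot all_order all_algebra.
From mathcomp Require Export complex.
From mathcomp Require Import all_classical all_reals all_analysis.

Set Implicit Arguments.
Unset Strict Implicit.
Unset Printing Implicit Defensive.

Import Order.TTheory GRing.Theory Num.Theory.
Import numFieldNormedType.Exports.
Export ComplexField.Normc.

Local Open Scope classical_set_scope.
Local Open Scope ring_scope.
Local Open Scope complex_scope.

(* Limits in R[i] are taken in R[i]^o, which carries the topology of the
   complex modulus. *)

Section BesselFunctions.
Context {R : realType}.
Implicit Types (z mu : R[i]) (t x : R).

Definition cexp z : R[i] :=
  (expR (complex.Re z))%:C * (cos (complex.Im z) +i* sin (complex.Im z)).

Definition csin z : R[i] := (cexp ('i * z) - cexp (- ('i * z))) / (2 * 'i).

(* The principal power t ^ z; meaningful for t > 0 only. *)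
Definition cpow t z : R[i] := cexp (z * (ln t)%:C).

(* 1 / Gamma(z) as the reciprocal of Gauss's limit
     Gamma(z) = lim_n  n! n^z / (z (z + 1) ... (z + n)),
   an entire function of z that vanishes at the poles of Gamma. *)
Definition inv_Gamma z : R[i] :=
  limn ((fun n : nat =>
    (\prod_(j < n.+1) (z + j%:R)) / (n`!%:R * cpow n%:R z)) : (R[i]^o)^nat).

(* J_mu(x) = sum_k (-1)^k (x/2)^(2k + mu) / (k! Gamma(k + mu + 1)), x > 0 *)
Definition besselJ mu x : R[i] :=
  limn (series ((fun k : nat =>
    (-1) ^+ k / k`!%:R * inv_Gamma (k%:R + mu + 1)
      * cpow (x / 2) ((2 * k)%:R + mu)) : (R[i]^o)^nat)).

(* I_mu(x) = sum_k (x/2)^(2k + mu) / (k! Gamma(k + mu + 1)), x > 0 *)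
Definition besselI mu x : R[i] :=
  limn (series ((fun k : nat =>
    k`!%:R^-1 * inv_Gamma (k%:R + mu + 1)
      * cpow (x / 2) ((2 * k)%:R + mu)) : (R[i]^o)^nat)).

(* K_mu(x) = (pi / 2) (I_{-mu}(x) - I_mu(x)) / sin(mu pi), extended by its
   limit to integer orders mu, where the denominator vanishes. *)
Definition besselK_quotient mu x : R[i] :=
  (pi / 2)%:C * (besselI (- mu) x - besselI mu x) / csin (mu * pi%:C).

Definition besselK mu x : R[i] :=
  if `[< exists m : int, mu = m%:~R >]
  then lim ((fun nu : R[i]^o => besselK_quotient nu x : R[i]^o)
              @ (mu : R[i]^o)^')
  else besselK_quotient mu x.

End BesselFunctions.

Section RealFunctions.
Context {R : realType}.

Definition sinh (x : R) : R := (expR x - expR (- x)) / 2.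

(* Euler's beta-function for real arguments a, b > 0; the library's [beta_fun]
   takes arguments in nat only. *)
Definition Beta (a b : R) : R :=
  \int[@lebesgue_measure R]_(t in `[0, 1]) (t `^ (a - 1) * (1 - t) `^ (b - 1)).

End RealFunctions.

Section ComplexValuedFunctions.
Context {R : realType}.
Local Notation leb := (@lebesgue_measure R).
Implicit Types f g : R -> R[i].

Definition Cmeasurable_fun f : Prop :=
  measurable_fun setT (fun t => complex.Re (f t)) /\
  measurable_fun setT (fun t => complex.Im (f t)).

Definition Cintegrable f : Prop :=
  leb.-integrable setT (fun t => (complex.Re (f t))%:E) /\
  leb.-integrable setT (fun t => (complex.Im (f t))%:E).

Definition Cintegral f : R[i] :=
  (\int[leb]_(t in setT) complex.Re (f t)) +i*
  (\int[leb]_(t in setT) complex.Im (f t)).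

Definition Lp_enorm (p : R) f : \bar R :=
  Lnorm leb p%:E (fun t => (normc (f t))%:E).

Definition in_Lp (p : R) f : Prop :=
  Cmeasurable_fun f /\ (Lp_enorm p f < +oo)%E.

Definition Lp_norm (p : R) f : R := fine (Lp_enorm p f).

(* The value of the integrand at tau = 0, where sinh vanishes, is immaterial. *)
Definition G_integrand g (x : R) : R -> R[i] := fun tau =>
  let y := 2 * Num.sqrt (2 * x) in
  besselK (tau *i) y * (complex.Im (besselJ (tau *i) y))%:C
    * (g tau / (sinh (pi * tau / 2))%:C).

Definition G_op g (x : R) : R[i] := Cintegral (G_integrand g x).

End ComplexValuedFunctions.

(* Main.v *)
(* For real tau, both Im J_(i tau)(y) and K_(i tau)(y) sinh(pi tau) are, up to the
   modulus of 1 / Gamma(1 + i tau), real solutions F of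
     F'' = (-+ 4 e^(2t) - tau^2) F,   t = ln(y / 2),
   given by explicit trigonometric series. For y <= 1 the series are bounded term
   by term; for y >= 1 the J-solution is controlled by its energy
   F^2 + F'^2 / (4 e^(2t) + tau^2), which decreases, and the K-solution, being
   recessive, by the monotonicity of e^(t/2) |F| beyond its turning point. With
   |Gamma(1 + i tau)|^(-2) <= sinh(pi tau) / (pi tau) this bounds the kernel of G by
   B / max(T, |tau|)^2, where B and T depend on y = 2 sqrt(2x), and, for M = 13/2,
   the sup norm of the kernel is at most M y^(-1/2) and its squared L_2 norm at most
   M^2 y^(-1/2). Hence its L_q norm, for q >= 2 conjugate to p, is at most
   M y^(-1/(2p)), and Hoelder's inequality applies. The constant is absorbed by
   B(s, s) >= 2/s - 1 with s = 1/(4p). *)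
Require Import Defs.
From HB Require Import structures.
From mathcomp Require Import all_boot all_order all_algebra.
From mathcomp Require Import all_classical all_reals all_analysis.
From mathcomp Require Import measurable_realfun ring lra.

Set Implicit Arguments.
Unset Strict Implicit.
Unset Printing Implicit Defensive.

Import Order.TTheory GRing.Theory Num.Theory.
Import numFieldNormedType.Exports.

Local Open Scope classical_set_scope.
Local Open Scope ring_scope.

(** The obstacle is uniformity in [tau] and [y]: for large [y] the series of the K-solution cancels
    heavily, so its decay cannot be read off term by term. Only recessiveness is taken from the
    series, by a Chebyshev argument: the weights s^k / (k!)^2 with s = e^(2t) concentrate near k =
    e^t, where the phases are close to 0. The sines are then negligible against the cosines of the
    companion solution, and the differential equation does the rest. The initial data come from the
    explicit series bounds at y = 1. The sup norm and the squared L_2 norm decay at the same rate 1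
    / r, with r = y^(1/2); interpolation then gives r^(-(q-1)/q) = r^(-1/p), the power of x that is
    claimed. The value 13/2 is what the target leaves: as B(s, s) >= 8p - 1 >= 7p, the constant to
    beat is (7/2) 2^(1/p) p^(1 - 1/(2p)), and this is at least 13/2. The other rational constants
    are rounded to fit under it; the tightest place is (8/3) (39/10)^2 <= (13/2)^2. *)

Lemma derive_le0_le (R : realType) (f df : R -> R) (a b : R) : a <= b ->
  (forall x, a <= x <= b -> is_derive x 1 f (df x)) ->
  (forall x, a <= x <= b -> df x <= 0) -> f b <= f a.
Proof.
move=> ab fdf df0.
have [x xab| |c cab E] := @MVT_segment R f df a b ab.
- by apply: fdf; move: xab; rewrite in_itv /= => /andP[/ltW -> /ltW ->].
- apply: derivable_within_continuous => x; rewrite in_itv /= => /fdf ?.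
  exact: ex_derive.
- have : df c * (b - a) <= 0.
    by rewrite mulr_le0_ge0 ?subr_ge0// df0//; move: cab; rewrite in_itv.
  by rewrite -E subr_le0.
Qed.

Lemma derive_ge0_ge (R : realType) (f df : R -> R) (a b : R) : a <= b ->
  (forall x, a <= x <= b -> is_derive x 1 f (df x)) ->
  (forall x, a <= x <= b -> 0 <= df x) -> f a <= f b.
Proof.
move=> ab fdf df0; rewrite -lerN2.
apply: (@derive_le0_le R (fun x => - f x) (fun x => - df x) a b ab) => x xab.
  by have := fdf x xab => ?; apply: is_deriveN.
by rewrite oppr_le0 df0.
Qed.

(** * The product expansion of sinh as a bound *)

Section SinhProduct.
Context {R : realType}.
Implicit Types x y : R.

Lemma sin_le x : 0 <= x -> sin x <= x.
Proof.
move=> x0; have := @derive_le0_le R (fun t => sin t - t) (fun t => cos t - 1) 0 x x0.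
rewrite sin0 subr0 subr_le0; apply => t _; by rewrite subr_le0 cos_le1.
Qed.

Lemma cos_ge x : 1 - x ^+ 2 / 2 <= cos x.
Proof.
wlog x0 : x / 0 <= x.
  move=> H; have [|/ltW x0] := leP 0 x; first exact: H.
  by rewrite -cosN -(sqrrN x) H// oppr_ge0.
have := @derive_ge0_ge R (fun t => cos t + t ^+ 2 / 2) (fun t => - sin t + t) 0 x x0.
rewrite cos0 expr0n /= mul0r addr0 => H; rewrite lerBlDr; apply: H => t /andP[t0 _].
  apply: is_deriveD; apply: is_derive_eq.
  by rewrite /GRing.scale /=; field.
by rewrite addrC subr_ge0 sin_le.
Qed.

(** The quadratic lower bound of [cos] is negative at 31/20, so it is applied at 31/80 and carried
    over by two duplications; a positive cosine places 31/20 below [pi / 2]. The value 31/20 is the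
    slope later used under [sinh (pi * tau / 2)]. *)
Lemma pi_gt31 : 31 / 10 < pi :> R.
Proof.
have h2 t : cos (t *+ 2) = cos t ^+ 2 *+ 2 - 1 :> R by exact: cos_mulr2n.
have c1 := cos_ge (31 / 80 : R).
have c2 : 71 / 100 <= cos (31 / 40 : R).
  have -> : (31 / 40 : R) = (31 / 80) *+ 2 by rewrite mulr2n; lra.
  by rewrite h2 mulr2n; nra.
have c3 : 0 < cos (31 / 20 : R).
  have -> : (31 / 20 : R) = (31 / 40) *+ 2 by rewrite mulr2n; lra.
  by rewrite h2 mulr2n; nra.
suff : (31 / 20 : R) < pi / 2 by move=> ?; lra.
rewrite ltNge; apply/negP => le.
have : cos (31 / 20 : R) <= cos (pi / 2).
  rewrite leNgt ltr_cos ?in_itv /= -?leNgt //.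
  - by have := @pi_ge2 R; lra.
  - by have := @pi_ge2 R; lra.
by rewrite cos_pihalf => ?; lra.
Qed.

Lemma sinhN x : sinh (- x) = - sinh x.
Proof. by rewrite /sinh opprK -mulNr opprB. Qed.

Lemma sinh0 : sinh (0 : R) = 0.
Proof. by rewrite /sinh oppr0 subrr mul0r. Qed.

Lemma sinh_ge x : 0 <= x -> x <= sinh x.
Proof.
move=> x0; have := @derive_ge0_ge R (fun t => sinh t - t)
  (fun t => (expR t + expR (- t)) / 2 - 1) 0 x x0.
rewrite sinh0 subr0 subr_ge0; apply => t _.
  rewrite /sinh; apply: is_derive_eq.
  by rewrite /GRing.scale /= !(mulrN1, mulr1, scaler0); lra.
rewrite expRN; have := expR_gt0 t; set u := expR t => u0.
have -> : (u + u^-1) / 2 - 1 = (u - 1) ^+ 2 / (2 * u) by field; rewrite gt_eqF.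
by rewrite divr_ge0 ?sqr_ge0// mulr_ge0// ltW.
Qed.

Lemma sinh_gt0 x : 0 < x -> 0 < sinh x.
Proof. by move=> x0; apply: lt_le_trans x0 (sinh_ge (ltW x0)). Qed.

(* [sin ((2 n + 1) t) = sin t * (sin_poly n).[(sin t) ^+ 2]]; the pair carries
   the last two polynomials of the three-term recurrence. *)
Fixpoint sin_poly2 (n : nat) : {poly R} * {poly R} :=
  if n is m.+1 then
    let: (p, q) := sin_poly2 m in ((2%:P - 4%:P * 'X) * p - q, p)
  else (1, -1).
Definition sin_poly n := (sin_poly2 n).1.

Lemma sin_polyS n :
  sin_poly n.+1 = (2%:P - 4%:P * 'X) * sin_poly n - (sin_poly2 n).2.
Proof. by rewrite /sin_poly /=; case: (sin_poly2 n). Qed.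

Lemma sin_poly22S n : (sin_poly2 n.+1).2 = sin_poly n.
Proof. by rewrite /sin_poly /=; case: (sin_poly2 n). Qed.

Lemma size_sin_poly n : (size (sin_poly n) <= n.+1)%N.
Proof.
suff : (size (sin_poly n) <= n.+1)%N /\ (size (sin_poly2 n).2 <= n.+1)%N by case.
elim: n => [|n [IH1 IH2]]; first by rewrite /sin_poly /= size_polyN !size_poly1.
rewrite sin_poly22S sin_polyS; split; last by apply: leq_trans IH1 _.
rewrite (leq_trans (size_polyD _ _))// size_polyN geq_max.
apply/andP; split; last by apply: leq_trans IH2 _.
rewrite (leq_trans (size_polyMleq _ _))//.
have s2 : (size (2%:P - 4%:P * 'X : {poly R})%R <= 2)%N.
  rewrite (leq_trans (size_polyD _ _))// size_polyN geq_max.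
  rewrite (leq_trans (size_polyC_leq1 _))//=.
  rewrite (leq_trans (size_polyMleq _ _))// size_polyX.
  by rewrite addn2 /= ltnS size_polyC_leq1.
by have := leq_add s2 IH1; case: (_ + _)%N.
Qed.

(** Induction on sin((2n+3)t) = 2 cos(2t) sin((2n+1)t) - sin((2n-1)t), where 2 cos(2t) = 2 - 4 sin^2
    t is the factor of the recurrence; the initial -1 encodes sin(-t). *)
Lemma sin_polyE n t :
  sin (n.*2.+1%:R * t) = sin t * (sin_poly n).[sin t ^+ 2] :> R.
Proof.
suff : sin (n.*2.+1%:R * t) = sin t * (sin_poly n).[sin t ^+ 2] /\
  sin ((n.*2.+1%:R - 2) * t) = sin t * (sin_poly2 n).2.[sin t ^+ 2] by case.
elim: n => [|n [IH1 IH2]].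
  rewrite /sin_poly /= !hornerE; split => //.
  have -> : (0.*2.+1%:R - 2) * t = - t by rewrite double0; ring.
  by rewrite sinN mulrN1.
rewrite sin_poly22S sin_polyS !(hornerD, hornerN, hornerM, hornerC, hornerX) mulrBr mulrCA -IH1 -IH2; split; last first.
  have -> // : (n.+1.*2.+1%:R - 2) * t = n.*2.+1%:R * t.
  by rewrite doubleS -!natr1; ring.
have -> : n.+1.*2.+1%:R * t = n.*2.+1%:R * t + t *+ 2.
  by rewrite doubleS -!natr1 mulr2n; ring.
have -> : (n.*2.+1%:R - 2) * t = n.*2.+1%:R * t - t *+ 2.
  by rewrite mulr2n; ring.
by rewrite sinD sinB cos_mulr2n cos2sin2; ring.
Qed.

(** The previous identity at t = i x, which turns sin^2 into -sinh^2; proved over the reals by the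
    same recurrence. *)
Lemma sinh_polyE n x :
  sinh (n.*2.+1%:R * x) = sinh x * (sin_poly n).[- sinh x ^+ 2] :> R.
Proof.
suff : sinh (n.*2.+1%:R * x) = sinh x * (sin_poly n).[- sinh x ^+ 2] /\
  sinh ((n.*2.+1%:R - 2) * x) = sinh x * (sin_poly2 n).2.[- sinh x ^+ 2] by case.
elim: n => [|n [IH1 IH2]].
  rewrite /sin_poly /= !hornerE; split => //.
  have -> : (0.*2.+1%:R - 2) * x = - x by rewrite double0; ring.
  by rewrite sinhN mulrN1.
rewrite sin_poly22S sin_polyS !(hornerD, hornerN, hornerM, hornerC, hornerX) mulrBr mulrCA -IH1 -IH2; split; last first.
  have -> // : (n.+1.*2.+1%:R - 2) * x = n.*2.+1%:R * x.
  by rewrite doubleS -!natr1; ring.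
have -> : n.+1.*2.+1%:R * x = n.*2.+1%:R * x + (x + x).
  by rewrite doubleS -!natr1; ring.
have -> : (n.*2.+1%:R - 2) * x = n.*2.+1%:R * x - (x + x).
  by ring.
set a := n.*2.+1%:R * x.
rewrite /sinh opprB opprD addrC opprD !expRD !expRN.
by have := expR_gt0 x; have := expR_gt0 a => ? ?; field; rewrite !gt_eqF.
Qed.

Lemma sin_poly0 n : (sin_poly n).[0] = n.*2.+1%:R.
Proof.
suff : (sin_poly n).[0] = n.*2.+1%:R /\ (sin_poly2 n).2.[0] = n.*2.+1%:R - 2 by case.
elim: n => [|n [IH1 IH2]]; first by rewrite /sin_poly /= !hornerE double0; split; ring.
rewrite sin_poly22S sin_polyS !(hornerD, hornerN, hornerM, hornerC, hornerX) IH1 IH2 doubleS -!natr1; split; ring.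
Qed.

(** With N = 2n+1, the polynomial [sin_poly n] vanishes at sin^2(pi j / N) for 1 <= j <= n, so
    sinh(N x) = N sinh x prod_j (1 + sinh^2 x / sin^2(pi j / N)). At x = pi t / N, the inequalities
    sinh x >= x and sin u <= u bound each factor below by that of Euler's product, without any
    limit. *)
Lemma sinh_prod_ge (t : R) n : 0 <= t ->
  pi * t * \prod_(j < n) (1 + t ^+ 2 / j.+1%:R ^+ 2) <= sinh (pi * t).
Proof.
move=> t0; pose N : R := n.*2.+1%:R.
have N0 : 0 < N by rewrite ltr0n.
pose th (j : nat) : R := j%:R * (pi / N).
have th_gt0 j : (0 < j)%N -> 0 < th j by move=> j0; rewrite mulr_gt0 ?ltr0n// divr_gt0 ?pi_gt0.
have th_lt j : (j <= n)%N -> th j < pi / 2.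
  move=> jn; rewrite /th mulrCA ltr_pM2l ?pi_gt0// ltr_pdivrMr// mulrC ltr_pdivlMr//.
  by rewrite -natrM ltr_nat muln2 ltnS leq_double.
pose s (j : nat) : R := sin (th j) ^+ 2.
have sth_gt0 j : (0 < j <= n)%N -> 0 < sin (th j).
  by case/andP=> j0 jn; apply: sin_gt0_pihalf; rewrite th_gt0//= th_lt.
have s_gt0 j : (0 < j <= n)%N -> 0 < s j by move=> /sth_gt0 ?; rewrite exprn_gt0.
have s_root j : (0 < j <= n)%N -> (sin_poly n).[s j] = 0.
  move=> jn; have /eqP := sin_polyE n (th j).
  have -> : n.*2.+1%:R * th j = 0 + pi *+ j.
    by rewrite /th add0r -[pi *+ j]mulr_natl; field; rewrite gt_eqF.
  rewrite (alternatingn (@sinDpi R)) sin0 mulr0 eq_sym mulf_eq0 gt_eqF ?sth_gt0//=.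
  by move/eqP.
have s_inj i j : (0 < i <= n)%N -> (0 < j <= n)%N -> s i = s j -> i = j.
  move=> hi hj /eqP; rewrite eqrXn2 ?ltW ?sth_gt0// => /eqP /sin_inj.
  move=> E; have : th i = th j.
    have th_in k : (0 < k <= n)%N -> th k \in `[- (pi / 2), pi / 2].
      case/andP=> k0 kn; rewrite in_itv /= (ltW (th_lt _ kn)) andbT.
      by rewrite (le_trans _ (ltW (th_gt0 _ k0)))// oppr_le0 divr_ge0 ?pi_ge0.
    by apply: E; apply: th_in.
  by move/mulIf => /(_ (lt0r_neq0 (divr_gt0 (pi_gt0 R) N0)))/eqP; rewrite eqr_nat => /eqP.
pose Q : {poly R} := N%:P * \prod_(j < n) (1 - ((s j.+1)^-1)%:P * 'X).
have sQ : (size Q <= n.+1)%N.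
  rewrite /Q (leq_trans (size_polyMleq _ _))//.
  rewrite size_polyC gt_eqF//=.
  rewrite (leq_trans (size_prod_leq _ _))//=.
  rewrite leq_subLR (@eq_card _ _ 'I_n)// card_ord addnS ltnS (@leq_trans (\sum_(j < n) 2)%N)//.
    apply: leq_sum => j _.
    rewrite (leq_trans (size_polyD _ _))// size_polyN geq_max size_poly1 /=.
    rewrite (leq_trans (size_polyMleq _ _))// size_polyX.
    by rewrite addn2 /= ltnS size_polyC_leq1.
  by rewrite sum_nat_const card_ord muln2 -addnn.
(* Both sides have degree at most n and agree at n + 1 points: the n common roots, and 0, where both
   equal N. *)
have EQ : sin_poly n = Q.
  apply/eqP; rewrite -subr_eq0; apply/eqP.
  apply: (@roots_geq_poly_eq0 R _ (0 :: [seq s i.+1 | i <- iota 0 n])).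
  - apply/andP; split.
      rewrite /root !(hornerD, hornerN, hornerM, hornerC, hornerX) sin_poly0 horner_prod big1 ?mulr1 ?subrr// => i _.
      by rewrite !(hornerD, hornerN, hornerM, hornerC, hornerX) mulr0 subr0.
    apply/allP => z zs.
    have [i + ->] : exists2 i, i \in iota 0 n & z = s i.+1 by apply/seq.mapP.
    rewrite mem_iota add0n /= => lin.
    rewrite /root !(hornerD, hornerN, hornerM, hornerC, hornerX) s_root// horner_prod (bigD1 (Ordinal lin))//= !(hornerD, hornerN, hornerM, hornerC, hornerX).
    rewrite [X in 1 - X]mulVf; last by rewrite gt_eqF// s_gt0.
    by rewrite subrr mul0r mulr0 subrr.
  - rewrite cons_uniq; apply/andP; split.
      apply/negP => zs.
      have [k] : exists2 k, k \in iota 0 n & 0 = s k.+1 by apply/seq.mapP.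
      rewrite mem_iota add0n /= => lin /esym/eqP.
      by rewrite gt_eqF// s_gt0.
    rewrite map_inj_in_uniq ?iota_uniq// => i j; rewrite !mem_iota add0n /= => li lj.
    by move/s_inj => /(_ li lj)[].
  - rewrite /= size_map size_iota (leq_trans (size_polyD _ _))// size_polyN geq_max.
    by rewrite size_sin_poly.
pose x := pi * t / N.
have x0 : 0 <= x by rewrite divr_ge0 ?mulr_ge0 ?pi_ge0// ltW.
have -> : sinh (pi * t) = sinh x * (N * \prod_(j < n) (1 + sinh x ^+ 2 / s j.+1)).
  have := sinh_polyE n x; rewrite {1}/x mulrCA divff ?gt_eqF// mulr1 => ->.
  rewrite EQ /Q !(hornerD, hornerN, hornerM, hornerC, hornerX) horner_prod; congr (_ * (_ * _)).
  by apply: eq_bigr => j _; rewrite !(hornerD, hornerN, hornerM, hornerC, hornerX) mulrN opprK mulrC.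
have -> : pi * t = x * N by rewrite /x divfK// gt_eqF.
rewrite -mulrA ler_pM//.
- apply: mulr_ge0; first exact: ltW.
  by apply: prodr_ge0 => j _; rewrite addr_ge0// divr_ge0 ?sqr_ge0.
- exact: sinh_ge.
rewrite ler_pM2l//; apply: ler_prod => j _.
rewrite addr_ge0 ?divr_ge0 ?sqr_ge0//= lerD2l.
have hj : (0 < j.+1 <= n)%N by rewrite /=.
rewrite ler_pdivrMr ?exprn_gt0 ?ltr0n// mulrAC ler_pdivlMr ?s_gt0//.
have sx0 : 0 <= sinh x := le_trans x0 (sinh_ge x0).
rewrite -!exprMn ler_pXn2r// ?nnegrE.
- have -> : sinh x * j.+1%:R = j.+1%:R * sinh x by rewrite mulrC.
  apply: (@le_trans _ _ (t * th j.+1)).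
    by rewrite ler_wpM2l// sin_le// ltW// th_gt0.
  have -> : t * th j.+1 = j.+1%:R * x by rewrite /th /x; field; rewrite gt_eqF.
  by rewrite ler_wpM2l// sinh_ge.
- by rewrite mulr_ge0// ltW// sth_gt0.
- by rewrite mulr_ge0.
Qed.

End SinhProduct.

Section ComplexLimits.
Context {R : realType}.
Local Open Scope complex_scope.
Implicit Types z : R[i].

Lemma normcE_sqrt z : normc z = Num.sqrt (complex.Re z ^+ 2 + complex.Im z ^+ 2).
Proof. by case: z. Qed.

Lemma normc_le_ReIm z : normc z <= `|complex.Re z| + `|complex.Im z|.
Proof.
rewrite normcE_sqrt -(@ler_pXn2r _ 2)// ?nnegrE ?sqrtr_ge0 ?addr_ge0//.
rewrite sqr_sqrtr ?addr_ge0 ?sqr_ge0// sqrrD !real_normK ?num_real//.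
by rewrite lerD2r lerDl mulrn_wge0// mulr_ge0.
Qed.

Lemma cvg_complex (u : R[i]^nat) z :
  (fun n => complex.Re (u n)) @ \oo --> complex.Re z ->
  (fun n => complex.Im (u n)) @ \oo --> complex.Im z ->
  (u : (R[i]^o)^nat) @ \oo --> (z : R[i]^o).
Proof.
move=> /cvgrPdist_lt cr /cvgrPdist_lt ci; apply/cvgrPdist_lt => -[e e'].
rewrite ltcE /= => /andP[/eqP -> e0].
have e2 : 0 < e / 2 by rewrite divr_gt0.
have Nr := cr _ e2; have Ni := ci _ e2.
near=> n; rewrite normc_def ltcR -normcE_sqrt.
apply: le_lt_trans (normc_le_ReIm _) _.
have -> : e = e / 2 + e / 2 by lra.
have -> : complex.Re (z - u n) = complex.Re z - complex.Re (u n) by case: (z) (u n) => ? ? [].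
have -> : complex.Im (z - u n) = complex.Im z - complex.Im (u n) by case: (z) (u n) => ? ? [].
by apply: ltrD; [near: n; exact: Nr|near: n; exact: Ni].
Unshelve. all: by end_near. Qed.

Lemma limn_complex (u : R[i]^nat) z :
  (fun n => complex.Re (u n)) @ \oo --> complex.Re z ->
  (fun n => complex.Im (u n)) @ \oo --> complex.Im z ->
  limn (u : (R[i]^o)^nat) = z.
Proof. by move=> cr ci; apply: cvg_lim => //; exact: cvg_complex. Qed.

End ComplexLimits.

(** * The Gamma function on the line Re z = 1 *)

Section GammaOnLine.
Context {R : realType}.
Implicit Types tau x : R.

Lemma atan_le x : 0 <= x -> atan x <= x.
Proof.
move=> x0; have := @derive_ge0_ge R (fun t => t - atan t) (fun t => 1 - (1 + t ^+ 2)^-1) 0 x x0.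
rewrite atan0 subr0 subr_ge0; apply => t _.
by rewrite subr_ge0 invf_le1 ?lerDl ?sqr_ge0// ltr_pwDl ?sqr_ge0.
Qed.

(** Derivatives compare because (tau t)^2 <= t as long as tau^2 t <= 1. At x = 1/j this bounds the
    increments of [Garg_sum] from below once j >= tau^2. *)
Lemma ln1D_le_atan tau x : 0 < tau -> 0 <= x -> tau ^+ 2 * x <= 1 ->
  tau * ln (1 + x) <= atan (tau * x).
Proof.
move=> t0 x0 tx; have := @derive_ge0_ge R (fun t => atan (tau * t) - tau * ln (1 + t))
  (fun t => tau * (1 + (tau * t) ^+ 2)^-1 - tau * (1 + t)^-1) 0 x x0.
rewrite !mulr0 addr0 ln1 atan0 mulr0 subr0 subr_ge0; apply => t /andP[h0 hx].
  have h1 : 0 < 1 + t by rewrite ltr_wpDr.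
  have d1 : is_derive t 1 (fun t => atan (tau * t)) (tau * (1 + (tau * t) ^+ 2)^-1).
    apply: is_derive_eq (is_derive1_comp (f := atan) (g := fun t => tau * t) _ _) _.
    by rewrite /GRing.scale /= mulr1 mulrC.
  have d2 : is_derive t 1 (fun t => ln (1 + t)) (1 + t)^-1.
    have ? := @is_derive1_ln R _ h1.
    apply: is_derive_eq (is_derive1_comp (f := @ln R) (g := fun t => 1 + t) _ _) _.
    by rewrite /GRing.scale /= add0r !mulr1.
  by apply: is_deriveB.
rewrite subr_ge0 ler_pM2l// lef_pV2 ?posrE ?ltr_pwDl ?sqr_ge0//.
  rewrite lerD2l exprMn expr2 mulrA -[leRHS]mul1r ler_wpM2r//.
  by rewrite (le_trans _ tx)// ler_wpM2l// sqr_ge0.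
Qed.

(* Gauss's product gives
     1 / Gamma (1 + i tau) = lim_n exp (- i tau ln n) prod_(j <= n) (1 + i tau / j),
   which has modulus [Gmod tau] and argument [Garg tau]. *)
Definition Gmod_prod tau n : R := \prod_(j < n) Num.sqrt (1 + tau ^+ 2 / j.+1%:R ^+ 2).
Definition Garg_sum tau n : R := \sum_(j < n) atan (tau / j.+1%:R).
Definition Gmod tau : R := limn (Gmod_prod tau).
Definition Garg tau : R := limn (fun n => Garg_sum tau n - tau * ln n%:R).

Lemma Gmod_prodN tau : Gmod_prod (- tau) = Gmod_prod tau.
Proof. by apply/funext => n; rewrite /Gmod_prod; under eq_bigr do rewrite sqrrN. Qed.

Lemma Garg_sumN tau n : Garg_sum (- tau) n = - Garg_sum tau n.
Proof. by rewrite /Garg_sum -sumrN; apply: eq_bigr => j _; rewrite mulNr atanN. Qed.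

Lemma Gmod_prod_nd tau : nondecreasing_seq (Gmod_prod tau).
Proof.
apply/nondecreasing_seqP => n; rewrite /Gmod_prod big_ord_recr /=.
apply: ler_peMr; first by apply: prodr_ge0 => j _; exact: sqrtr_ge0.
by rewrite -[leLHS]sqrtr1 ler_wsqrtr// lerDl divr_ge0 ?sqr_ge0.
Qed.

Lemma Gmod_prod_ge1 tau n : 1 <= Gmod_prod tau n.
Proof.
by rewrite (le_trans _ (Gmod_prod_nd _ (leq0n n)))// /Gmod_prod big_ord0.
Qed.

Lemma Gmod_prod_le tau n : 0 < tau ->
  Gmod_prod tau n ^+ 2 <= sinh (pi * tau) / (pi * tau).
Proof.
move=> t0; rewrite ler_pdivlMr ?mulr_gt0 ?pi_gt0// mulrC.
apply: le_trans (sinh_prod_ge n (ltW t0)); rewrite ler_pM2l ?mulr_gt0 ?pi_gt0//.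
rewrite /Gmod_prod -prodrXl; apply: ler_prod => j _.
rewrite sqr_ge0/= sqr_sqrtr// addr_ge0// divr_ge0 ?sqr_ge0//.
Qed.

Lemma cvg_Gmod tau : Gmod_prod tau @ \oo --> Gmod tau.
Proof.
wlog t0 : tau / 0 <= tau.
  move=> H; have [|/ltW t0] := leP 0 tau; first exact: H.
  by rewrite /Gmod -Gmod_prodN; apply: H; rewrite oppr_ge0.
apply: nondecreasing_is_cvgn; first exact: Gmod_prod_nd.
move: t0; rewrite le_eqVlt => /predU1P[<-|t0].
  exists 1 => _ [n _ <-]; rewrite /Gmod_prod big1// => j _.
  by rewrite expr0n/= mul0r addr0 sqrtr1.
exists (sinh (pi * tau) / (pi * tau) + 1) => _ [n _ <-].
have := Gmod_prod_le n t0; have := Gmod_prod_ge1 tau n.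
by set a := Gmod_prod _ _; set b := _ / _ => ? ?; nra.
Qed.

Lemma Gmod_ge_prod tau n : Gmod_prod tau n <= Gmod tau.
Proof. by apply: nondecreasing_cvgn_le; [exact: Gmod_prod_nd|exact: cvg_Gmod]. Qed.

Lemma Gmod_gt0 tau : 0 < Gmod tau.
Proof. by apply: lt_le_trans (Gmod_ge_prod tau 0); rewrite /Gmod_prod big_ord0. Qed.

Lemma Gmod_le tau : 0 < tau -> Gmod tau ^+ 2 <= sinh (pi * tau) / (pi * tau).
Proof.
move=> t0; have c : (fun n => Gmod_prod tau n ^+ 2) @ \oo --> Gmod tau ^+ 2.
  have c1 := @cvg_Gmod tau; rewrite expr2; under eq_cvg do rewrite expr2.
  exact: cvgM.
rewrite -(cvg_lim _ c)//; apply: limr_le; first by apply/cvg_ex; eexists; exact: c.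
by near=> n; exact: Gmod_prod_le.
Unshelve. all: by end_near. Qed.

(** The increment is controlled by atan u <= u and 1/(n+2) <= ln((n+2)/(n+1)). *)
Lemma Garg_seq_ni tau : 0 < tau ->
  nonincreasing_seq (fun n => Garg_sum tau n.+1 - tau * ln n.+1%:R).
Proof.
move=> t0; apply/nonincreasing_seqP => n.
rewrite [X in X - _ <= _]/Garg_sum big_ord_recr /= -/(Garg_sum tau n.+1).
suff : atan (tau / n.+2%:R) <= tau * (ln n.+2%:R - ln n.+1%:R) by lra.
apply: le_trans (atan_le _) _; first by rewrite divr_ge0// ltW.
rewrite ler_pM2l// -ln_div ?posrE ?ltr0n//.
have -> : n.+2%:R / n.+1%:R = (1 - n.+2%:R^-1)^-1 :> R.
  by rewrite -!natr1; have : 0 <= n%:R :> R by []; move=> ?; field; lra.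
rewrite lnV ?posrE ?subr_gt0 ?invf_lt1 ?ltr1n ?ltr0n//.
by rewrite lerNr le_ln1Dx// ltrN2 invf_lt1 ?ltr1n ?ltr0n.
Qed.

(** Here the logarithm runs one index ahead of the sum, unlike in [Garg_seq_ni]: this companion
    sequence eventually increases, lies below the other one, and so supplies the lower bound for its
    convergence. *)
Lemma Garg_sum_ge tau (n m : nat) : 0 < tau -> tau ^+ 2 <= n.+1%:R -> (n <= m)%N ->
  Garg_sum tau n - tau * ln n.+1%:R <= Garg_sum tau m - tau * ln m.+1%:R.
Proof.
move=> t0 tn /subnK <-; elim: (m - n)%N => [|k IH]; first by rewrite add0n.
rewrite addSn; apply: le_trans IH _; set j := (k + n)%N.
rewrite [X in _ <= X - _]/Garg_sum big_ord_recr /= -/(Garg_sum tau j).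
suff : tau * (ln j.+2%:R - ln j.+1%:R) <= atan (tau / j.+1%:R) by lra.
rewrite -ln_div ?posrE ?ltr0n//.
have -> : j.+2%:R / j.+1%:R = 1 + j.+1%:R^-1 :> R.
  by rewrite -!natr1; have : 0 <= j%:R :> R by []; move=> ?; field; lra.
apply: ln1D_le_atan => //; rewrite ?invr_ge0// ler_pdivrMr ?ltr0n// mul1r.
by rewrite (le_trans tn)// ler_nat ltnS leq_addl.
Qed.

Lemma cvg_Garg tau : (fun n => Garg_sum tau n - tau * ln n%:R) @ \oo --> Garg tau.
Proof.
wlog t0 : tau / 0 <= tau.
  move=> H; have [|/ltW t0] := leP 0 tau; first exact: H.
  have c : (fun n => Garg_sum tau n - tau * ln n%:R) @ \oo --> - Garg (- tau).
    have -> : (fun n => Garg_sum tau n - tau * ln n%:R) =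
      (fun n => - (Garg_sum (- tau) n - (- tau) * ln n%:R)).
      by apply/funext => n; rewrite Garg_sumN; ring.
    by apply: cvgN; apply: H; rewrite oppr_ge0.
  have -> : Garg tau = - Garg (- tau) by exact: cvg_lim c.
  exact: c.
move: t0; rewrite le_eqVlt => /predU1P[<-|t0].
  rewrite /Garg (_ : (fun n => _) = cst 0); first by rewrite lim_cst//; exact: cvg_cst.
  apply/funext => n; rewrite mul0r subr0 /Garg_sum big1// => j _.
  by rewrite mul0r atan0.
suff : cvgn (fun n => Garg_sum tau n.+1 - tau * ln n.+1%:R).
  move/(cvgP _) => c; rewrite /Garg.
  apply/cvg_ex; case/cvg_ex : c => l c; exists l.
  by move: c; rewrite -(@cvg_shiftS _ (fun n => Garg_sum tau n - tau * ln n%:R)).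
apply: nonincreasing_is_cvgn; first exact: Garg_seq_ni.
have [N tN] : exists N : nat, tau ^+ 2 <= N.+1%:R.
  exists (Num.truncn (tau ^+ 2)); apply: ltW; exact: truncnS_gt.
exists (Garg_sum tau N - tau * ln N.+1%:R) => _ [n _ <-].
apply: le_trans (Garg_seq_ni t0 (leq_maxl n N)).
apply: le_trans (Garg_sum_ge t0 tN (_ : N <= (maxn n N).+1)%N) _.
  by rewrite leqW// leq_maxr.
by rewrite lerD2l lerN2 ler_pM2l// ler_ln ?posrE ?ltr0n// ler_nat.
Qed.

(** The first term of the nonincreasing sequence is [atan tau]. With [Garg_ge0] this keeps the
    phases of order [tau] near [tau = 0], where the kernel divides by [sinh]. *)
Lemma Garg_le tau : 0 < tau -> Garg tau <= tau.
Proof.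
move=> t0; have := @cvg_Garg tau; rewrite -cvg_shiftS /= => c.
rewrite -(cvg_lim _ c)//; apply: limr_le; first by apply/cvg_ex; eexists; exact: c.
near=> n; apply: le_trans (Garg_seq_ni t0 (leq0n n)) _.
rewrite ln1 mulr0 subr0 /Garg_sum big_ord_recr big_ord0 /= add0r divr1.
by rewrite atan_le// ltW.
Unshelve. all: by end_near. Qed.

(** For [tau <= 1] the increasing companion sequence may be started at index 0, where it is 0. *)
Lemma Garg_ge0 tau : 0 < tau <= 1 -> 0 <= Garg tau.
Proof.
move=> /andP[t0 t1]; have := @cvg_Garg tau; rewrite -cvg_shiftS /= => c.
rewrite -(cvg_lim _ c)//; apply: limr_ge; first by apply/cvg_ex; eexists; exact: c.
near=> n; have h : tau ^+ 2 <= 1%:R by rewrite expr_le1// ltW.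
have := Garg_sum_ge t0 h (leq0n n.+1).
rewrite ln1 mulr0 subr0 {1}/Garg_sum big_ord0 => /le_trans; apply.
by rewrite lerD2l lerN2 ler_pM2l// ler_ln ?posrE ?ltr0n// ler_nat.
Unshelve. all: by end_near. Qed.

Lemma GargN tau : Garg (- tau) = - Garg tau.
Proof.
rewrite {1}/Garg; apply: cvg_lim => //.
have -> : (fun n => Garg_sum (- tau) n - (- tau) * ln n%:R) =
      (fun n => - (Garg_sum tau n - tau * ln n%:R)).
  by apply/funext => n; rewrite Garg_sumN; ring.
by apply: cvgN; exact: cvg_Garg.
Qed.

Lemma GmodN tau : Gmod (- tau) = Gmod tau.
Proof. by rewrite /Gmod Gmod_prodN. Qed.

End GammaOnLine.

(** * Polar form of 1 / Gamma (k + 1 + i tau) *)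

Section Cis.
Context {R : realType}.
Local Open Scope complex_scope.
Implicit Types (z : R[i]) (t x tau : R).

Definition cis t : R[i] := cos t +i* sin t.

Lemma cisD t x : cis (t + x) = cis t * cis x.
Proof.
by apply/eqP; rewrite eq_complex /= cosD sinD; apply/andP; split; apply/eqP; ring.
Qed.

Lemma cis0 : cis 0 = 1.
Proof. by rewrite /cis cos0 sin0. Qed.

Lemma cisN t : cis (- t) = (cis t)^-1.
Proof.
by apply/esym/divr1_eq; rewrite -invfM -cisD subrr cis0 invr1.
Qed.

Lemma cexpE t x : cexp (t +i* x) = (expR t)%:C * cis x.
Proof. by []. Qed.

Lemma sin_atan x : sin (atan x) = x / Num.sqrt (1 + x ^+ 2).
Proof.
have := atanK x; rewrite /tan cos_atan invrK => E; apply: (canRL (mulfK _) E).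
by rewrite gt_eqF// sqrtr_gt0 ltr_pwDl ?sqr_ge0.
Qed.

Lemma prod_succ_line tau m :
  \prod_(j < m) (j.+1%:R + tau *i) =
  (m`!%:R * Gmod_prod tau m)%:C * cis (Garg_sum tau m).
Proof.
elim: m => [|m IH].
  by rewrite /Gmod_prod /Garg_sum !big_ord0 fact0 mulr1 cis0 mulr1.
rewrite big_ord_recr /= IH /Gmod_prod /Garg_sum !big_ord_recr /= cisD factS natrM.
set p := \prod_(_ < _) _; set s := \sum_(_ < _) _; set w : R := m.+1%:R.
have -> : m.+1%:R + tau *i =
    (w * Num.sqrt (1 + tau ^+ 2 / w ^+ 2))%:C * cis (atan (tau / w)).
  rewrite /cis cos_atan sin_atan exprMn exprVn.
  have w0 : w != 0 by rewrite pnatr_eq0.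
  have q0 : Num.sqrt (1 + tau ^+ 2 / w ^+ 2) != 0.
    by rewrite gt_eqF// sqrtr_gt0 ltr_pwDl ?divr_ge0 ?sqr_ge0.
  have -> : m.+1%:R = w%:C :> R[i] by rewrite /w rmorph_nat.
  by apply/eqP; rewrite eq_complex /=; apply/andP; split; apply/eqP; field; apply/andP.
rewrite mulrACA -rmorphM; congr ((_ : R)%:C * _); rewrite -/w; ring.
Qed.

Lemma limn_complexS (u : R[i]^nat) z :
  (fun n => complex.Re (u n.+1)) @ \oo --> complex.Re z ->
  (fun n => complex.Im (u n.+1)) @ \oo --> complex.Im z ->
  limn (u : (R[i]^o)^nat) = z.
Proof.
by move=> cr ci; apply: limn_complex;
  [rewrite -(cvg_shiftS (fun n => complex.Re (u n)))
  |rewrite -(cvg_shiftS (fun n => complex.Im (u n)))].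
Qed.

Lemma cvg_shift_ratio (k : nat) :
  (fun n => (n + k).+1%:R / n.+1%:R : R) @ \oo --> (1 : R).
Proof.
have -> : (fun n => (n + k).+1%:R / n.+1%:R : R) = (fun n => 1 + k%:R * n.+1%:R^-1).
  apply/funext => n; rewrite -addSn natrD mulrDl divff// pnatr_eq0//.
rewrite -[X in _ --> X]addr0 -[X in _ --> _ + X](mulr0 (k%:R : R)).
by apply: cvgD; [exact: cvg_cst|apply: cvgMr; exact: cvg_harmonic].
Qed.

Lemma cvg_fact_ratio (k : nat) :
  (fun n => (n.+1 + k)`!%:R / (n.+1`!%:R * n.+1%:R ^+ k) : R) @ \oo --> (1 : R).
Proof.
elim: k => [|k IH].
  under eq_cvg do rewrite addn0 expr0 mulr1 divff ?pnatr_eq0 -?lt0n ?fact_gt0//.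
  exact: cvg_cst.
rewrite -[X in _ --> X](mulr1 (1 : R)).
have -> : (fun n => (n.+1 + k.+1)`!%:R / (n.+1`!%:R * n.+1%:R ^+ k.+1) : R) =
  (fun n => (n.+1 + k)`!%:R / (n.+1`!%:R * n.+1%:R ^+ k) * ((n + k.+1).+1%:R / n.+1%:R)).
  apply/funext => n; rewrite addnS factS natrM exprS addSn.
  have n0 : n.+1%:R != 0 :> R by rewrite pnatr_eq0.
  have f0 : n.+1`!%:R != 0 :> R by rewrite pnatr_eq0 -lt0n fact_gt0.
  have F (a b c d e : R) : a != 0 -> b != 0 -> c != 0 ->
      d * e / (c * (b * a)) = e / (c * a) * (d / b).
    by move=> a0 b0 c0; field; rewrite a0 b0 c0.
  by rewrite addnS F// expf_neq0.
by apply: cvgM => //; exact: cvg_shift_ratio.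
Qed.

(** Gauss's product for k + 1 + i tau is the product of the j + i tau from j = 1 on, divided by its
    first k factors. In polar form, [rr] and [pp] are the modulus and the argument of its terms, and
    they converge separately. *)
Lemma inv_Gamma_line tau k : inv_Gamma (k%:R + tau *i + 1) =
  (Gmod tau / (k`!%:R * Gmod_prod tau k))%:C * cis (Garg tau - Garg_sum tau k).
Proof.
set r := Gmod tau / _; set p := Garg tau - _.
pose rr n := (n.+1 + k.+1)`!%:R / (n.+1`!%:R * n.+1%:R ^+ k.+1) *
  (Gmod_prod tau (n.+1 + k.+1) / (k`!%:R * Gmod_prod tau k)).
pose pp n := Garg_sum tau (n.+1 + k.+1) - tau * ln n.+1%:R - Garg_sum tau k.
have cr : rr @ \oo --> r.
  rewrite -(mul1r r); apply: cvgM; first exact: cvg_fact_ratio.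
  apply: cvgMl.
  rewrite (_ : (fun n => _) = (fun n => Gmod_prod tau (n + k.+2))).
    by rewrite (cvg_shiftn k.+2); exact: cvg_Gmod.
  by apply/funext => n; rewrite addSnnS.
have cp : pp @ \oo --> p.
  apply: cvgB; last exact: cvg_cst.
  have -> : (fun n => Garg_sum tau (n.+1 + k.+1) - tau * ln n.+1%:R) =
    (fun n => (Garg_sum tau (n + k.+2) - tau * ln (n + k.+2)%:R)
              + tau * ln ((n + k.+1).+1%:R / n.+1%:R)).
    apply/funext => n; rewrite addSnnS -[(n + k.+1).+1]addnS.
    by rewrite ln_div ?posrE ?ltr0n ?addnS//; ring.
  rewrite -[X in _ --> X]addr0 -[X in _ --> _ + X](mulr0 tau) -[X in _ * X]ln1.
  apply: cvgD.
    rewrite (cvg_shiftn k.+2 (fun n => Garg_sum tau n - tau * ln n%:R)).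
    exact: cvg_Garg.
  apply: cvgMr; apply: (cvg_comp _ (@ln R) (cvg_shift_ratio k.+1)).
  exact: continuous_ln.
have E n : (\prod_(j < n.+2) (k%:R + tau *i + 1 + j%:R)) /
    (n.+1`!%:R * cpow n.+1%:R (k%:R + tau *i + 1)) = (rr n)%:C * cis (pp n) :> R[i].
  have k0 : (k`!%:R * Gmod_prod tau k)%:C * cis (Garg_sum tau k) != 0.
    rewrite -prod_succ_line; apply/prodf_neq0 => j _.
    have -> : j.+1%:R = (j.+1%:R : R)%:C by rewrite rmorph_nat.
    by rewrite eq_complex /= addr0 pnatr_eq0.
  have -> : \prod_(j < n.+2) (k%:R + tau *i + 1 + j%:R) =
      (((n.+1 + k.+1)`!%:R * Gmod_prod tau (n.+1 + k.+1))%:C * cis (Garg_sum tau (n.+1 + k.+1)))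
      / ((k`!%:R * Gmod_prod tau k)%:C * cis (Garg_sum tau k)) :> R[i].
    apply: (canRL (mulfK k0)); rewrite -!prod_succ_line.
    have -> : (n.+1 + k.+1)%N = (k + n.+2)%N by rewrite addnC addSnnS.
    rewrite big_split_ord /= mulrC; congr (_ * _).
    by apply: eq_bigr => j _; rewrite -natr1 natrD; ring.
  have -> : cpow n.+1%:R (k%:R + tau *i + 1) =
      (n.+1%:R ^+ k.+1)%:C * cis (tau * ln n.+1%:R) :> R[i].
    rewrite /cpow.
    have -> : (k%:R + tau *i + 1) * (ln n.+1%:R)%:C =
       (k.+1%:R * ln n.+1%:R) +i* (tau * ln n.+1%:R) :> R[i].
      have -> : k%:R = (k%:R : R)%:C :> R[i] by rewrite rmorph_nat.
      apply/eqP; rewrite eq_complex /= -natr1; apply/andP; split; apply/eqP; ring.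
    by rewrite cexpE expRM_natl lnK// posrE ltr0n.
  rewrite /rr /pp 2!cisD !cisN -[n.+1`!%:R](rmorph_nat (real_complex R)).
  rewrite !(rmorphM, fmorphV) /=.
  have F (a b c d e f g h i : R[i]) :
      a * b * c / (d * e * f) / (g * (h * i)) = a / (g * h) * (b / (d * e)) * (c / i / f).
    by rewrite !invfM; ring.
  exact: F.
(* The shift discards the term n = 0, in which n^z has no meaning. *)
apply: limn_complexS.
  under eq_cvg do rewrite E /= mul0r subr0.
  rewrite /= mul0r subr0; apply: cvgM => //.
  by apply: (cvg_comp _ (@cos R) cp); exact: continuous_cos.
under eq_cvg do rewrite E /= mul0r addr0.
rewrite /= mul0r addr0; apply: cvgM => //.
by apply: (cvg_comp _ (@sin R) cp); exact: continuous_sin.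
Qed.

End Cis.

(** * Power series with coefficients O(1 / k!) *)

Section EntireSeries.
Context {R : realType}.
Implicit Types (a : R^nat) (x C : R).

(* Coefficients bounded by [C / k!]: a class closed under [pseries_diffs]. *)
Definition fact_bounded C a := forall k, `|a k| <= C / k`!%:R.

Lemma fact_bounded_diffs C a : fact_bounded C a -> fact_bounded C (pseries_diffs a).
Proof.
move=> aC k; rewrite /pseries_diffs normrM ger0_norm//.
by have := aC k.+1; rewrite factS natrM invfM mulrCA -ler_pdivlMl ?invr_gt0 ?ltr0n// invrK.
Qed.

Lemma fact_bounded_cvg C a x : fact_bounded C a -> cvgn (pseries a x).
Proof.
move=> aC; apply: normed_cvg.
have H := is_cvg_seriesZ (k := C) (is_cvg_series_exp_coeff `|x|).
apply: series_le_cvg H => [n|n|n].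
- exact: normr_ge0.
- by rewrite -[_ n]/(C * _) mulr_ge0// ?exp_coeff_ge0//;
    have := le_trans (normr_ge0 _) (aC 0); rewrite fact0 divr1.
rewrite -[(C *: _) n]/(C * (_ ^+ n / _)) /= normrM normrX mulrCA mulrC.
by rewrite ler_wpM2l ?exprn_ge0// aC.
Qed.

Lemma fact_bounded_is_derive C a x : fact_bounded C a ->
  is_derive x 1 (fun x => limn (pseries a x)) (limn (pseries (pseries_diffs a) x)).
Proof.
move=> aC; have aC1 := fact_bounded_diffs aC; have aC2 := fact_bounded_diffs aC1.
apply: (@pseries_snd_diffs _ _ (`|x| + 1)); [exact: fact_bounded_cvg aC|
  exact: fact_bounded_cvg aC1|exact: fact_bounded_cvg aC2|].
by rewrite [ltRHS]ger0_norm ?ltrDl// addr_ge0.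
Qed.

(** The Euler operator x d/dx multiplies the k-th coefficient by k; this lets the differential
    equation be checked coefficient by coefficient. *)
Lemma pseries_diffs_mul C a x : fact_bounded C a ->
  series (fun k => k%:R * a k * x ^+ k) @ \oo --> x * limn (pseries (pseries_diffs a) x).
Proof.
move=> aC; have c := pseries_diffs_equiv (fact_bounded_cvg (x := x) (fact_bounded_diffs aC)).
have -> : series (fun k => k%:R * a k * x ^+ k) =
    (fun n => x * series (fun i => i%:R * a i * x ^+ i.-1) n).
  apply/funext => n; rewrite /series /= mulr_sumr; apply: eq_bigr => -[|k] _.
    by rewrite !mul0r mulr0.
  by rewrite exprS /=; ring.
by apply: cvgMr.
Qed.

End EntireSeries.

(** * The Bessel series at imaginary order and their differential equation *)

Section BesselSeries.
Context {R : realType}.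
Implicit Types (sg tau psi t s : R) (k : nat).

(* Up to the factor [Gmod tau], the real and imaginary parts of I_(i tau)(y)
   (sg = 1) and J_(i tau)(y) (sg = -1) are [bser sg tau psi (ln (y / 2))], with
   psi = Garg tau + pi / 2 and psi = Garg tau respectively; [bser'] is the
   derivative in t = ln (y / 2). *)
Definition bwt s k : R := s ^+ k / k`!%:R ^+ 2.
Definition bcoef tau k : R := (k`!%:R ^+ 2 * Gmod_prod tau k)^-1.
Definition bphase tau psi t k : R := tau * t + psi - Garg_sum tau k.
Definition bterm sg tau psi t k : R :=
  sg ^+ k * bcoef tau k * (expR t ^+ 2) ^+ k * sin (bphase tau psi t k).
Definition bser sg tau psi t : R := limn (series (bterm sg tau psi t)).
Definition bterm' sg tau psi t k : R := sg ^+ k * bcoef tau k * (expR t ^+ 2) ^+ k *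
  (2 * k%:R * sin (bphase tau psi t k) + tau * cos (bphase tau psi t k)).
Definition bser' sg tau psi t : R := limn (series (bterm' sg tau psi t)).

Lemma factR_gt0 k : 0 < k`!%:R :> R.
Proof. by rewrite ltr0n fact_gt0. Qed.

Lemma factR_ge1 k : 1 <= k`!%:R :> R.
Proof. by rewrite ler1n fact_gt0. Qed.

Lemma bcoef_gt0 tau k : 0 < bcoef tau k.
Proof.
by rewrite invr_gt0 mulr_gt0 ?exprn_gt0 ?factR_gt0// (lt_le_trans ltr01)// Gmod_prod_ge1.
Qed.

Lemma bcoef_le tau k : bcoef tau k <= (k`!%:R ^+ 2)^-1.
Proof.
rewrite lef_pV2 ?posrE ?exprn_gt0 ?factR_gt0//.
  by rewrite ler_peMr ?Gmod_prod_ge1// exprn_ge0// ltW// factR_gt0.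
by rewrite mulr_gt0 ?exprn_gt0 ?factR_gt0// (lt_le_trans ltr01)// Gmod_prod_ge1.
Qed.

Lemma bcoefS tau k : bcoef tau k.+1 =
  bcoef tau k / (k.+1%:R ^+ 2 * Num.sqrt (1 + tau ^+ 2 / k.+1%:R ^+ 2)).
Proof.
rewrite /bcoef /Gmod_prod big_ord_recr factS natrM exprMn -invfM /=; congr (_^-1); ring.
Qed.

Variables (sg tau psi : R).
Hypothesis sg1 : `|sg| = 1.

Let bcos k := sg ^+ k * bcoef tau k * cos (psi - Garg_sum tau k).
Let bsin k := sg ^+ k * bcoef tau k * sin (psi - Garg_sum tau k).

Let coef_bounded k (c : R) : `|c| <= 1 -> `|sg ^+ k * bcoef tau k * c| <= 1 / k`!%:R.
Proof.
move=> c1; rewrite !normrM normrX sg1 expr1n !mul1r (ger0_norm (ltW (bcoef_gt0 _ _))).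
apply: (@le_trans _ _ (bcoef tau k)); first by rewrite ler_piMr// ltW// bcoef_gt0.
apply: le_trans (bcoef_le _ _) _.
rewrite lef_pV2 ?posrE ?exprn_gt0 ?factR_gt0//.
by rewrite expr2 ler_peMr ?factR_ge1// ltW// factR_gt0.
Qed.

Let bcos_bounded : fact_bounded 1 bcos.
Proof. by move=> k; apply: coef_bounded; exact: cos_max. Qed.

Let bsin_bounded : fact_bounded 1 bsin.
Proof. by move=> k; apply: coef_bounded; exact: sin_max. Qed.

Let q k := Num.sqrt (1 + tau ^+ 2 / k.+1%:R ^+ 2).
Let q2 k : q k ^+ 2 = 1 + tau ^+ 2 / k.+1%:R ^+ 2.
Proof. by rewrite sqr_sqrtr// addr_ge0// divr_ge0 ?sqr_ge0. Qed.
Let q0 k : q k != 0.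
Proof. by rewrite gt_eqF// sqrtr_gt0 ltr_pwDl ?divr_ge0 ?sqr_ge0. Qed.

(** With c_k = [bcos k] + i [bsin k], these are the real and imaginary parts of n (n + i tau)
    c_(k+1) = sg c_k for n = k + 1, since n + i tau = n [q k] e^(i atan(tau/n)). *)
Let coef_rec k :
  k.+1%:R ^+ 2 * bcos k.+1 - tau * k.+1%:R * bsin k.+1 = sg * bcos k /\
  k.+1%:R ^+ 2 * bsin k.+1 + tau * k.+1%:R * bcos k.+1 = sg * bsin k.
Proof.
rewrite /bcos /bsin bcoefS -/(q k).
have -> : psi - Garg_sum tau k.+1 = (psi - Garg_sum tau k) - atan (tau / k.+1%:R).
  by rewrite /Garg_sum big_ord_recr /=; ring.
move: (psi - _) => u; rewrite cosB sinB cos_atan sin_atan exprMn exprVn -/(q k) (exprS sg).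
move: (cos _) (sin _) (bcoef _ _) (sg ^+ k) => C S d e.
have n0 : k.+1%:R != 0 :> R by rewrite pnatr_eq0.
have T : tau ^+ 2 = (q k ^+ 2 - 1) * k.+1%:R ^+ 2 by rewrite q2; field.
have qq := q0 k; move: (q k) (k.+1%:R : R) qq n0 T => r n r0 n0 T.
split.
  transitivity (sg * e * d * C * (n ^+ 2 + tau ^+ 2) / (n ^+ 2 * r ^+ 2)).
    by field; rewrite n0 r0.
  by rewrite T; field; rewrite n0 r0.
transitivity (sg * e * d * S * (n ^+ 2 + tau ^+ 2) / (n ^+ 2 * r ^+ 2)).
  by field; rewrite n0 r0.
by rewrite T; field; rewrite n0 r0.
Qed.

Let P (a : R^nat) s := limn (pseries a s).
Let D (a : R^nat) := pseries_diffs a.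

(** For f(s) = sum c_k s^k the recurrence says s f'' + (1 + i tau) f' = sg f; the two lines are its
    real and imaginary parts. *)
Let ode_coef s :
  s * P (D (D bcos)) s + P (D bcos) s - tau * P (D bsin) s = sg * P bcos s /\
  s * P (D (D bsin)) s + P (D bsin) s + tau * P (D bcos) s = sg * P bsin s.
Proof.
have cD a : fact_bounded 1 a -> series (fun k => D a k * s ^+ k) @ \oo --> P (D a) s.
  by move=> aC; apply: fact_bounded_cvg (fact_bounded_diffs aC).
have cDD a : fact_bounded 1 a ->
    series (fun k => k%:R * D a k * s ^+ k) @ \oo --> s * P (D (D a)) s.
  by move=> aC; apply: pseries_diffs_mul (fact_bounded_diffs aC).
have c0 a : fact_bounded 1 a -> (fun n => sg * series (fun k => a k * s ^+ k) n) @ \oo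
     --> sg * P a s.
  by move=> aC; apply: cvgMr; apply: fact_bounded_cvg aC.
split.
  have c1 : (fun n => series (fun k => k%:R * D bcos k * s ^+ k) n
        + series (fun k => D bcos k * s ^+ k) n - tau * series (fun k => D bsin k * s ^+ k) n)
        @ \oo --> s * P (D (D bcos)) s + P (D bcos) s - tau * P (D bsin) s.
    apply: cvgB; first by apply: cvgD; [exact: cDD|exact: cD].
    by apply: cvgMr; exact: cD.
  rewrite -(cvg_lim _ c1)//; apply: cvg_lim => //.
  rewrite (_ : (fun n => _) = (fun n => sg * series (fun k => bcos k * s ^+ k) n)).
    exact: c0.
  apply/funext => n; rewrite /series /= !mulr_sumr -!(big_split, sumrB) /=.
  apply: eq_bigr => k _; rewrite [RHS]mulrA -(coef_rec k).1 /D /pseries_diffs -!natr1; ring.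
have c1 : (fun n => series (fun k => k%:R * D bsin k * s ^+ k) n
      + series (fun k => D bsin k * s ^+ k) n + tau * series (fun k => D bcos k * s ^+ k) n)
      @ \oo --> s * P (D (D bsin)) s + P (D bsin) s + tau * P (D bcos) s.
  apply: cvgD; first by apply: cvgD; [exact: cDD|exact: cD].
  by apply: cvgMr; exact: cD.
rewrite -(cvg_lim _ c1)//; apply: cvg_lim => //.
rewrite (_ : (fun n => _) = (fun n => sg * series (fun k => bsin k * s ^+ k) n)).
  exact: c0.
apply/funext => n; rewrite /series /= !mulr_sumr -!(big_split, sumrB) /=.
apply: eq_bigr => k _; rewrite [RHS]mulrA -(coef_rec k).2 /D /pseries_diffs -!natr1; ring.
Qed.

(** Splitting the phase shows that [bser] is the imaginary part of e^(i tau t) f(e^(2t)), so it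
    inherits smoothness from an entire function. *)
Let bserE t : series (bterm sg tau psi t) @ \oo -->
  sin (tau * t) * P bcos (expR t ^+ 2) + cos (tau * t) * P bsin (expR t ^+ 2).
Proof.
have -> : series (bterm sg tau psi t) = (fun n =>
    sin (tau * t) * pseries bcos (expR t ^+ 2) n + cos (tau * t) * pseries bsin (expR t ^+ 2) n).
  apply/funext => n; rewrite /pseries /series /= !mulr_sumr -big_split /=.
  apply: eq_bigr => k _; rewrite /bterm /bphase /bcos /bsin -addrA (sinD (tau * t)).
  by move: (sg ^+ k) (bcoef tau k) (_ ^+ k) => e d x; ring.
by apply: cvgD; apply: cvgMr; [apply: fact_bounded_cvg bcos_bounded
  |apply: fact_bounded_cvg bsin_bounded].
Qed.

Lemma cvg_bser t : series (bterm sg tau psi t) @ \oo --> bser sg tau psi t.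
Proof. by apply/cvg_ex; eexists; exact: bserE. Qed.

Let bser'E t : series (bterm' sg tau psi t) @ \oo -->
  tau * (cos (tau * t) * P bcos (expR t ^+ 2) - sin (tau * t) * P bsin (expR t ^+ 2)) +
  2 * (sin (tau * t) * (expR t ^+ 2 * P (D bcos) (expR t ^+ 2)) +
       cos (tau * t) * (expR t ^+ 2 * P (D bsin) (expR t ^+ 2))).
Proof.
set s := expR t ^+ 2.
have -> : series (bterm' sg tau psi t) = (fun n =>
    tau * (cos (tau * t) * pseries bcos s n - sin (tau * t) * pseries bsin s n) +
    2 * (sin (tau * t) * series (fun k => k%:R * bcos k * s ^+ k) n +
         cos (tau * t) * series (fun k => k%:R * bsin k * s ^+ k) n)).
  apply/funext => n; rewrite /pseries /series /= !mulr_sumr -sumrB -big_split /=.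
  rewrite !mulr_sumr -big_split /=; apply: eq_bigr => k _.
  rewrite /bterm' /bphase /bcos /bsin -addrA (sinD (tau * t)) (cosD (tau * t)).
  by move: (sg ^+ k) (bcoef tau k) (_ ^+ k) => e d x; ring.
apply: cvgD; apply: cvgMr; [apply: cvgB|apply: cvgD]; apply: cvgMr.
- by apply: fact_bounded_cvg bcos_bounded.
- by apply: fact_bounded_cvg bsin_bounded.
- exact: pseries_diffs_mul bcos_bounded.
- exact: pseries_diffs_mul bsin_bounded.
Qed.

Let derivP a t : fact_bounded 1 a ->
  is_derive t 1 (fun t => P a (expR t ^+ 2)) (2 * expR t ^+ 2 * P (D a) (expR t ^+ 2)).
Proof.
move=> aC; have d := fact_bounded_is_derive (expR t ^+ 2) aC.
apply: is_derive_eq (is_derive1_comp (f := P a) (g := fun t => expR t ^+ 2) _ _) _.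
by rewrite /GRing.scale /= /P /D; ring.
Qed.

Let dsin t : is_derive t 1 (fun t => sin (tau * t)) (tau * cos (tau * t)).
Proof.
apply: is_derive_eq (is_derive1_comp (f := @sin R) (g := fun t => tau * t) _ _) _.
by rewrite /GRing.scale /=; ring.
Qed.

Let dcos t : is_derive t 1 (fun t => cos (tau * t)) (- tau * sin (tau * t)).
Proof.
apply: is_derive_eq (is_derive1_comp (f := @cos R) (g := fun t => tau * t) _ _) _.
by rewrite /GRing.scale /=; ring.
Qed.

Lemma is_derive_bser t : is_derive t 1 (bser sg tau psi) (bser' sg tau psi t).
Proof.
have -> : bser sg tau psi = (fun t =>
    sin (tau * t) * P bcos (expR t ^+ 2) + cos (tau * t) * P bsin (expR t ^+ 2)).
  by apply/funext => u; apply: cvg_lim => //; exact: bserE.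
have d1 := derivP t bcos_bounded; have d2 := derivP t bsin_bounded.
apply: is_derive_eq; rewrite /bser' (cvg_lim _ (@bser'E t))// /GRing.scale /=; ring.
Qed.

(* Bessel's equation in the variable [t = ln (y / 2)]. *)
Lemma is_derive_bser' t :
  is_derive t 1 (bser' sg tau psi) ((sg * 4 * expR t ^+ 2 - tau ^+ 2) * bser sg tau psi t).
Proof.
have -> : bser' sg tau psi = (fun t =>
  tau * (cos (tau * t) * P bcos (expR t ^+ 2) - sin (tau * t) * P bsin (expR t ^+ 2)) +
  2 * (sin (tau * t) * (expR t ^+ 2 * P (D bcos) (expR t ^+ 2)) +
       cos (tau * t) * (expR t ^+ 2 * P (D bsin) (expR t ^+ 2)))).
  by apply/funext => u; apply: cvg_lim => //; exact: bser'E.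
have d1 := derivP t bcos_bounded; have d2 := derivP t bsin_bounded.
have d3 := derivP t (fact_bounded_diffs bcos_bounded).
have d4 := derivP t (fact_bounded_diffs bsin_bounded).
have -> : bser sg tau psi t =
    sin (tau * t) * P bcos (expR t ^+ 2) + cos (tau * t) * P bsin (expR t ^+ 2).
  by apply: cvg_lim => //; exact: bserE.
apply: is_derive_eq; rewrite /GRing.scale /=.
have [E1 E2] := ode_coef (expR t ^+ 2).
set s := expR t ^+ 2 in E1 E2 *.
transitivity (4 * s * sin (tau * t) * (sg * P bcos s) + 4 * s * cos (tau * t) * (sg * P bsin s)
  - tau ^+ 2 * (sin (tau * t) * P bcos s + cos (tau * t) * P bsin s)); last by ring.
by rewrite -E1 -E2 /D /s; ring.
Qed.

End BesselSeries.

(** * Energy and comparison estimates for Bessel's equation in [t] *)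

Section BesselODE.
Context {R : realType}.
Implicit Types (t tau : R) (F U V Q : R -> R).

Let dexp2 t : is_derive t 1 (fun t => expR t ^+ 2) (2 * expR t ^+ 2).
Proof. by apply: is_derive_eq; rewrite /GRing.scale /=; ring. Qed.

(** In the derivative of F^2 + F'^2 / q the terms in F F' cancel, leaving -F'^2 q' / q^2 with q' = 8
    e^(2t). *)
Lemma oscillatory_energy tau F F1 (a b : R) : a <= b ->
  (forall t, is_derive t 1 F (F1 t)) ->
  (forall t, is_derive t 1 F1 (- (4 * expR t ^+ 2 + tau ^+ 2) * F t)) ->
  F b ^+ 2 <= F a ^+ 2 + F1 a ^+ 2 / (4 * expR a ^+ 2 + tau ^+ 2).
Proof.
move=> ab dF dF1; pose q t := 4 * expR t ^+ 2 + tau ^+ 2.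
have q0 t : 0 < q t by rewrite ltr_wpDr ?sqr_ge0// mulr_gt0// exprn_gt0// expR_gt0.
have dq t : is_derive t 1 q (8 * expR t ^+ 2).
  have ? := dexp2 t; rewrite /q.
  by apply: is_derive_eq; rewrite /GRing.scale /=; ring.
pose E t := F t ^+ 2 + F1 t ^+ 2 / q t.
have : E b <= E a.
  apply: (@derive_le0_le _ E (fun t => - (F1 t ^+ 2 * (8 * expR t ^+ 2) / q t ^+ 2)) a b ab) => t _.
    have ? := dF t; have ? := dF1 t; have ? := dq t.
    have ? : is_derive t 1 (fun t => (q t)^-1) (- (q t) ^- 2 *: (8 * expR t ^+ 2)).
      by apply: is_deriveV; rewrite gt_eqF.
    apply: is_derive_eq; rewrite /GRing.scale /= -/(q t).
    by field; rewrite gt_eqF.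
  rewrite oppr_le0; apply: divr_ge0; last exact: sqr_ge0.
  by apply: mulr_ge0; [exact: sqr_ge0|apply: mulr_ge0 => //; exact: sqr_ge0].
by apply: le_trans; rewrite lerDl divr_ge0 ?sqr_ge0// ltW.
Qed.

Lemma growth_energy tau F F1 (a b : R) : 0 < tau -> a <= b ->
  (forall t, is_derive t 1 F (F1 t)) ->
  (forall t, is_derive t 1 F1 ((4 * expR t ^+ 2 - tau ^+ 2) * F t)) ->
  tau ^+ 2 * F b ^+ 2 <= (F1 a ^+ 2 + tau ^+ 2 * F a ^+ 2) *
    expR (2 / tau * (expR b ^+ 2 - expR a ^+ 2)).
Proof.
move=> t0 ab dF dF1; pose e t := expR (- (2 / tau * expR t ^+ 2)).
have de t : is_derive t 1 e (- (4 / tau * expR t ^+ 2) * e t).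
  have ? := dexp2 t.
  apply: is_derive_eq (is_derive1_comp (f := @expR R)
    (g := fun t => - (2 / tau * expR t ^+ 2)) _ _) _.
  by rewrite /GRing.scale /= /e; field; rewrite gt_eqF.
pose E t := (F1 t ^+ 2 + tau ^+ 2 * F t ^+ 2) * e t.
have : E b <= E a.
  apply: (@derive_le0_le _ E (fun t => - (4 / tau * expR t ^+ 2 * (F1 t - tau * F t) ^+ 2 * e t))
    a b ab) => t _.
    have ? := dF t; have ? := dF1 t; have ? := de t.
    by apply: is_derive_eq; rewrite /GRing.scale /=; field; rewrite gt_eqF.
  rewrite oppr_le0; apply: mulr_ge0; last exact: expR_ge0.
  apply: mulr_ge0; last exact: sqr_ge0.
  by apply: mulr_ge0; [rewrite divr_ge0// ltW|exact: sqr_ge0].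
have -> : expR (2 / tau * (expR b ^+ 2 - expR a ^+ 2)) = e a / e b.
  by rewrite /e -expRN -expRD; congr expR; ring.
rewrite /E mulrA ler_pdivlMr ?expR_gt0//; apply: le_trans.
by rewrite ler_wpM2r ?expR_ge0// lerDr sqr_ge0.
Qed.

(* If [U * U1 > 0] at some [t >= a], then the same holds for [Z = U - e * V] with
   [e] small. As [Z * Z' * exp (- t)] is nondecreasing, [Z ^+ 2] increases after [t]
   and has no zero there; but [Z T = 0] for [e = U T / V T], which is small for [T]
   large. *)
Lemma recessive_nonincreasing U U1 V V1 Q (a b : R) : a <= b ->
  (forall t, is_derive t 1 U (U1 t)) -> (forall t, is_derive t 1 V (V1 t)) ->
  (forall t, is_derive t 1 U1 (U1 t + Q t * U t)) ->
  (forall t, is_derive t 1 V1 (V1 t + Q t * V t)) ->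
  (forall t, a <= t -> 0 <= Q t) ->
  (forall d : R, 0 < d -> exists t0 : R, forall t, t0 <= t -> 0 < V t /\ `|U t| <= d * V t) ->
  U b ^+ 2 <= U a ^+ 2.
Proof.
move=> ab dU dV dU1 dV1 Q0 UV.
apply: (@derive_le0_le _ (fun t => U t ^+ 2) (fun t => 2 * (U t * U1 t)) a b ab) => t.
  move=> _; have ? := dU t; apply: is_derive_eq; rewrite /GRing.scale /=; ring.
move=> /andP[at_ _]; rewrite leNgt; apply/negP; rewrite pmulr_rgt0// => g0.
(* For |e| <= d <= 1 the product [Z t * Z1 t] differs from [U t * U1 t] by at most d M, the
   quadratic term in e being absorbed by |e| <= 1. *)
pose M : R := `|U t * V1 t| + `|V t * U1 t| + `|V t * V1 t|.
have M0 : 0 <= M by rewrite !addr_ge0.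
pose d : R := Num.min 1 (U t * U1 t / (2 * (M + 1))).
have d0 : 0 < d by rewrite lt_min ltr01 divr_gt0// mulr_gt0// ltr_wpDl.
have d1 : d <= 1 by rewrite ge_min lexx.
have dM : d * M < U t * U1 t.
  have : d * (2 * (M + 1)) <= U t * U1 t.
    by rewrite -ler_pdivlMr ?mulr_gt0 ?ltr_wpDl// ge_min lexx orbT.
  by nra.
have [t0 Ht0] := UV _ d0.
pose T : R := Num.max t t0; have tT : t <= T by rewrite le_max lexx.
have [VT UT] : 0 < V T /\ `|U T| <= d * V T by apply: Ht0; rewrite le_max lexx orbT.
pose e : R := U T / V T.
have ed : `|e| <= d by rewrite normrM normfV (gtr0_norm VT) ler_pdivrMr.
pose Z t := U t - e * V t; pose Z1 t := U1 t - e * V1 t.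
have dZ (u : R) : is_derive u 1 Z (Z1 u).
  by have ? := dU u; have ? := dV u; apply: is_derive_eq; rewrite /GRing.scale /= /Z1; ring.
have dZ1 (u : R) : is_derive u 1 Z1 (Z1 u + Q u * Z u).
  by have ? := dU1 u; have ? := dV1 u; apply: is_derive_eq; rewrite /GRing.scale /= /Z1 /Z; ring.
have ZT : Z T = 0 by rewrite /Z /e divfK ?gt_eqF// subrr.
have Zt : 0 < Z t * Z1 t.
  have -> : Z t * Z1 t = U t * U1 t - (e * (U t * V1 t) + e * (V t * U1 t) - e * e * (V t * V1 t)).
    by rewrite /Z /Z1; ring.
  rewrite subr_gt0; apply: le_lt_trans dM.
  have h x y : `|y| <= d -> y * x <= d * `|x|.
    move=> yd; apply: le_trans (ler_norm _) _; rewrite normrM; exact: ler_wpM2r.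
  rewrite /M !mulrDr; apply: lerD; [apply: lerD; exact: h|].
  rewrite -mulNr; apply: h; rewrite normrN normrM.
  by rewrite -[leRHS]mulr1; apply: ler_pM => //; apply: le_trans ed d1.
have ZZ1 (u : R) : t <= u -> 0 < Z u * Z1 u.
  move=> tu; have : Z t * Z1 t * expR (- t) <= Z u * Z1 u * expR (- u).
    apply: (@derive_ge0_ge _ (fun u => Z u * Z1 u * expR (- u))
      (fun u => (Z1 u ^+ 2 + Q u * Z u ^+ 2) * expR (- u)) t u tu) => v.
      move=> _; have ? := dZ v; have ? := dZ1 v.
      by apply: is_derive_eq; rewrite /GRing.scale /=; ring.
    move=> /andP[tv _]; rewrite mulr_ge0 ?expR_ge0// addr_ge0 ?sqr_ge0// mulr_ge0 ?sqr_ge0//.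
    by apply: Q0; apply: le_trans tv.
  move=> h; have := lt_le_trans (mulr_gt0 Zt (expR_gt0 _)) h.
  by rewrite pmulr_lgt0 ?expR_gt0.
have : Z t ^+ 2 <= Z T ^+ 2.
  apply: (@derive_ge0_ge _ (fun t => Z t ^+ 2) (fun t => 2 * (Z t * Z1 t)) t T tT) => v.
    by move=> _; have ? := dZ v; apply: is_derive_eq; rewrite /GRing.scale /=; ring.
  by move=> /andP[tv _]; rewrite mulr_ge0// ltW// ZZ1.
rewrite ZT expr0n /= => Z0; have /eqP : Z t ^+ 2 = 0.
  by apply/eqP; rewrite eq_le Z0 sqr_ge0.
by rewrite expf_eq0 /= => /eqP Ze; move: Zt; rewrite Ze mul0r ltxx.
Qed.

End BesselODE.

Lemma series_norm_le (R : realType) (a b : R^nat) : cvgn (series b) ->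
  (forall k, `|a k| <= b k) -> `|limn (series a)| <= limn (series b).
Proof.
move=> cb ab; have b0 k : 0 <= b k by apply: le_trans (normr_ge0 _) (ab k).
have ca : cvgn [normed series a] by apply: series_le_cvg cb => // k; exact: normr_ge0.
by apply: le_trans (lim_series_norm ca) _; apply: lim_series_le.
Qed.

(** * Decay of the recessive solution *)

Section Weights.
Context {R : realType}.
Implicit Types (s N : R) (k : nat).

(** This is I_0(2 sqrt s), the total mass of the weights. *)
Definition bwt_sum s : R := limn (series (bwt s)).

Lemma bwt_ge0 s k : 0 <= s -> 0 <= bwt s k.
Proof. by move=> s0; rewrite divr_ge0 ?exprn_ge0. Qed.

Lemma bwt0 s : bwt s 0 = 1.
Proof. by rewrite /bwt fact0 expr1n divr1. Qed.

(** This ratio lowers the order of a moment by two, which yields the second and third moments from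
    the mass and the mean. *)
Lemma bwtS s k : k.+1%:R ^+ 2 * bwt s k.+1 = s * bwt s k.
Proof.
have k0 : k.+1%:R != 0 :> R by rewrite pnatr_eq0.
rewrite /bwt factS natrM (exprS s); have := factR_gt0 (R := R) k.
move: (_`!%:R) (s ^+ k) (k.+1%:R : R) k0 => f e n n0 f0.
by field; rewrite n0 gt_eqF.
Qed.

Lemma bwt_cvg s : 0 <= s -> cvgn (series (bwt s)).
Proof.
move=> s0; apply: series_le_cvg (is_cvg_series_exp_coeff s) => k.
- exact: bwt_ge0.
- exact: exp_coeff_ge0.
- rewrite /bwt /exp_coeff /= ler_wpM2l ?exprn_ge0//.
  rewrite lef_pV2 ?posrE ?exprn_gt0 ?factR_gt0//.
  by rewrite expr2 ler_peMr ?factR_ge1// ltW// factR_gt0.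
Qed.

Lemma bwt_sum_ge1 s : 0 <= s -> 1 <= bwt_sum s.
Proof.
move=> s0; have := @nondecreasing_cvgn_le _ (series (bwt s)).
move=> /(_ _ (bwt_cvg s0) 1%N); rewrite /series /= big_nat1 bwt0; apply.
by apply/nondecreasing_seqP => n; rewrite big_nat_recr//= lerDl bwt_ge0.
Qed.

Lemma cvg_series_shift (a : R^nat) (l : R) : a 0 = 0 ->
  series (fun k => a k.+1) @ \oo --> l -> series a @ \oo --> l.
Proof.
move=> a0 c; rewrite -cvg_shiftS.
rewrite (_ : (fun n => _) = series (fun k => a k.+1))//.
by apply/funext => n; rewrite /series /= big_nat_recl// a0 add0r.
Qed.

Lemma cvg_bwt2 s : 0 <= s ->
  series (fun k => k%:R ^+ 2 * bwt s k) @ \oo --> s * bwt_sum s.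
Proof.
move=> s0; apply: cvg_series_shift; first by rewrite expr0n mul0r.
rewrite (_ : series _ = (fun n => s * series (bwt s) n)).
  by apply: cvgMr; exact: bwt_cvg.
by apply/funext => n; rewrite /series /= mulr_sumr; apply: eq_bigr => k _; rewrite bwtS.
Qed.

Lemma bwt1_cvg s : 0 <= s -> cvgn (series (fun k => k%:R * bwt s k)).
Proof.
move=> s0; apply: series_le_cvg (cvgP _ (cvg_bwt2 s0)) => k.
- by rewrite mulr_ge0// bwt_ge0.
- by rewrite mulr_ge0 ?bwt_ge0// sqr_ge0.
- rewrite ler_wpM2r ?bwt_ge0//; case: k => [|k]; first by rewrite expr0n.
  by rewrite expr2 ler_peMr// ler1n.
Qed.

Lemma cvg_bwt3 s : 0 <= s -> series (fun k => k%:R ^+ 3 * bwt s k) @ \oo -->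
  s * (limn (series (fun k => k%:R * bwt s k)) + bwt_sum s).
Proof.
move=> s0; apply: cvg_series_shift; first by rewrite expr0n mul0r.
rewrite (_ : series (fun k => k.+1%:R ^+ 3 * bwt s k.+1) =
  (fun n => s * (series (fun k => k%:R * bwt s k) n + series (bwt s) n))).
  by apply: cvgMr; apply: cvgD; [exact: bwt1_cvg|exact: bwt_cvg].
apply/funext => n; rewrite /series /= -big_split mulr_sumr; apply: eq_bigr => k _.
by rewrite (exprS _ 2) -mulrA bwtS -natr1 /=; ring.
Qed.

(* The weighted third moment [sum k (k - N) ^+ 2] is nonnegative, which bounds the
   mean from below and hence the variance around [N] from above. *)
Lemma bwt_variance N : 0 < N ->
  cvgn (series (fun k => (k%:R - N) ^+ 2 * bwt (N ^+ 2) k)) /\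
  limn (series (fun k => (k%:R - N) ^+ 2 * bwt (N ^+ 2) k)) <= N * bwt_sum (N ^+ 2).
Proof.
move=> N0; have s0 := sqr_ge0 N; set s := N ^+ 2 in s0 *; set A := bwt_sum s.
have c0 : series (bwt s) @ \oo --> A by exact: bwt_cvg.
have c1 := bwt1_cvg s0; set m := limn (series (fun k => k%:R * bwt s k)).
have {}c1 : series (fun k => k%:R * bwt s k) @ \oo --> m by [].
have c2 := cvg_bwt2 s0; have c3 := cvg_bwt3 s0; rewrite -/m -/A in c2 c3.
have v : series (fun k => (k%:R - N) ^+ 2 * bwt s k) @ \oo --> s * A - 2 * N * m + s * A.
  rewrite (_ : series _ = (fun n => series (fun k => k%:R ^+ 2 * bwt s k) n
     - 2 * N * series (fun k => k%:R * bwt s k) n + s * series (bwt s) n)).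
    by apply: cvgD; [apply: cvgB => //; exact: cvgMr|exact: cvgMr].
  apply/funext => n; rewrite /series /= !mulr_sumr -sumrB -big_split; apply: eq_bigr => k _.
  by rewrite /= /s; ring.
have w : series (fun k => k%:R * (k%:R - N) ^+ 2 * bwt s k) @ \oo -->
    s * (m + A) - 2 * N * (s * A) + s * m.
  rewrite (_ : series _ = (fun n => series (fun k => k%:R ^+ 3 * bwt s k) n
     - 2 * N * series (fun k => k%:R ^+ 2 * bwt s k) n
     + s * series (fun k => k%:R * bwt s k) n)).
    by apply: cvgD; [apply: cvgB => //; exact: cvgMr|exact: cvgMr].
  apply/funext => n; rewrite /series /= !mulr_sumr -sumrB -big_split; apply: eq_bigr => k _.
  by rewrite /= /s; ring.
have w0 : 0 <= s * (m + A) - 2 * N * (s * A) + s * m.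
  rewrite -(cvg_lim _ w)//; apply: limr_ge; first exact: (cvgP _ w).
  near=> n; rewrite /series /=; apply: sumr_ge0 => k _.
  by rewrite mulr_ge0 ?bwt_ge0// mulr_ge0// sqr_ge0.
split; first exact: (cvgP _ v).
rewrite (cvg_lim _ v)//.
have sp : 0 < s by rewrite exprn_gt0.
(* That is, 2 m >= (2 N - 1) A, which makes the variance 2 N^2 A - 2 N m at most N A. *)
have h : 0 <= s * (m + A - 2 * N * A + m) by move: w0; congr (0 <= _); ring.
rewrite pmulr_rge0// in h.
have -> : s * A = N * (N * A) by rewrite /s; ring.
have : 0 <= N * (m + A - 2 * N * A + m) by rewrite pmulr_rge0.
by lra.
Unshelve. all: by end_near. Qed.

End Weights.

Section Asymptotics.
Context {R : realType}.
Implicit Types (tau eta t : R) (k : nat).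

(* For large [N = expR t] the phases of the terms with index close to [N], which
   carry most of the weight, are small. *)
Lemma bphase_small tau eta : 0 < eta -> exists2 d : R, 0 < d <= 1 & exists2 N0 : R, 0 < N0 &
  forall t k, N0 <= expR t -> (k%:R - expR t) ^+ 2 < d ^+ 2 * expR t ^+ 2 ->
    `|bphase tau (Garg tau) t k| <= eta.
Proof.
move=> eta0.
have e2 : 0 < eta / 2 by rewrite divr_gt0.
have /cvgrPdist_lt /(_ _ e2) [K _ HK] := @cvg_Garg _ tau.
(* For |x - 1| <= d <= 1/2 one has |ln x| <= 2 d, so tau ln(k/N) stays within eta / 2. *)
pose d : R := Num.min (1 / 2) (eta / (4 * (`|tau| + 1))).
have t1 : 0 < `|tau| + 1 by rewrite ltr_wpDl.
have d0 : 0 < d by rewrite lt_min !divr_gt0// mulr_gt0.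
have d12 : d <= 1 / 2 by rewrite ge_min lexx.
have de : 2 * d * `|tau| <= eta / 2.
  have : d * (4 * (`|tau| + 1)) <= eta.
    by rewrite -ler_pdivlMr ?mulr_gt0// ge_min lexx orbT.
  by nra.
exists d; first by rewrite d0 /=; lra.
exists (2 * K.+1%:R) => [|t k Nt kN]; first by rewrite mulr_gt0// ltr0n.
set N := expR t in Nt kN *.
have N0 : 0 < N by exact: expR_gt0.
have {kN} kN : `|k%:R - N| < d * N.
  by rewrite -(@ltr_pXn2r _ 2)// ?nnegrE ?mulr_ge0 ?ltW// real_normK ?num_real// exprMn.
move: kN; rewrite ltr_norml => /andP[k1 k2].
have Nk : N / 2 <= k%:R by nra.
have K1 : K.+1%:R <= (k%:R : R) by lra.
have Kk : (K <= k)%N by move: K1; rewrite ler_nat; apply: leq_trans.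
have k0 : 0 < k%:R :> R by apply: lt_le_trans K1; rewrite ltr0n.
(* The phase splits into the tail of the limit defining [Garg tau], small because k is large, and
   tau ln(k/N), small because k is close to N. *)
have -> : bphase tau (Garg tau) t k =
    (Garg tau - (Garg_sum tau k - tau * ln k%:R)) - tau * ln (k%:R / N).
  by rewrite ln_div ?posrE// /N expRK /bphase; ring.
have {HK} := HK k Kk; rewrite /= => HK.
apply: le_trans (ler_normB _ _) _.
have -> : eta = eta / 2 + eta / 2 by lra.
apply: lerD; first exact: ltW.
rewrite normrM; apply: le_trans de; rewrite mulrC ler_wpM2r// ler_norml.
have a1 : k%:R / N - 1 <= d by rewrite -(ler_pM2r N0) mulrBl divfK ?gt_eqF// mul1r; lra.
have a2 : - d <= k%:R / N - 1 by rewrite -(ler_pM2r N0) mulrBl divfK ?gt_eqF// mul1r; lra.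
set x := k%:R / N in a1 a2 *.
have x0 : 0 < x by rewrite divr_gt0.
apply/andP; split.
  rewrite -lerN2 opprK -lnV ?posrE//.
  apply: (@le_trans _ _ (x^-1 - 1)).
    rewrite -[in leLHS](subrK 1 x^-1) addrC le_ln1Dx//.
    by rewrite ltrBrDl subrr invr_gt0.
  rewrite -(ler_pM2r x0) mulrBl mulVf ?gt_eqF// mul1r; nra.
apply: (@le_trans _ _ (x - 1)); last by lra.
by rewrite -[in leLHS](subrK 1 x) addrC le_ln1Dx// ltrBrDl subrr.
Qed.

Lemma bterm_le sg tau psi t k : `|sg| = 1 ->
  `|bterm sg tau psi t k| <= bwt (expR t ^+ 2) k * `|sin (bphase tau psi t k)|.
Proof.
move=> sg1; rewrite /bterm !normrM normrX sg1 expr1n mul1r ler_wpM2r//.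
rewrite (ger0_norm (ltW (bcoef_gt0 _ _))) ger0_norm ?exprn_ge0 ?sqr_ge0//.
by rewrite /bwt mulrC ler_wpM2l ?exprn_ge0 ?sqr_ge0// bcoef_le.
Qed.

Lemma bcoef_ge tau k : (Gmod tau)^-1 / k`!%:R ^+ 2 <= bcoef tau k.
Proof.
have P0 : 0 < Gmod_prod tau k by apply: lt_le_trans (Gmod_prod_ge1 _ _).
rewrite /bcoef [leRHS]invfM [leRHS]mulrC ler_wpM2r ?invr_ge0 ?exprn_ge0//.
by rewrite lef_pV2 ?posrE ?Gmod_gt0// Gmod_ge_prod.
Qed.

(** Where the weight concentrates, the terms of one series carry sines near 0 and those of the other
    cosines near 1. With A the total mass and c = [Gmod tau], the first sum is at most 2 e A and the
    second at least A / c - 2 e A. *)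
Lemma bser_recessive tau (d : R) : 0 < d -> exists t0 : R, forall t, t0 <= t ->
  0 < bser 1 tau (Garg tau + pi / 2) t /\
  `|bser 1 tau (Garg tau) t| <= d * bser 1 tau (Garg tau + pi / 2) t.
Proof.
move=> d0; pose c : R := Gmod tau; have c0 : 0 < c := Gmod_gt0 tau.
have n1 : `|1 : R| = 1 by rewrite normr1.
pose e : R := Num.min 1 (Num.min (d / (8 * c)) ((8 * c)^-1)).
have c8 : 0 < 8 * c by rewrite mulr_gt0.
have e0 : 0 < e by rewrite !lt_min ltr01 /= divr_gt0// invr_gt0.
have e1 : e <= 1 by rewrite ge_min lexx.
have ed : e * (8 * c) <= d by rewrite -ler_pdivlMr// !ge_min lexx !orbT.
have ec : e * (8 * c) <= 1.
  by rewrite -ler_pdivlMr// mul1r !ge_min lexx !orbT.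
have [r /andP[r0 r1] [N0 N00 H]] := @bphase_small tau e e0.
pose N1 : R := Num.max N0 (2 / (e * r ^+ 2)).
have er0 : 0 < e * r ^+ 2 by rewrite mulr_gt0// exprn_gt0.
exists N1 => t tN.
set N := expR t; have N_gt0 : 0 < N by exact: expR_gt0.
have NN1 : N1 <= N by apply: le_trans tN _; apply: le_trans (expR_ge1Dx t); rewrite lerDr.
have NN0 : N0 <= N by apply: le_trans NN1; rewrite le_max lexx.
have Ne : 2 <= N * (e * r ^+ 2).
  by rewrite -ler_pdivrMr//; apply: le_trans NN1; rewrite le_max lexx orbT.
pose s := N ^+ 2; have s0 : 0 <= s by exact: sqr_ge0.
pose A := bwt_sum s; have A1 : 1 <= A := bwt_sum_ge1 s0.
have [cv lv] := bwt_variance N_gt0.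
pose ph := bphase tau (Garg tau) t.
(* Chebyshev majorant: the first part serves indices within r N of N, the second those farther away,
   where (k - N)^2 / (r N)^2 >= 1. The variance bound makes each part sum to at most e A. *)
pose b k : R := e * bwt s k + 2 / (r * N) ^+ 2 * ((k%:R - N) ^+ 2 * bwt s k).
have rN : 0 < (r * N) ^+ 2 by rewrite exprn_gt0// mulr_gt0.
have cb : series b @ \oo -->
    e * A + 2 / (r * N) ^+ 2 * limn (series (fun k => (k%:R - N) ^+ 2 * bwt s k)).
  rewrite (_ : series b = (fun n => e * series (bwt s) n +
     2 / (r * N) ^+ 2 * series (fun k => (k%:R - N) ^+ 2 * bwt s k) n)).
    by apply: cvgD; apply: cvgMr; [exact: bwt_cvg|].
  by apply/funext => n; rewrite /series /= !mulr_sumr -big_split.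
have lb : limn (series b) <= 2 * e * A.
  rewrite (cvg_lim _ cb)//.
  have : 2 / (r * N) ^+ 2 * limn (series (fun k => (k%:R - N) ^+ 2 * bwt s k)) <= e * A.
    apply: (@le_trans _ _ (2 / (r * N) ^+ 2 * (N * A))).
      by rewrite ler_wpM2l// divr_ge0// ltW.
    have -> : 2 / (r * N) ^+ 2 * (N * A) = 2 / (r ^+ 2 * N) * A.
      by field; rewrite !gt_eqF.
    rewrite ler_wpM2r//; first by lra.
    by rewrite ler_pdivrMr ?mulr_gt0 ?exprn_gt0//; nra.
  by lra.
have dich k (x : R) : 0 <= x <= 2 -> (`|ph k| <= e -> x <= e) -> bwt s k * x <= b k.
  move=> /andP[x0 x2] hx; have w0 := bwt_ge0 k s0.
  have v0 : 0 <= (k%:R - N) ^+ 2 := sqr_ge0 _.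
  have [kN|kN] := ltP ((k%:R - N) ^+ 2) (r ^+ 2 * N ^+ 2).
    have {}hx := hx (H t k NN0 kN).
    apply: (@le_trans _ _ (e * bwt s k)); first by rewrite mulrC ler_wpM2r.
    rewrite /b lerDl; apply: mulr_ge0; last exact: mulr_ge0.
    by rewrite divr_ge0// ltW.
  apply: (@le_trans _ _ (2 * bwt s k)); first by rewrite mulrC ler_wpM2r.
  rewrite /b; apply: (@le_trans _ _ (2 / (r * N) ^+ 2 * ((k%:R - N) ^+ 2 * bwt s k))).
    rewrite [leRHS]mulrA ler_wpM2r// [leRHS]mulrAC ler_pdivlMr// ler_wpM2l//.
    by rewrite exprMn.
  rewrite lerDr; apply: mulr_ge0 => //; exact: ltW.
have cb' : cvgn (series b) by exact: cvgP cb.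
have F_le : `|bser 1 tau (Garg tau) t| <= 2 * e * A.
  apply: le_trans lb; apply: series_norm_le => // k.
  apply: le_trans (bterm_le _ _ _ _ n1) _; apply: dich.
    by rewrite normr_ge0 /=; apply: le_trans (sin_max _) _; lra.
  move=> h; apply: le_trans h.
  have [p0|/ltW p0] := leP 0 (ph k).
    rewrite (ger0_norm p0) ler_norml sin_le// andbT.
    have := @derive_ge0_ge R (fun u => sin u + u) (fun u => cos u + 1) 0 (ph k) p0.
    rewrite sin0 addr0 => hh; rewrite -subr_ge0 opprK; apply: hh => u _.
    by have := cos_geN1 u; lra.
  rewrite (ler0_norm p0) -normrN -sinN.
  have p1 : 0 <= - ph k by rewrite oppr_ge0.
  rewrite ler_norml sin_le// andbT.
  have := @derive_ge0_ge R (fun u => sin u + u) (fun u => cos u + 1) 0 (- ph k) p1.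
  rewrite sin0 addr0 => hh; rewrite -subr_ge0 opprK; apply: hh => u _.
  by have := cos_geN1 u; lra.
have H_ge : A / c - 2 * e * A <= bser 1 tau (Garg tau + pi / 2) t.
  have cw : series (fun k => bwt s k / c - b k) @ \oo --> A / c - limn (series b).
    rewrite (_ : series _ = (fun n => series (bwt s) n / c - series b n)).
      by apply: cvgB => //; apply: cvgMl; exact: bwt_cvg.
    by apply/funext => n; rewrite /series /= mulr_suml -sumrB.
  apply: (@le_trans _ _ (A / c - limn (series b))); first by lra.
  rewrite -(cvg_lim _ cw)//; apply: lim_series_le; [exact: (cvgP _ cw)|exact: (cvgP _ (@cvg_bser _ 1 tau _ n1 t))|].
  move=> k; rewrite /bterm expr1n mul1r.
  have -> : bphase tau (Garg tau + pi / 2) t k = ph k + pi / 2 by rewrite /ph /bphase; ring.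
  rewrite sinDpihalf -/N -/s.
  have : bwt s k / c <= bcoef tau k * s ^+ k.
    have := bcoef_ge tau k; rewrite -/c => h.
    have -> : bwt s k / c = c^-1 / k`!%:R ^+ 2 * s ^+ k by rewrite /bwt; ring.
    by rewrite ler_wpM2r// exprn_ge0.
  have : bcoef tau k * s ^+ k * (1 - cos (ph k)) <= b k.
    apply: (@le_trans _ _ (bwt s k * (1 - cos (ph k)))).
      rewrite ler_wpM2r ?subr_ge0 ?cos_le1//.
      rewrite /bwt [leLHS]mulrC.
      apply: ler_wpM2l; [exact: exprn_ge0|exact: bcoef_le].
    apply: dich; first by have := cos_le1 (ph k); have := cos_geN1 (ph k) => ? ?; apply/andP; lra.
    move=> h; have := cos_ge (ph k).
    have : ph k ^+ 2 <= e ^+ 2 by rewrite -[leLHS]real_normK ?num_real// ler_pXn2r// nnegrE ltW.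
    by nra.
  by lra.
have Ac : 8 * (e * A) <= A / c.
  by rewrite ler_pdivlMr//; nra.
have eA : 0 < e * A by rewrite mulr_gt0// (lt_le_trans ltr01).
split; first by lra.
apply: le_trans F_le _; apply: (@le_trans _ _ (d * (A / c - 2 * e * A))); last first.
  by rewrite ler_wpM2l// ltW.
apply: (@le_trans _ _ (d * (A / (2 * c)))); last first.
  rewrite ler_wpM2l ?ltW//.
  have -> : A / (2 * c) = A / c / 2 by field; rewrite gt_eqF.
  by lra.
rewrite mulrA ler_pdivlMr ?mulr_gt0//.
have A0 : 0 < A by apply: lt_le_trans A1.
have -> : 2 * e * A * (2 * c) = (e * (8 * c) / 2) * A by field.
rewrite ler_wpM2r// ?ltW//; have : 0 <= e * (8 * c) by rewrite !mulr_ge0// ltW.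
by lra.
Qed.

End Asymptotics.

(** * Explicit bounds on the kernel *)

Section NumericBounds.
Context {R : realType}.
Implicit Types (sg tau psi t s : R) (k n : nat).

Lemma series_geo_le (b : R^nat) (b0 C z : R) : 0 <= z < 1 -> 0 <= C ->
  (forall k, 0 <= b k) -> b 0 <= b0 -> (forall k, b k.+1 <= C * z ^+ k) ->
  cvgn (series b) /\ limn (series b) <= b0 + C / (1 - z).
Proof.
move=> /andP[z0 z1] C0 bge b00 bz.
have z10 : 0 < 1 - z by rewrite subr_gt0.
have geo n : \sum_(0 <= k < n) z ^+ k <= (1 - z)^-1.
  rewrite -(ler_pM2r z10) mulVf ?gt_eqF// mulrC.
  suff -> : (1 - z) * \sum_(0 <= k < n) z ^+ k = 1 - z ^+ n by rewrite gerBl exprn_ge0.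
  elim: n => [|n IH]; first by rewrite big_nil mulr0 expr0 subrr.
  by rewrite big_nat_recr//= mulrDr IH exprS; ring.
have bd n : series b n <= b0 + C / (1 - z).
  rewrite /series /=; case: n => [|n].
    by rewrite big_nil addr_ge0 ?divr_ge0 ?(ltW z10)//; apply: le_trans b00.
  rewrite big_nat_recl//; apply: lerD => //.
  apply: le_trans (_ : _ <= \sum_(0 <= k < n) C * z ^+ k) _; first exact: ler_sum.
  by rewrite -mulr_sumr ler_wpM2l.
have nd : nondecreasing_seq (series b).
  by apply/nondecreasing_seqP => n; rewrite /series /= big_nat_recr//= lerDl.
have cb : cvgn (series b).
  by apply: nondecreasing_is_cvgn => //; exists (b0 + C / (1 - z)) => _ [n _ <-].
by split => //; apply: limr_le => //; near=> n.
Unshelve. all: by end_near. Qed.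

Lemma expr2_le_factS k : 2 ^+ k <= k.+1`!%:R :> R.
Proof.
elim: k => [|k IH]; first by rewrite expr0.
by rewrite factS natrM exprS ler_pM ?exprn_ge0// ler_nat.
Qed.

Section SmallArgument.
Variable s : R.
Hypothesis s01 : 0 <= s <= 1 / 4.

Let s0 : 0 <= s. Proof. by case/andP: s01. Qed.
Let s1 : s <= 1 / 4. Proof. by case/andP: s01. Qed.

Let bwt_le k : bwt s k <= (1 / 4) ^+ k / k`!%:R ^+ 2.
Proof.
by rewrite /bwt ler_wpM2r ?invr_ge0 ?exprn_ge0// lerXn2r// nnegrE.
Qed.

(** From s <= 1/4 and (k+1)! >= 2^k the terms after the first are dominated geometrically with ratio
    1/16. In the next two lemmas a factor k or k^2 cancels part of the factorials, and the ratio
    becomes 1/8 or 1/4. *)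
Lemma bwt_sum_le : cvgn (series (bwt s)) /\ limn (series (bwt s)) <= 1 + 16 / 15 * s.
Proof.
have -> : 1 + 16 / 15 * s = 1 + s / (1 - 1 / 16) by field.
apply: series_geo_le => //; [by apply/andP; lra|by move=> k; exact: bwt_ge0|by rewrite bwt0|].
move=> k; rewrite /bwt exprS -mulrA ler_wpM2l//.
have -> : 1 / 16 = (1 / 4) * (2 ^+ 2)^-1 :> R by lra.
rewrite exprMn; apply: ler_pM; rewrite ?exprn_ge0 ?invr_ge0 ?exprn_ge0//.
  by rewrite lerXn2r ?nnegrE.
rewrite exprVn lef_pV2 ?posrE ?exprn_gt0 ?factR_gt0// exprAC lerXn2r ?nnegrE ?exprn_ge0//.
exact: expr2_le_factS.
Qed.

Lemma bwt1_sum_le : cvgn (series (fun k => k%:R * bwt s k)) /\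
  limn (series (fun k => k%:R * bwt s k)) <= 8 / 7 * s.
Proof.
have -> : 8 / 7 * s = 0 + s / (1 - 1 / 8) by field.
apply: series_geo_le => //; [by apply/andP; lra| |by rewrite mul0r|].
  by move=> k; rewrite mulr_ge0// bwt_ge0.
move=> k; rewrite /bwt.
have -> : k.+1%:R * (s ^+ k.+1 / k.+1`!%:R ^+ 2) = s * (s ^+ k * (k.+1`!%:R * k`!%:R)^-1).
  have k0 : k.+1%:R != 0 :> R by rewrite pnatr_eq0.
  rewrite factS natrM (exprS s); have f0 := lt0r_neq0 (factR_gt0 (R := R) k).
  move: (_`!%:R) (s ^+ k) (k.+1%:R : R) k0 f0 => f e n n0 f0.
  by field; rewrite n0 f0.
rewrite ler_wpM2l//.
have -> : 1 / 8 = (1 / 4) * 2^-1 :> R by lra.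
rewrite exprMn; apply: ler_pM; rewrite ?exprn_ge0 ?invr_ge0 ?mulr_ge0//.
  by rewrite lerXn2r ?nnegrE.
rewrite exprVn lef_pV2 ?posrE ?exprn_gt0 ?mulr_gt0 ?factR_gt0//.
apply: le_trans (expr2_le_factS k) _; rewrite ler_peMr ?factR_ge1//.
Qed.

Lemma bwt2_sum_le : cvgn (series (fun k => k%:R ^+ 2 * bwt s k)) /\
  limn (series (fun k => k%:R ^+ 2 * bwt s k)) <= 4 / 3 * s.
Proof.
have -> : 4 / 3 * s = 0 + s / (1 - 1 / 4) by field.
apply: series_geo_le => //; [by apply/andP; lra| |by rewrite expr0n mul0r|].
  by move=> k; rewrite mulr_ge0 ?bwt_ge0// sqr_ge0.
move=> k; rewrite bwtS ler_wpM2l//; apply: le_trans (bwt_le k) _.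
by rewrite ler_piMr ?exprn_ge0// invf_le1 ?exprn_gt0 ?factR_gt0// exprn_ege1// factR_ge1.
Qed.

Variables (sg tau psi t : R).
Hypothesis sg1 : `|sg| = 1.
Hypothesis st : expR t ^+ 2 = s.

Let bterm'_le k : `|bterm' sg tau psi t k| <= bwt s k *
  (2 * k%:R * `|sin (bphase tau psi t k)| + `|tau|).
Proof.
rewrite /bterm' !normrM normrX sg1 expr1n mul1r st; apply: ler_pM => //.
  rewrite (ger0_norm (ltW (bcoef_gt0 _ _))) ger0_norm ?exprn_ge0//.
  by rewrite /bwt mulrC ler_wpM2l ?exprn_ge0// bcoef_le.
apply: le_trans (ler_normD _ _) _; rewrite !normrM (ger0_norm (ler0n _ _)) (ger0_norm (ler0n _ _)).
by rewrite lerD2l ler_piMr// cos_max.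
Qed.

Lemma bser_le : `|bser sg tau psi t| <= 1 + 16 / 15 * s.
Proof.
have [c l] := bwt_sum_le; apply: le_trans l; apply: series_norm_le => // k.
apply: le_trans (bterm_le _ _ _ _ sg1) _; rewrite st ler_piMr ?bwt_ge0// sin_max//.
Qed.

Lemma bser'_le : `|bser' sg tau psi t| <= 16 / 7 * s + `|tau| * (1 + 16 / 15 * s).
Proof.
have [c0 l0] := bwt_sum_le; have [c1 l1] := bwt1_sum_le.
have c : series (fun k => 2 * (k%:R * bwt s k) + `|tau| * bwt s k) @ \oo -->
   2 * limn (series (fun k => k%:R * bwt s k)) + `|tau| * limn (series (bwt s)).
  rewrite (_ : series (fun k => _ + _) = (fun n => 2 * series (fun k => k%:R * bwt s k) n +
    `|tau| * series (bwt s) n)); first by apply: cvgD; exact: cvgMr.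
  by apply/funext => n; rewrite /series /= !mulr_sumr -big_split.
apply: le_trans (_ : _ <= 2 * limn (series (fun k => k%:R * bwt s k)) +
  `|tau| * limn (series (bwt s))) _; last first.
  apply: lerD; first by lra.
  by rewrite ler_wpM2l.
rewrite -(cvg_lim _ c)//; apply: series_norm_le; first exact: (cvgP _ c).
move=> k; apply: le_trans (bterm'_le k) _.
have -> : 2 * (k%:R * bwt s k) + `|tau| * bwt s k = bwt s k * (2 * k%:R + `|tau|) by ring.
by rewrite ler_wpM2l ?bwt_ge0// lerD2r ler_piMr ?mulr_ge0// sin_max.
Qed.

(* The terms have phase at most [tau * (l + k)], with [l = - t]. *)
Hypotheses (tau01 : 0 < tau <= 1) (psiE : psi = Garg tau) (t12 : t <= - (1 / 2)).

Let Nt0 : 0 <= - t.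
Proof. by rewrite oppr_ge0 (le_trans t12)// oppr_le0 divr_ge0. Qed.

Let phase_le k : `|sin (bphase tau psi t k)| <= tau * (- t + k%:R).
Proof.
have [t0 t1] := andP tau01.
have g0 := Garg_ge0 tau01; have g1 := Garg_le t0.
have S0 : 0 <= Garg_sum tau k.
  apply: sumr_ge0 => j _; by rewrite -[leLHS]atan0; apply: le_atan; rewrite divr_ge0// ltW.
have S1 : Garg_sum tau k <= tau * k%:R.
  have -> : tau * k%:R = \sum_(j < k) tau by rewrite sumr_const card_ord mulr_natr.
  apply: ler_sum => j _; apply: le_trans (atan_le _) _; first by rewrite divr_ge0// ltW.
  by rewrite ler_pdivrMr ?ltr0n// ler_peMr ?ler1n// ltW.
have K0 : 0 <= tau * k%:R by rewrite mulr_ge0// ltW.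
(* The upper side of the phase bound is tau t + Garg tau <= tau (t + 1) <= - tau t, which is where t
   <= -1/2 enters. *)
have h : 0 <= tau * (- (1 / 2) - t) by apply: mulr_ge0; [exact: ltW|rewrite subr_ge0].
have : `|bphase tau psi t k| <= tau * (- t + k%:R).
  by rewrite ler_norml psiE /bphase; apply/andP; split; lra.
apply: le_trans; set x := bphase _ _ _ _.
wlog x0 : x / 0 <= x.
  move=> H; have [|/ltW x0] := leP 0 x; first exact: H.
  by rewrite -normrN -sinN -(normrN x); apply: H; rewrite oppr_ge0.
rewrite (ger0_norm x0) ler_norml sin_le// andbT.
have := @derive_ge0_ge R (fun u => sin u + u) (fun u => cos u + 1) 0 x x0.
rewrite sin0 addr0 => hh; rewrite -subr_ge0 opprK; apply: hh => u _.
by have := cos_geN1 u; lra.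
Qed.

Lemma bser_le_tau : `|bser sg tau psi t| <= tau * (- t * (1 + 16 / 15 * s) + 8 / 7 * s).
Proof.
have [t0 t1] := andP tau01.
have [c0 l0] := bwt_sum_le; have [c1 l1] := bwt1_sum_le.
have c : series (fun k => tau * (- t * bwt s k + k%:R * bwt s k)) @ \oo -->
   tau * (- t * limn (series (bwt s)) + limn (series (fun k => k%:R * bwt s k))).
  rewrite (_ : series (fun k => tau * _) = (fun n => tau * (- t * series (bwt s) n +
    series (fun k => k%:R * bwt s k) n))).
    by apply: cvgMr; apply: cvgD => //; exact: cvgMr.
  by apply/funext => n; rewrite /series /= mulr_sumr -big_split mulr_sumr.
apply: le_trans (_ : _ <= tau * (- t * limn (series (bwt s)) +
  limn (series (fun k => k%:R * bwt s k)))) _; last first.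
  rewrite ler_pM2l//; apply: lerD => //; exact: ler_wpM2l.
rewrite -(cvg_lim _ c)//; apply: series_norm_le; first exact: (cvgP _ c).
move=> k; apply: le_trans (bterm_le _ _ _ _ sg1) _; rewrite st.
have -> : tau * (- t * bwt s k + k%:R * bwt s k) = bwt s k * (tau * (- t + k%:R)) by ring.
by rewrite ler_wpM2l ?bwt_ge0.
Qed.

Lemma bser'_le_tau : `|bser' sg tau psi t| <=
  tau * (- t * (16 / 7 * s) + 8 / 3 * s + (1 + 16 / 15 * s)).
Proof.
have [t0 t1] := andP tau01.
have [c0 l0] := bwt_sum_le; have [c1 l1] := bwt1_sum_le; have [c2 l2] := bwt2_sum_le.
have c : series (fun k => tau * (- t * 2 * (k%:R * bwt s k) + 2 * (k%:R ^+ 2 * bwt s k) + bwt s k))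
  @ \oo --> tau * (- t * 2 * limn (series (fun k => k%:R * bwt s k)) +
    2 * limn (series (fun k => k%:R ^+ 2 * bwt s k)) + limn (series (bwt s))).
  rewrite (_ : series (fun k => tau * _) = (fun n => tau * (- t * 2 *
    series (fun k => k%:R * bwt s k) n + 2 * series (fun k => k%:R ^+ 2 * bwt s k) n +
    series (bwt s) n))).
    by apply: cvgMr; apply: cvgD => //; apply: cvgD; exact: cvgMr.
  by apply/funext => n; rewrite /series /= !mulr_sumr -!big_split mulr_sumr.
apply: le_trans (_ : _ <= tau * (- t * 2 * limn (series (fun k => k%:R * bwt s k)) +
    2 * limn (series (fun k => k%:R ^+ 2 * bwt s k)) + limn (series (bwt s)))) _; last first.
  rewrite ler_pM2l//; apply: lerD => //; apply: lerD; last by lra.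
  have -> : - t * (16 / 7 * s) = - t * 2 * (8 / 7 * s) by field.
  by rewrite ler_wpM2l// mulr_ge0.
rewrite -(cvg_lim _ c)//; apply: series_norm_le; first exact: (cvgP _ c).
move=> k; apply: le_trans (bterm'_le k) _; rewrite (gtr0_norm t0).
have -> : tau * (- t * 2 * (k%:R * bwt s k) + 2 * (k%:R ^+ 2 * bwt s k) + bwt s k) =
  bwt s k * (2 * k%:R * (tau * (- t + k%:R)) + tau) by ring.
by rewrite ler_wpM2l ?bwt_ge0// lerD2r ler_wpM2l// mulr_ge0.
Qed.

End SmallArgument.
End NumericBounds.

(** * Explicit bounds on the two solutions, for y <= 1 and y >= 1 *)

Section KernelProfile.
Context {R : realType}.
Implicit Types (tau t x : R).

(** The first factor represents K: up to real factors, K is the imaginary part of I_(i tau). *)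
Definition bprod tau t := bser 1 tau (Garg tau) t * bser (-1) tau (Garg tau) t.

Let n1 : `|1 : R| = 1. Proof. exact: normr1. Qed.
Let nN1 : `|-1 : R| = 1. Proof. by rewrite normrN normr1. Qed.

Lemma expR_taylor_ge n x : 0 <= x -> \sum_(0 <= k < n) x ^+ k / k`!%:R <= expR x.
Proof.
move=> x0; rewrite /expR; apply: (@nondecreasing_cvgn_le _ (series (exp_coeff x))).
  by apply/nondecreasing_seqP => m; rewrite /series /= big_nat_recr//= lerDl exp_coeff_ge0.
exact: is_cvg_series_exp_coeff.
Qed.

(** Four squarings starting from 1 + x <= e^x at x = -1/24. In other words, ln 2 >= 2/3. *)
Lemma expR_N23 : 1 / 2 <= expR (- (2 / 3)) :> R.
Proof.
have dbl (x : R) : expR x = expR (x / 2) ^+ 2 by rewrite expr2 -expRD; congr expR; lra.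
have h1 : 23 / 24 <= expR (- (2 / 3) / 2 / 2 / 2 / 2) :> R.
  by apply: le_trans (expR_ge1Dx _); lra.
have h2 : 918 / 1000 <= expR (- (2 / 3) / 2 / 2 / 2) :> R by rewrite dbl; nra.
have h3 : 842 / 1000 <= expR (- (2 / 3) / 2 / 2) :> R by rewrite dbl; nra.
have h4 : 708 / 1000 <= expR (- (2 / 3) / 2) :> R by rewrite dbl; nra.
by rewrite dbl; nra.
Qed.

Lemma expR1_ge : 5 / 2 <= expR 1 :> R.
Proof.
have := @expR_taylor_ge 3 1 ler01; rewrite !big_nat_recr //= big_nil.
by rewrite !expr1n !factS fact0; lra.
Qed.

Lemma le_sinh x y : x <= y -> sinh x <= sinh y.
Proof.
move=> xy; rewrite /sinh; have : expR x <= expR y by rewrite ler_expR.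
have : expR (- y) <= expR (- x) by rewrite ler_expR lerN2.
by lra.
Qed.

Lemma sinh_pi_ge tau : 0 < tau -> 31 / 20 * tau <= sinh (pi * tau / 2).
Proof.
move=> t0; apply: le_trans (sinh_ge _); last by rewrite !mulr_ge0 ?pi_ge0// ltW.
have := @pi_gt31 R; have -> : pi * tau / 2 = pi / 2 * tau by field.
by move=> h; rewrite ler_pM2r//; lra.
Qed.

Lemma bprod_small tau t : 0 < tau -> expR t <= 1 / 2 ->
  `|bprod tau t| <= (19 / 15) ^+ 2 /\
  (tau <= 1 -> `|bprod tau t| <= (tau * (- t + 6 / 10)) ^+ 2).
Proof.
move=> t0 et; have e0 := expR_gt0 t.
have s01 : 0 <= expR t ^+ 2 <= 1 / 4 by rewrite sqr_ge0 /=; nra.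
have [_ s1] := andP s01.
rewrite /bprod normrM expr2; split.
  by apply: ler_pM => //; [have := bser_le s01 tau (Garg tau) n1 erefl
    |have := bser_le s01 tau (Garg tau) nN1 erefl]; move/le_trans; apply; lra.
move=> t1; have tau01 : 0 < tau <= 1 by rewrite t0.
have t12 : t <= - (1 / 2) by have := expR_ge1Dx t; lra.
have h : - t * (1 + 16 / 15 * expR t ^+ 2) + 8 / 7 * expR t ^+ 2 <= - t + 6 / 10.
  (* Since -t <= e^(-t) - 1, the left side is at most e^t - e^(2t) <= 1/4. *)
  have : - t * expR t ^+ 2 <= 1 / 4.
    have lt1 : 1 - t <= expR (- t) := expR_ge1Dx (- t).
    have x1 : expR t * expR (- t) = 1 by rewrite -expRD subrr expR0.
    apply: (@le_trans _ _ ((expR (- t) - 1) * expR t ^+ 2)).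
      by rewrite ler_wpM2r ?sqr_ge0//; lra.
    have -> : (expR (- t) - 1) * expR t ^+ 2 = (expR t * expR (- t)) * expR t - expR t ^+ 2 by ring.
    by rewrite x1 mul1r; have := sqr_ge0 (expR t - 1 / 2); nra.
  by lra.
by rewrite expr2; apply: ler_pM => //;
  [have := bser_le_tau s01 n1 erefl tau01 erefl t12
  |have := bser_le_tau s01 nN1 erefl tau01 erefl t12]; move/le_trans; apply; rewrite ler_pM2l.
Qed.

Section LargeArgument.
Variable tau : R.
Hypothesis t0 : 0 < tau.
Let FI : R -> R := bser 1 tau (Garg tau).
Let FJ : R -> R := bser (-1) tau (Garg tau).
Let a : R := - ln 2.
Let ea : expR a = 1 / 2.
Proof. by rewrite /a expRN lnK ?posrE// div1r. Qed.
Let ea2 : expR a ^+ 2 = 1 / 4.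
Proof. by rewrite ea; lra. Qed.
Let s01 : 0 <= (1 / 4 : R) <= 1 / 4.
Proof. by apply/andP; lra. Qed.
Let a1 : - 1 <= a.
Proof. by rewrite /a lerN2; have := @le_ln1Dx R 1; rewrite (_ : 1 + 1 = 2)//; apply. Qed.
Let a12 : a <= - (1 / 2).
Proof. by have := expR_ge1Dx a; rewrite ea; lra. Qed.

(** The energy is started at y = 1, that is e^a = 1/2, with the series bounds at s = 1/4; the second
    bound starts from those that are linear in [tau], using -a <= 1. *)
Lemma bserJ_large t : 1 / 2 <= expR t ->
  FJ t ^+ 2 <= 177 / 50 /\ (tau <= 1 -> FJ t ^+ 2 <= 87 / 10 * tau ^+ 2).
Proof.
rewrite -ea ler_expR => at_.
have dF (u : R) : is_derive u 1 FJ (bser' (-1) tau (Garg tau) u) by exact: is_derive_bser.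
have dF1 (u : R) : is_derive u 1 (bser' (-1) tau (Garg tau))
    (- (4 * expR u ^+ 2 + tau ^+ 2) * FJ u).
  by have ? := @is_derive_bser' R _ tau (Garg tau) nN1 u; apply: is_derive_eq; rewrite -/FJ; ring.
have := oscillatory_energy at_ dF dF1; rewrite ea2 => E.
have q0 : 0 < 4 * (1 / 4) + tau ^+ 2 by rewrite ltr_wpDr ?sqr_ge0//; lra.
have E' c1 c2 : `|FJ a| <= c1 -> `|bser' (-1) tau (Garg tau) a| <= c2 ->
    FJ t ^+ 2 <= c1 ^+ 2 + c2 ^+ 2 / (1 + tau ^+ 2).
  move=> h1 h2; apply: le_trans E _.
  have g1 : FJ a ^+ 2 <= c1 ^+ 2.
    by rewrite -[leLHS]real_normK ?num_real// lerXn2r// nnegrE (le_trans _ h1).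
  have g2 : bser' (-1) tau (Garg tau) a ^+ 2 <= c2 ^+ 2.
    by rewrite -[leLHS]real_normK ?num_real// lerXn2r// nnegrE (le_trans _ h2).
  apply: lerD => //.
  have -> : 4 * (1 / 4) + tau ^+ 2 = 1 + tau ^+ 2 by lra.
  by rewrite ler_wpM2r// invr_ge0 addr_ge0// sqr_ge0.
split.
  apply: le_trans (E' (19 / 15) (4 / 7 + tau * (19 / 15)) _ _) _.
  - by have := bser_le s01 tau (Garg tau) nN1 ea2; move/le_trans; apply; lra.
  - have := bser'_le s01 tau (Garg tau) nN1 ea2; rewrite (gtr0_norm t0).
    by move/le_trans; apply; lra.
  (* By Cauchy-Schwarz (4/7 + 19/15 tau)^2 <= ((4/7)^2 + (19/15)^2)(1 + tau^2), so the energy is at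
     most 2 (19/15)^2 + (4/7)^2, just below 177/50. *)
  rewrite -lerBrDl ler_pdivrMr ?ltr_pwDl ?sqr_ge0//.
  by have := sqr_ge0 (4 / 7 * tau - 19 / 15); nra.
move=> t1; have tau01 : 0 < tau <= 1 by rewrite t0.
apply: le_trans (E' (163 / 105 * tau) (263 / 105 * tau) _ _) _.
- have := bser_le_tau s01 nN1 ea2 tau01 erefl a12; move/le_trans; apply.
  by rewrite [leRHS]mulrC ler_pM2l//; have := a1; lra.
- have := bser'_le_tau s01 nN1 ea2 tau01 erefl a12; move/le_trans; apply.
  by rewrite [leRHS]mulrC ler_pM2l//; have := a1; lra.
apply: (@le_trans _ _ ((163 / 105 * tau) ^+ 2 + (263 / 105 * tau) ^+ 2)).
  rewrite lerD2l ler_pdivrMr ?ltr_pwDl ?sqr_ge0//.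
  by rewrite ler_peMr ?sqr_ge0// lerDl sqr_ge0.
by have := sqr_ge0 tau; nra.
Qed.

(* The factor [exp (t / 2)] turns [FI] into a solution of an equation whose
   coefficient is nonnegative beyond [b]. *)
Lemma bserI_nonincreasing (b t : R) : tau ^+ 2 + 1 / 4 <= 4 * expR b ^+ 2 -> b <= t ->
  expR t * FI t ^+ 2 <= expR b * FI b ^+ 2.
Proof.
move=> hb bt; pose H := bser 1 tau (Garg tau + pi / 2).
pose half (F : R -> R) (u : R) := expR (u / 2) * F u.
pose half1 (F F1 : R -> R) (u : R) := expR (u / 2) * (F1 u + F u / 2).
(* In the variable y = 2 e^u the function y^(1/2) F satisfies W'' = (Q / y^2) W; returning to u
   produces the first-order term of the equation below. *)
pose Q (u : R) := 4 * expR u ^+ 2 - tau ^+ 2 - 1 / 4.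
have de (u : R) : is_derive u 1 (fun u : R => expR (u / 2)) (expR (u / 2) / 2).
  apply: is_derive_eq (is_derive1_comp (f := @expR R) (g := fun u : R => u / 2) _ _) _.
  by rewrite /GRing.scale /=; field.
have sq (F : R -> R) (u : R) : (half F u) ^+ 2 = expR u * F u ^+ 2.
  rewrite /half exprMn; congr (_ * _); rewrite expr2 -expRD; congr expR; lra.
have D psi : (forall u : R, is_derive u 1 (half (bser 1 tau psi))
      (half1 (bser 1 tau psi) (bser' 1 tau psi) u)) /\
    (forall u : R, is_derive u 1 (half1 (bser 1 tau psi) (bser' 1 tau psi))
      (half1 (bser 1 tau psi) (bser' 1 tau psi) u + Q u * half (bser 1 tau psi) u)).
  split=> u; have ? := de u; have ? := @is_derive_bser R 1 tau psi n1 u;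
    have ? := @is_derive_bser' R 1 tau psi n1 u.
    by apply: is_derive_eq; rewrite /half1 /GRing.scale /=; field.
  by apply: is_derive_eq; rewrite /half1 /half /Q /GRing.scale /=; field.
have [dU dU1] := D (Garg tau); have [dV dV1] := D (Garg tau + pi / 2).
rewrite -!sq; apply: (recessive_nonincreasing bt dU dV dU1 dV1).
  move=> u bu; rewrite /Q.
  have : expR b ^+ 2 <= expR u ^+ 2 by rewrite lerXn2r ?nnegrE ?expR_ge0// ler_expR.
  by lra.
move=> d d0; have [u0 Hu0] := bser_recessive tau d0; exists u0 => u /Hu0 [h1 h2].
split; first by rewrite mulr_gt0 ?expR_gt0.
by rewrite normrM ger0_norm ?expR_ge0// mulrCA ler_pM2l ?expR_gt0.
Qed.

(** For tau^2 <= 3/4 the point y = 1 already lies beyond the turning point, so monotonicity applies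
    from there on. *)
Lemma bserI_large_small_tau t : 1 / 2 <= expR t -> tau ^+ 2 <= 3 / 4 ->
  2 * expR t * FI t ^+ 2 <= 241 / 100 * tau ^+ 2.
Proof.
rewrite -ea ler_expR => at_ t34.
have t1 : tau <= 1 by nra.
have tau01 : 0 < tau <= 1 by rewrite t0.
have h : tau ^+ 2 + 1 / 4 <= 4 * expR a ^+ 2 by rewrite ea2; lra.
have := bserI_nonincreasing h at_; rewrite ea => E.
have : `|FI a| <= 163 / 105 * tau.
  have := bser_le_tau s01 n1 ea2 tau01 erefl a12; move/le_trans; apply.
  by rewrite [leRHS]mulrC ler_pM2l//; have := a1; lra.
move=> h1; have h2 : FI a ^+ 2 <= (163 / 105 * tau) ^+ 2.
  by rewrite -[leLHS]real_normK ?num_real// lerXn2r// nnegrE (le_trans _ h1).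
by have := sqr_ge0 tau; nra.
Qed.

(** The energy estimate carries the data at y = 1 up to the turning point b, given by 4 e^(2b) =
    tau^2 + 1/4, and monotonicity takes over from b. As tau^2 >= 3/4, 2 e^b <= 7/6 tau. *)
Lemma bserI_large_large_tau t : 1 / 2 <= expR t -> 3 / 4 <= tau ^+ 2 ->
  2 * expR t * FI t ^+ 2 * tau ^+ 2 <= 7 / 6 * tau *
    (((4 / 7 + 19 / 15 * tau) ^+ 2 + (19 / 15) ^+ 2 * tau ^+ 2) * expR (tau / 2)).
Proof.
set C := (_ + _ : R) => et t34.
have C0 : 0 <= C by rewrite addr_ge0 ?sqr_ge0// -exprMn sqr_ge0.
pose b : R := ln (Num.sqrt (tau ^+ 2 + 1 / 4) / 2).
have q0 : 0 < tau ^+ 2 + 1 / 4 by rewrite ltr_pwDr ?sqr_ge0.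
have sq0 : 0 < Num.sqrt (tau ^+ 2 + 1 / 4) by rewrite sqrtr_gt0.
have eb : expR b = Num.sqrt (tau ^+ 2 + 1 / 4) / 2 by rewrite lnK// posrE divr_gt0.
have eb2 : 4 * expR b ^+ 2 = tau ^+ 2 + 1 / 4.
  by rewrite eb exprMn sqr_sqrtr ?ltW//; lra.
have ebt : 2 * expR b <= 7 / 6 * tau.
  have h : (2 * expR b) ^+ 2 <= (7 / 6 * tau) ^+ 2.
    have -> : (2 * expR b) ^+ 2 = 4 * expR b ^+ 2 by ring.
    by rewrite eb2; lra.
  by rewrite -(@ler_pXn2r _ 2)// nnegrE mulr_ge0// ?expR_ge0// ltW.
have main u : a <= u -> u <= b ->
    2 * expR u * FI u ^+ 2 * tau ^+ 2 <= 7 / 6 * tau * (C * expR (tau / 2)).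
  move=> au ub.
  have dF (v : R) : is_derive v 1 FI (bser' 1 tau (Garg tau) v) by exact: is_derive_bser.
  have dF1 (v : R) : is_derive v 1 (bser' 1 tau (Garg tau))
      ((4 * expR v ^+ 2 - tau ^+ 2) * FI v).
    by have ? := @is_derive_bser' R _ tau (Garg tau) n1 v; apply: is_derive_eq;
      rewrite -/FI; ring.
  have := growth_energy t0 au dF dF1; rewrite ea2 => E.
  have h1 : `|FI a| <= 19 / 15.
    by have := bser_le s01 tau (Garg tau) n1 ea2; move/le_trans; apply; lra.
  have h2 : `|bser' 1 tau (Garg tau) a| <= 4 / 7 + 19 / 15 * tau.
    have := bser'_le s01 tau (Garg tau) n1 ea2; rewrite (gtr0_norm t0).
    by move/le_trans; apply; lra.
  have eu : expR u <= expR b by rewrite ler_expR.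
  have eu2 : expR u ^+ 2 <= expR b ^+ 2 by rewrite lerXn2r ?nnegrE ?expR_ge0.
  have {}E : tau ^+ 2 * FI u ^+ 2 <= C * expR (tau / 2).
    apply: le_trans E _; apply: ler_pM; rewrite ?expR_ge0//.
    - by rewrite addr_ge0 ?sqr_ge0// -exprMn sqr_ge0.
    - have h0 : 0 <= 4 / 7 + 19 / 15 * tau by rewrite addr_ge0 ?mulr_ge0// ltW.
      apply: lerD.
        by rewrite -[leLHS]real_normK ?num_real// lerXn2r// nnegrE.
      rewrite mulrC ler_wpM2r ?sqr_ge0//.
      by rewrite -[leLHS]real_normK ?num_real// lerXn2r// nnegrE.
    - rewrite ler_expR.
      have -> : tau / 2 = 2 / tau * (tau ^+ 2 / 4) by field; rewrite gt_eqF.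
      by rewrite ler_wpM2l ?divr_ge0 ?(ltW t0)//; lra.
  have -> : 2 * expR u * FI u ^+ 2 * tau ^+ 2 = (2 * expR u) * (tau ^+ 2 * FI u ^+ 2) by ring.
  apply: ler_pM; [by apply: mulr_ge0; rewrite ?expR_ge0|by rewrite -exprMn sqr_ge0| |exact: E].
  by apply: le_trans ebt; rewrite ler_pM2l.
have ab : a <= b.
  rewrite -ler_expR ea eb ler_pM2r// -[leLHS]sqrtr1 ler_wsqrtr//; lra.
have ta : a <= t by rewrite -ler_expR ea.
have [tb|/ltW bt] := leP t b; first exact: main.
apply: le_trans (main b ab (lexx b)).
have h : tau ^+ 2 + 1 / 4 <= 4 * expR b ^+ 2 by rewrite eb2.
have := bserI_nonincreasing h bt.
by move=> E; rewrite ler_wpM2r ?sqr_ge0// -!(mulrA 2) ler_pM2l.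
Qed.

End LargeArgument.

(** Using 31/20 = 13/10 + 1/4, a factor e^(tau/2) is split off sinh^2 to cancel the one on the left;
    the cubic that remains is beaten by the degree 5 Taylor polynomial of e^(26/10 tau). *)
Lemma sinh_poly_bound tau : 0 < tau -> 3 / 4 <= tau ^+ 2 ->
  177 / 50 * (7 / 6 * tau *
    (((4 / 7 + 19 / 15 * tau) ^+ 2 + (19 / 15) ^+ 2 * tau ^+ 2) * expR (tau / 2)))
  <= (117 / 40) ^+ 2 * sinh (pi * tau / 2) ^+ 2.
Proof.
move=> t0 t34.
have t86 : 173 / 200 <= tau by nra.
set X := expR (13 / 10 * tau).
have X0 : 0 < X by exact: expR_gt0.
have hs : sinh (31 / 20 * tau) <= sinh (pi * tau / 2).
  apply: le_sinh; have := @pi_gt31 R; have -> : pi * tau / 2 = pi / 2 * tau by field.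
  by move=> h; rewrite ler_pM2r//; lra.
(* This gives sinh(31/20 tau) >= (1 - 3/40) / 2 = 37/80 times e^(31/20 tau). *)
have small : expR (- (31 / 10 * tau)) <= 3 / 40.
  rewrite expRN invf_ple ?posrE ?expR_gt0//.
  have h : 167 / 100 + (67 / 100) ^+ 2 / 2 + (67 / 100) ^+ 3 / 6 <= expR (67 / 100) :> R.
    have := @expR_taylor_ge 4 (67 / 100 : R); rewrite !big_nat_recr //= big_nil.
    rewrite !factS fact0 => H; apply: le_trans (H _); lra.
  have e4 : expR (67 / 100) ^+ 4 <= expR (31 / 10 * tau).
    by rewrite -expRM_natl ler_expR; lra.
  apply: le_trans e4.
  have h19 : 48 / 25 <= expR (67 / 100) :> R by apply: le_trans h; lra.
  by apply: (@le_trans _ _ ((48 / 25) ^+ 4)); [lra|rewrite lerXn2r ?nnegrE ?expR_ge0//; lra].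
have lower : (37 / 80) * (X * expR (tau / 4)) <= sinh (31 / 20 * tau).
  rewrite /X -expRD (_ : 13 / 10 * tau + tau / 4 = 31 / 20 * tau); last lra.
  rewrite /sinh (_ : expR (- (31 / 20 * tau)) = expR (31 / 20 * tau) * expR (- (31 / 10 * tau))).
    by have := expR_gt0 (31 / 20 * tau); nra.
  by rewrite -expRD; congr expR; lra.
have X2 : 1 + (26 / 10 * tau) + (26 / 10 * tau) ^+ 2 / 2 + (26 / 10 * tau) ^+ 3 / 6 +
   (26 / 10 * tau) ^+ 4 / 24 + (26 / 10 * tau) ^+ 5 / 120 <= X ^+ 2.
  have -> : X ^+ 2 = expR (26 / 10 * tau) by rewrite /X expr2 -expRD; congr expR; lra.
  have := @expR_taylor_ge 6 (26 / 10 * tau); rewrite !big_nat_recr //= big_nil.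
  rewrite !factS fact0 => H; apply: le_trans (H _); last by rewrite mulr_ge0// ltW.
  lra.
have e2 : expR (tau / 4) ^+ 2 = expR (tau / 2) by rewrite expr2 -expRD; congr expR; lra.
have L0 : 0 <= 37 / 80 * (X * expR (tau / 4)) by rewrite !mulr_ge0 ?expR_ge0.
apply: (@le_trans _ _ ((117 / 40) ^+ 2 * (37 / 80 * (X * expR (tau / 4))) ^+ 2)); last first.
  by rewrite ler_wpM2l ?sqr_ge0// lerXn2r ?nnegrE// ?(le_trans L0)// (le_trans lower).
have -> : (117 / 40) ^+ 2 * (37 / 80 * (X * expR (tau / 4))) ^+ 2 =
    (117 / 40 * (37 / 80)) ^+ 2 * X ^+ 2 * expR (tau / 2) by rewrite -e2; ring.
set c := (117 / 40 * (37 / 80)) ^+ 2; set C := _ + _.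
have -> : 177 / 50 * (7 / 6 * tau * (C * expR (tau / 2))) =
  177 / 50 * (7 / 6 * tau * C) * expR (tau / 2) by ring.
rewrite ler_pM2r ?expR_gt0//.
apply: le_trans (ler_wpM2l _ X2); last by rewrite sqr_ge0.
(* Certificates: the polynomial inequality follows linearly from these nonnegative products. *)
have h1 : 0 <= tau ^+ 2 * (tau - 9 / 8) ^+ 2 by rewrite mulr_ge0 ?sqr_ge0.
have h2 : 0 <= tau * (tau ^+ 2 - 1) ^+ 2 by rewrite mulr_ge0 ?sqr_ge0 ?ltW.
have h3 : 0 <= tau * (tau - 1) ^+ 2 by rewrite mulr_ge0 ?sqr_ge0 ?ltW.
have h4 := sqr_ge0 (tau - 1 / 2); have h5 := sqr_ge0 tau.
by rewrite /c /C; lra.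
Qed.

End KernelProfile.

Section KernelBound.
Context {R : realType}.
Implicit Types (tau t y B T : R).

(** What remains of the kernel once the squared modulus of 1 / Gamma is bounded and sinh(pi tau)
    cancels. *)
Definition kbound tau t := `|bprod tau t| / (tau * sinh (pi * tau / 2)).

Lemma kbound_large tau t : 0 < tau -> 1 / 2 <= expR t ->
  Num.sqrt (2 * expR t) * kbound tau t <= 39 / 10 /\
  Num.sqrt (2 * expR t) * kbound tau t <= 39 / 10 / tau ^+ 2.
Proof.
move=> t0 et; set r := Num.sqrt _.
have e0 : 0 <= 2 * expR t by rewrite mulr_ge0// expR_ge0.
have r0 : 0 <= r by exact: sqrtr_ge0.
have r2 : r ^+ 2 = 2 * expR t by rewrite sqr_sqrtr.
have S0 := sinh_pi_ge t0; set S := sinh _ in S0.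
have Sp : 0 < S by apply: lt_le_trans S0; rewrite mulr_gt0.
have tS : 0 < tau * S by rewrite mulr_gt0.
have t2 : 0 < tau ^+ 2 by rewrite exprn_gt0.
rewrite /kbound -/S mulrA !ler_pdivrMr//.
set X := r * _.
have X0 : 0 <= X by rewrite mulr_ge0.
have X2 : X ^+ 2 = 2 * expR t * bser 1 tau (Garg tau) t ^+ 2 * bser (-1) tau (Garg tau) t ^+ 2.
  by rewrite /X exprMn r2 real_normK ?num_real// /bprod exprMn mulrA.
have [J1 J2] := bserJ_large t0 et.
have -> : 39 / 10 / tau ^+ 2 * (tau * S) = 39 / 10 * S / tau by field; rewrite gt_eqF.
have [t34|/ltW t34] := leP (tau ^+ 2) (3 / 4).
  have t1 : tau <= 1 by nra.
  have XX : X <= 229 / 50 * tau ^+ 2.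
    rewrite -(@ler_pXn2r _ 2)// ?nnegrE//; last by rewrite mulr_ge0// ltW.
    rewrite X2; apply: (@le_trans _ _ ((241 / 100 * tau ^+ 2) * (87 / 10 * tau ^+ 2))).
      apply: ler_pM; [|exact: sqr_ge0|exact: bserI_large_small_tau|exact: J2].
      by rewrite mulr_ge0// sqr_ge0.
    by have := sqr_ge0 (tau ^+ 2); nra.
  split; first by apply: le_trans XX _; nra.
  by rewrite ler_pdivlMr//; nra.
(* 117/40 is 3/4 of 39/10: since tau^2 >= 3/4, dividing by tau^2 still leaves the constant 39/10. *)
have XX : X * tau <= 117 / 40 * S.
  have h1 : 0 <= X * tau by apply: mulr_ge0 X0 (ltW t0).
  have h2 : 0 <= 117 / 40 * S by apply: mulr_ge0 (ltW Sp).
  rewrite -(@ler_pXn2r _ 2)// [X in X <= _]exprMn X2 [leRHS]exprMn.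
  apply: le_trans (sinh_poly_bound t0 t34).
  rewrite mulrAC [X in _ <= X]mulrC; apply: ler_pM => //; [|exact: sqr_ge0|exact: bserI_large_large_tau].
  by apply: mulr_ge0 (sqr_ge0 _); apply: mulr_ge0 (sqr_ge0 _).
have XX2 : X <= 117 / 40 * S / tau by rewrite ler_pdivlMr.
split; last by apply: le_trans XX2 _; rewrite ler_pM2r ?invr_gt0// ler_pM2r//; lra.
apply: le_trans XX2 _; rewrite ler_pdivrMr//; nra.
Qed.

(** The quantity 8/3 B^2 / T^3 is the integral of B^2 / max(T, |tau|)^4 over the line. For y <= 1, T
    is close to the crossover of the bounds (19/15)^2 and (tau m)^2 of [bprod], where m grows like
    ln(1/y). *)
Lemma kernel_profile y : 0 < y -> exists B T,
  [/\ 0 < B, 0 < T,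
      forall tau, 0 < tau ->
        kbound tau (ln (y / 2)) <= B / T ^+ 2 /\ kbound tau (ln (y / 2)) <= B / tau ^+ 2,
      B / T ^+ 2 <= 13 / 2 / Num.sqrt y
    & 8 / 3 * B ^+ 2 / T ^+ 3 <= (13 / 2) ^+ 2 / Num.sqrt y].
Proof.
move=> y0; set t := ln (y / 2).
have et : expR t = y / 2 by rewrite lnK// posrE divr_gt0.
have yE : y = 2 * expR t by rewrite et; field.
have r0 : 0 < Num.sqrt y by rewrite sqrtr_gt0.
have [e12|/ltW e12] := leP (1 / 2) (expR t).
  exists (39 / 10 / Num.sqrt y), 1.
  have r1 : 1 <= Num.sqrt y by rewrite -[leLHS]sqrtr1 ler_wsqrtr//; lra.
  split => //; first by rewrite divr_gt0.
  - move=> tau t0; have [h1 h2] := kbound_large t0 e12; rewrite -yE in h1 h2.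
    rewrite expr1n divr1 ler_pdivlMr// mulrC; split => //.
    by rewrite mulrAC ler_pdivlMr// mulrC.
  - by rewrite expr1n divr1 ler_pM2r ?invr_gt0//; lra.
  - rewrite expr1n divr1 exprMn exprVn ler_pdivlMr//.
    have -> : 8 / 3 * ((39 / 10) ^+ 2 / Num.sqrt y ^+ 2) * Num.sqrt y =
      (8 / 3 * (39 / 10) ^+ 2) / Num.sqrt y by field; rewrite gt_eqF.
    by rewrite ler_pdivrMr//; nra.
pose m : R := - t + 6 / 10.
have t23 : t <= - (2 / 3).
  rewrite leNgt; apply/negP; rewrite -ltr_expR.
  by have := @expR_N23 R; lra.
have m0 : 0 < m by rewrite /m; lra.
have m1 : 19 / 15 <= m by rewrite /m; lra.
(* 26/25 exceeds (19/15)^2 / (31/20), and 63/50 is slightly below 19/15, so that B / T^2 dominates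
   both m^2 / (31/20) and, as m >= 19/15, B itself. *)
exists (26 / 25), (63 / 50 / m).
have T0 : 0 < 63 / 50 / m by rewrite divr_gt0.
have BT : 26 / 25 / (63 / 50 / m) ^+ 2 = 26 / 25 * (50 / 63) ^+ 2 * m ^+ 2.
  by field; rewrite gt_eqF.
(* From e^u >= e u >= (5/2) u, cubed here and squared in [em2]: the logarithmic powers m^3 and m^2
   are absorbed into y^(-1/2), which is comparable to e^(m/2). *)
have em3 : (5 / 2 * (m / 6)) ^+ 3 <= expR (m / 2).
  have -> : expR (m / 2) = expR (m / 6) ^+ 3 by rewrite -expRM_natl; congr expR; lra.
  rewrite lerXn2r ?nnegrE ?expR_ge0//; first by rewrite !mulr_ge0// ltW.
  have -> : m / 6 = 1 + (m / 6 - 1) by lra.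
  rewrite expRD; apply: (@le_trans _ _ (expR 1 * (1 + (m / 6 - 1)))).
    by rewrite ler_wpM2r ?expR1_ge//; lra.
  by rewrite ler_pM2l ?expR_gt0// expR_ge1Dx.
have em2 : (5 / 2 * (m / 4)) ^+ 2 <= expR (m / 2).
  have -> : expR (m / 2) = expR (m / 4) ^+ 2 by rewrite -expRM_natl; congr expR; lra.
  rewrite lerXn2r ?nnegrE ?expR_ge0//; first by rewrite !mulr_ge0// ltW.
  have -> : m / 4 = 1 + (m / 4 - 1) by lra.
  rewrite expRD; apply: (@le_trans _ _ (expR 1 * (1 + (m / 4 - 1)))).
    by rewrite ler_wpM2r ?expR1_ge//; lra.
  by rewrite ler_pM2l ?expR_gt0// expR_ge1Dx.
have rm : 49 / 100 * expR (m / 2) <= (Num.sqrt y)^-1.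
  have h0 : 0 <= 49 / 100 * expR (m / 2) * Num.sqrt y.
    by apply: mulr_ge0 (ltW r0); apply: mulr_ge0 => //; exact: expR_ge0.
  rewrite -[leRHS]mul1r ler_pdivlMr// -(@expr_le1 _ 2)//.
  have -> : (49 / 100 * expR (m / 2) * Num.sqrt y) ^+ 2 =
      (49 / 100) ^+ 2 * 2 * expR (6 / 10).
    transitivity ((49 / 100) ^+ 2 * 2 * expR (6 / 10) * (expR (- t) * expR t)).
      have : expR (m / 2) ^+ 2 = expR (6 / 10) * expR (- t).
        by rewrite expr2 -!expRD; congr expR; rewrite /m; lra.
      have G (u v w : R) : (u * v * w) ^+ 2 = u ^+ 2 * v ^+ 2 * w ^+ 2 by ring.
      rewrite G sqr_sqrtr ?ltW// => ->; rewrite yE.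
      by set c := (49 / 100) ^+ 2; ring.
    by rewrite -expRD addNr expR0 mulr1.
  have h : 7 / 10 <= expR (- (3 / 10)) :> R by apply: le_trans (expR_ge1Dx _); lra.
  have : expR (6 / 10) * expR (- (3 / 10)) ^+ 2 = 1 :> R.
    by rewrite expr2 -!expRD -[RHS]expR0; congr expR; lra.
  have := expR_gt0 (6 / 10 : R); set E := expR (6 / 10); set F := expR (- _) in h *.
  move=> E0 EF; have : (7 / 10) ^+ 2 <= F ^+ 2 by rewrite lerXn2r ?nnegrE ?expR_ge0.
  by nra.
split => //.
- move=> tau t0; have [h1 h2] := bprod_small t0 e12.
  have S0 := sinh_pi_ge t0.
  have Sp : 0 < sinh (pi * tau / 2) by apply: lt_le_trans S0; rewrite mulr_gt0.
  have t2 : 0 < tau ^+ 2 by rewrite exprn_gt0.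
  have tS : 31 / 20 * tau ^+ 2 <= tau * sinh (pi * tau / 2).
    by rewrite expr2 mulrCA ler_pM2l.
  have tS0 : 0 < tau * sinh (pi * tau / 2) by rewrite mulr_gt0.
  have k2 : kbound tau t <= 26 / 25 / tau ^+ 2.
    rewrite /kbound ler_pdivrMr// mulrAC ler_pdivlMr//.
    apply: (@le_trans _ _ ((19 / 15) ^+ 2 * tau ^+ 2)); first by rewrite ler_pM2r.
    apply: (@le_trans _ _ (26 / 25 * (31 / 20 * tau ^+ 2))); first by nra.
    by rewrite ler_pM2l.
  split => //; rewrite BT.
  have [t1|/ltW t1] := leP tau 1.
    rewrite /kbound ler_pdivrMr//; apply: le_trans (h2 t1) _; rewrite exprMn -/m.
    apply: (@le_trans _ _ (26 / 25 * (50 / 63) ^+ 2 * m ^+ 2 * (31 / 20 * tau ^+ 2))).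
      have w : 0 <= tau ^+ 2 * m ^+ 2 by apply: mulr_ge0; exact: sqr_ge0.
      lra.
    apply: ler_wpM2l => //; apply: mulr_ge0 (sqr_ge0 _).
    by apply: mulr_ge0 (sqr_ge0 _); apply: divr_ge0.
  apply: le_trans k2 _; apply: (@le_trans _ _ (26 / 25)).
    by rewrite ler_piMr// invf_le1// exprn_ege1.
  by nra.
- rewrite BT; apply: (@le_trans _ _ (13 / 2 * (49 / 100 * expR (m / 2)))).
    by nra.
  by rewrite ler_pM2l.
- have -> : 8 / 3 * (26 / 25) ^+ 2 / (63 / 50 / m) ^+ 3 =
    8 / 3 * (26 / 25) ^+ 2 * (50 / 63) ^+ 3 * m ^+ 3 by field; rewrite gt_eqF.
  apply: (@le_trans _ _ ((13 / 2) ^+ 2 * (49 / 100 * expR (m / 2)))).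
    have : 0 <= m ^+ 3 by rewrite exprn_ge0// ltW.
    by nra.
  by rewrite ler_pM2l// exprn_gt0.
Qed.

End KernelBound.

(** * Identification with the Bessel functions *)

Section BesselOnLine.
Context {R : realType}.
Local Open Scope complex_scope.
Implicit Types (sg tau psi t x y : R).

Lemma Re_sum (u : R[i]^nat) n :
  complex.Re (\sum_(0 <= k < n) u k) = \sum_(0 <= k < n) complex.Re (u k).
Proof.
elim: n => [|n IH]; first by rewrite !big_nil.
by rewrite !big_nat_recr//= -IH; case: (\sum_(_ <= _ < _) _) (u n) => ? ? [].
Qed.

Lemma Im_sum (u : R[i]^nat) n :
  complex.Im (\sum_(0 <= k < n) u k) = \sum_(0 <= k < n) complex.Im (u k).
Proof.
elim: n => [|n IH]; first by rewrite !big_nil.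
by rewrite !big_nat_recr//= -IH; case: (\sum_(_ <= _ < _) _) (u n) => ? ? [].
Qed.

(** Each term is a real number times e^(i phase); its cosine is the sine of the phase shifted by pi
    / 2, so one real series serves both components. *)
Lemma bessel_series_line sg tau y (u : R[i]^nat) : `|sg| = 1 -> 0 < y ->
  (forall k, u k = (sg ^+ k / k`!%:R)%:C * inv_Gamma (k%:R + tau *i + 1)
                   * cpow (y / 2) ((2 * k)%:R + tau *i)) ->
  limn (series u : (R[i]^o)^nat) = (Gmod tau)%:C *
    (bser sg tau (Garg tau + pi / 2) (ln (y / 2)) +i* bser sg tau (Garg tau) (ln (y / 2))).
Proof.
move=> sg1 y0 uE; set t := ln (y / 2).
have y20 : 0 < y / 2 by rewrite divr_gt0.
have E k : u k = (Gmod tau)%:C *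
    (bterm sg tau (Garg tau + pi / 2) t k +i* bterm sg tau (Garg tau) t k).
  rewrite uE inv_Gamma_line.
  have -> : cpow (y / 2) ((2 * k)%:R + tau *i) = ((expR t ^+ 2) ^+ k)%:C * cis (tau * t).
    rewrite /cpow -/t.
    have -> : ((2 * k)%:R + tau *i) * t%:C = ((2 * k)%:R * t) +i* (tau * t).
      have -> : (2 * k)%:R = ((2 * k)%:R : R)%:C :> R[i] by rewrite rmorph_nat.
      by apply/eqP; rewrite eq_complex /=; apply/andP; split; apply/eqP; ring.
    by rewrite cexpE expRM_natl exprM.
  have F (a b c d e : R[i]) : a * (b * c) * (d * e) = a * b * d * (c * e) by ring.
  rewrite F -cisD -!rmorphM.
  have -> : Garg tau - Garg_sum tau k + tau * t = bphase tau (Garg tau) t k.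
    by rewrite /bphase; ring.
  rewrite /bterm.
  have -> : bphase tau (Garg tau + pi / 2) t k = bphase tau (Garg tau) t k + pi / 2.
    by rewrite /bphase; ring.
  rewrite sinDpihalf /bcoef.
  have f0 := lt0r_neq0 (factR_gt0 (R := R) k).
  have p0 : Gmod_prod tau k != 0 by rewrite gt_eqF// (lt_le_trans ltr01)// Gmod_prod_ge1.
  rewrite /cis; move: (cos _) (sin _) ((_ ^+ 2) ^+ k) (sg ^+ k) (Gmod tau) => C S e s g.
  by apply/eqP; rewrite eq_complex /=; apply/andP; split; apply/eqP; field; rewrite f0 p0.
have cs psi := @cvg_bser _ sg tau psi sg1 t.
apply: limn_complex.
  rewrite /= mul0r subr0.
  rewrite (_ : (fun n => _) = (fun n => Gmod tau * series (bterm sg tau (Garg tau + pi / 2) t) n)).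
    by apply: cvgMr; exact: cs.
  apply/funext => n; rewrite /series /= Re_sum mulr_sumr; apply: eq_bigr => k _.
  by rewrite E /= mul0r subr0.
rewrite /= mul0r addr0.
rewrite (_ : (fun n => _) = (fun n => Gmod tau * series (bterm sg tau (Garg tau) t) n)).
  by apply: cvgMr; exact: cs.
apply/funext => n; rewrite /series /= Im_sum mulr_sumr; apply: eq_bigr => k _.
by rewrite E /= mul0r addr0.
Qed.

Lemma besselJ_line tau y : 0 < y -> besselJ (tau *i) y = (Gmod tau)%:C *
  (bser (-1) tau (Garg tau + pi / 2) (ln (y / 2)) +i* bser (-1) tau (Garg tau) (ln (y / 2))).
Proof.
move=> y0; apply: bessel_series_line => // [|k]; first by rewrite normrN normr1.
congr (_ * _ * _); rewrite rmorphM fmorphV rmorphXn rmorphN rmorph1 rmorph_nat //.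
Qed.

Lemma besselI_line tau y : 0 < y -> besselI (tau *i) y = (Gmod tau)%:C *
  (bser 1 tau (Garg tau + pi / 2) (ln (y / 2)) +i* bser 1 tau (Garg tau) (ln (y / 2))).
Proof.
move=> y0; apply: bessel_series_line => // [|k]; first by rewrite normr1.
by congr (_ * _ * _); rewrite expr1n mul1r fmorphV rmorph_nat.
Qed.

Lemma btermN sg tau psi t k : bterm sg (- tau) (- psi) t k = - bterm sg tau psi t k.
Proof.
rewrite /bterm /bcoef Gmod_prodN /bphase Garg_sumN.
have -> : - tau * t - psi - - Garg_sum tau k = - (tau * t + psi - Garg_sum tau k) by ring.
by rewrite sinN mulrN.
Qed.

Lemma bserN sg tau psi t : `|sg| = 1 -> bser sg (- tau) (- psi) t = - bser sg tau psi t.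
Proof.
move=> sg1; apply: cvg_lim => //.
rewrite (_ : series _ = (fun n => - series (bterm sg tau psi t) n)).
  by apply: cvgN; exact: cvg_bser.
by apply/funext => n; rewrite /series /= -sumrN; apply: eq_bigr => k _; rewrite btermN.
Qed.

Lemma bser_cosN sg tau psi t : 
  bser sg (- tau) (- psi + pi / 2) t = bser sg tau (psi + pi / 2) t.
Proof.
rewrite /bser; congr (limn (series _)); apply/funext => k.
rewrite /bterm /bcoef Gmod_prodN /bphase Garg_sumN.
have -> : - tau * t + (- psi + pi / 2) - - Garg_sum tau k =
  - (tau * t + psi - Garg_sum tau k) + pi / 2 by ring.
have -> : tau * t + (psi + pi / 2) - Garg_sum tau k =
  tau * t + psi - Garg_sum tau k + pi / 2 by ring.
by rewrite !sinDpihalf cosN.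
Qed.

(** I_(-i tau) is the conjugate of I_(i tau), so the difference is -2i Im I_(i tau), and sin(i pi
    tau) = i sinh(pi tau): the quotient is real. *)
Lemma besselK_line tau y : tau != 0 -> 0 < y -> besselK (tau *i) y =
  (- (pi * Gmod tau * bser 1 tau (Garg tau) (ln (y / 2)) / sinh (pi * tau)))%:C.
Proof.
(* A nonzero imaginary order is not an integer, so the limit branch is excluded. *)
move=> tau0 y0; rewrite /besselK; case: asboolP => [[m /eqP]|_].
  have -> : m%:~R = (m%:~R : R)%:C :> R[i] by rewrite rmorph_int.
  by rewrite eq_complex /= (negbTE tau0) andbF.
rewrite /besselK_quotient.
have -> : - (tau *i) = (- tau) *i :> R[i] by apply/eqP; rewrite eq_complex /= oppr0 !eqxx.
rewrite !besselI_line// GmodN GargN bser_cosN bserN ?normr1//.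
set B := bser 1 tau (Garg tau) _; set C := bser _ _ _ _; set g := Gmod tau.
have sh0 : sinh (pi * tau) != 0.
  have [t0|t0|/eqP] := ltgtP tau 0; last by rewrite (negbTE tau0).
    by rewrite -[tau]opprK mulrN sinhN oppr_eq0 gt_eqF// sinh_gt0// mulr_gt0 ?pi_gt0// oppr_gt0.
  by rewrite gt_eqF// sinh_gt0// mulr_gt0 ?pi_gt0.
have -> : csin (tau *i * pi%:C) = 'i * (sinh (pi * tau))%:C.
  rewrite /csin.
  have e (z : R) : cexp (z%:C) = (expR z)%:C by rewrite cexpE cis0 mulr1.
  have -> : 'i * (tau *i * pi%:C) = (- (pi * tau))%:C :> R[i].
    by apply/eqP; rewrite eq_complex /=; apply/andP; split; apply/eqP; ring.
  have -> : - (- (pi * tau))%:C = (pi * tau)%:C :> R[i] by rewrite rmorphN opprK.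
  rewrite !e -rmorphB /= /sinh.
  have i0 : 'i != 0 :> R[i] by rewrite eq_complex /= oner_eq0 andbF.
  apply: (canLR (mulfK _)); first by rewrite mulf_neq0// pnatr_eq0.
  have -> : 'i * ((expR (pi * tau) - expR (- (pi * tau))) / 2)%:C * (2 * 'i) =
    ('i * 'i) * (((expR (pi * tau) - expR (- (pi * tau))) / 2)%:C * 2%:R) :> R[i] by ring.
  have -> : 'i * 'i = -1 :> R[i] by rewrite -expr2 sqr_i.
  have -> : 2%:R = (2%:R : R)%:C :> R[i] by rewrite rmorph_nat.
  by rewrite -rmorphM /= divfK// mulN1r -rmorphN opprB.
have -> : g%:C * (C +i* - B) - g%:C * (C +i* B) = 'i * (- 2 * g * B)%:C.
  by apply/eqP; rewrite eq_complex /=; apply/andP; split; apply/eqP; ring.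
have i0 : 'i != 0 :> R[i] by rewrite eq_complex /= oner_eq0 andbF.
have s0 : (sinh (pi * tau))%:C != 0 :> R[i] by rewrite eq_complex /= (negbTE sh0).
apply: (canLR (mulfK _)); first by rewrite mulf_neq0.
rewrite mulrCA [RHS]mulrCA -!rmorphM; congr (_ * (_ : R)%:C).
by field.
Qed.

Definition kern x tau : R :=
  let t := ln (2 * Num.sqrt (2 * x) / 2) in
  - (pi * Gmod tau ^+ 2 * bprod tau t) / (sinh (pi * tau) * sinh (pi * tau / 2)).

(* Includes [tau = 0], where both sides divide by [sinh 0 = 0] and are zero. *)
Lemma G_integrandE (g : R -> R[i]) x tau : 0 < x ->
  G_integrand g x tau = (kern x tau)%:C * g tau.
Proof.
move=> x0; rewrite /G_integrand /kern; set y := 2 * Num.sqrt (2 * x).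
have y0 : 0 < y by rewrite mulr_gt0// sqrtr_gt0 mulr_gt0.
have [->|t0] := eqVneq tau 0.
  by rewrite !(mulr0, mul0r, sinh0, invr0).
rewrite besselK_line// besselJ_line//= mul0r addr0.
rewrite -fmorphV [g tau * _]mulrC mulrA -!rmorphM; congr ((_ : R)%:C * _).
have F (p h a b s r : R) : - (p * h * a / s) * (h * b) / r = - (p * h ^+ 2 * (a * b)) / (s * r).
  by rewrite invfM; ring.
exact: F.
Qed.

Lemma kernN x tau : kern x (- tau) = kern x tau.
Proof.
rewrite /kern /bprod GmodN GargN !bserN ?normrN ?normr1//.
by rewrite [pi * - tau]mulrN [- (pi * tau) / 2]mulNr !sinhN !mulrNN.
Qed.

Lemma kern_le x tau : 0 < tau ->
  `|kern x tau| <= kbound tau (ln (2 * Num.sqrt (2 * x) / 2)).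
Proof.
move=> t0; rewrite /kern /kbound; set t := ln _.
have s1 : 0 < sinh (pi * tau) by rewrite sinh_gt0// mulr_gt0 ?pi_gt0.
have s2 : 0 < sinh (pi * tau / 2) by rewrite sinh_gt0// divr_gt0// mulr_gt0 ?pi_gt0.
rewrite normrM normrN normrM normfV (gtr0_norm (mulr_gt0 s1 s2)).
have pg : 0 <= pi * Gmod tau ^+ 2 by apply: mulr_ge0 (pi_ge0 R) (sqr_ge0 _).
have s12 := mulr_gt0 s1 s2; have p0 := lt0r_neq0 (pi_gt0 R).
rewrite (ger0_norm pg) ler_pdivrMr//.
rewrite -[leRHS]mulrA [_^-1 * _]mulrC [leRHS]mulrC ler_wpM2r//.
have -> : sinh (pi * tau) * sinh (pi * tau / 2) / (tau * sinh (pi * tau / 2)) =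
  pi * (sinh (pi * tau) / (pi * tau)).
  have s20 := lt0r_neq0 s2; have t1 := lt0r_neq0 t0.
  have F (p h u v : R) : p != 0 -> h != 0 -> v != 0 -> u * v / (h * v) = p * (u / (p * h)).
    by move=> ? ? ?; field; apply/and3P.
  exact: F.
by rewrite ler_pM2l ?pi_gt0// Gmod_le.
Qed.

End BesselOnLine.

(** * Measurability of the kernel in [tau] *)

Section KernelMeasurable.
Context {R : realType}.
Implicit Types (f g : R -> R) (x y : R).
Local Notation meas f := (measurable_fun [set: R] (f : R -> R)).

(** Written as f (|f|^(-1))^2, which also holds at zeros of f because the inverse of 0 is 0. *)
Lemma measurable_funV f : meas f -> meas (fun t => (f t)^-1).
Proof.
move=> mf; have -> : (fun t => (f t)^-1) = (fun t => f t * (`|f t| `^ (-1)) ^+ 2).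
  apply/funext => t; rewrite powR_inv1// exprVn real_normK ?num_real//.
  have [->|f0] := eqVneq (f t) 0; first by rewrite mul0r invr0.
  by field.
apply: measurable_funM => //; apply: measurable_funX.
apply: (measurableT_comp (measurable_powR (-1))).
exact: (measurableT_comp (@normr_measurable _ _)).
Qed.

Lemma measurable_cont_comp (h : R -> R) f : continuous h -> meas f -> meas (fun t => h (f t)).
Proof. by move=> ch mf; apply: measurableT_comp => //; exact: continuous_measurable_fun. Qed.

Lemma measurable_id : meas (fun t => t).
Proof. by apply: continuous_measurable_fun => t; exact: cvg_id. Qed.

Lemma measurable_Gmod_prod n : meas (fun t => Gmod_prod t n).
Proof.
elim: n => [|n IH]; first by under eq_fun do rewrite /Gmod_prod big_ord0; exact: measurable_cst.
under eq_fun do rewrite /Gmod_prod big_ord_recr /=.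
apply: measurable_funM => //; apply: measurable_cont_comp; first exact: sqrt_continuous.
apply: measurable_funD; first exact: measurable_cst.
by apply: measurable_funM; [apply: measurable_funX; exact: measurable_id|exact: measurable_cst].
Qed.

Lemma measurable_Garg_sum n : meas (fun t => Garg_sum t n).
Proof.
rewrite /Garg_sum; apply: measurable_sum => j.
apply: measurable_cont_comp; first exact: continuous_atan.
by apply: measurable_funM; [exact: measurable_id|exact: measurable_cst].
Qed.

Lemma measurable_Gmod : meas Gmod.
Proof.
apply: (@measurable_fun_cvg _ _ _ _ (fun n t => Gmod_prod t n)).
  exact: measurable_Gmod_prod.
by move=> t _; exact: cvg_Gmod.
Qed.

Lemma measurable_Garg : meas Garg.
Proof.
apply: (@measurable_fun_cvg _ _ _ _ (fun n t => Garg_sum t n - t * ln n%:R)).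
  move=> n; apply: measurable_funB; first exact: measurable_Garg_sum.
  by apply: measurable_funM; [exact: measurable_id|exact: measurable_cst].
by move=> t _; exact: cvg_Garg.
Qed.

Lemma measurable_bser (sg t : R) : `|sg| = 1 -> meas (fun tau => bser sg tau (Garg tau) t).
Proof.
move=> sg1.
apply: (@measurable_fun_cvg _ _ _ _ (fun n tau => series (bterm sg tau (Garg tau) t) n)).
  move=> n; rewrite /series /=; apply: measurable_sum => k; rewrite /bterm.
  apply: measurable_funM; last first.
    apply: measurable_cont_comp; first exact: continuous_sin.
    rewrite /bphase; apply: measurable_funB; last exact: measurable_Garg_sum.
    apply: measurable_funD; last exact: measurable_Garg.
    by apply: measurable_funM; [exact: measurable_id|exact: measurable_cst].
  apply: measurable_funM; last exact: measurable_cst.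
  apply: measurable_funM; first exact: measurable_cst.
  apply: measurable_funV; apply: measurable_funM; first exact: measurable_cst.
  exact: measurable_Gmod_prod.
by move=> tau _; exact: cvg_bser.
Qed.

Lemma measurable_sinh : meas sinh.
Proof.
rewrite /sinh; apply: measurable_funM; last exact: measurable_cst.
apply: measurable_funB; first exact: measurable_expR.
apply: (measurableT_comp (@measurable_expR _)); apply: measurable_funN.
exact: measurable_id.
Qed.

Lemma measurable_kern x : meas (kern x).
Proof.
have n1 : `|1 : R| = 1 by rewrite normr1.
have nN1 : `|-1 : R| = 1 by rewrite normrN normr1.
have mp (c : R) : meas (fun t => sinh (pi * t * c)).
  apply: (measurableT_comp measurable_sinh).
  apply: measurable_funM; last exact: measurable_cst.
  by apply: measurable_funM; [exact: measurable_cst|exact: measurable_id].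
rewrite /kern /=; apply: measurable_funM.
  apply: measurable_funN; apply: measurable_funM.
    apply: measurable_funM; first exact: measurable_cst.
    by apply: measurable_funX; exact: measurable_Gmod.
  by apply: measurable_funM; exact: measurable_bser.
apply: measurable_funV; apply: measurable_funM; last exact: mp.
by have := mp 1; under eq_fun do rewrite mulr1.
Qed.

End KernelMeasurable.

(** * Integrals of the majorant and of Euler's beta function *)

Section Majorant.
Context {R : realType}.
Implicit Types x y t B T : R.
Local Notation leb := (@lebesgue_measure R).

(** The square of the pointwise kernel bound, for the L_2 estimate. *)
Definition majorant B T t : R := B ^+ 2 / Num.max T `|t| ^+ 4.

Lemma majorant_gt0 T t : 0 < T -> 0 < Num.max T `|t|.
Proof. by move=> T0; rewrite lt_max T0. Qed.

Lemma majorant_ge0 B T t : 0 <= majorant B T t.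
Proof. by rewrite divr_ge0 ?sqr_ge0// exprn_even_ge0. Qed.

Lemma continuous_majorant B T : 0 < T -> continuous (majorant B T).
Proof.
move=> T0 t; apply: cvgMr; apply: cvgV.
  by rewrite expf_neq0// gt_eqF// majorant_gt0.
have cm : {for t, continuous (fun t : R => Num.max T `|t|)}.
  by apply: continuous_max; [exact: cvg_cst|exact: norm_continuous].
rewrite -[_ ^+ 4]/(_ * (_ * (_ * _))).
by apply: cvgM => //; apply: cvgM => //; apply: cvgM.
Qed.

Lemma integral_majorant B T : 0 < T ->
  (\int[leb]_t (majorant B T t)%:E = (8 / 3 * B ^+ 2 / T ^+ 3)%:E)%E.
Proof.
move=> T0.
have cm := @continuous_majorant B T T0.
rewrite ge0_symfun_integralT//; last 2 first.
- exact: majorant_ge0.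
- by move=> t; rewrite /majorant /= normrN.
have -> : [set t : R | 0 <= t] = `[0, T[ `|` `[T, +oo[.
  apply/seteqP; split => t /=; rewrite !in_itv /= ?andbT.
    by move=> t0; have [tT|tT] := ltP t T; [left; rewrite t0|right].
  by move=> [/andP[]//|]; apply: le_trans; exact: ltW.
have mm : measurable_fun [set: R] (fun t => (majorant B T t)%:E).
  by apply/measurable_EFinP; exact: continuous_measurable_fun.
rewrite ge0_integral_setU//=; last 3 first.
- exact: measurable_funTS.
- by move=> t _; rewrite lee_fin majorant_ge0.
- apply/disj_setPLR => t /=; rewrite !in_itv /= andbT => /andP[_ tT].
  by apply/negP; rewrite -ltNge.
have -> : (\int[leb]_(t in `[0%R, T[) (majorant B T t)%:E = (B ^+ 2 / T ^+ 3)%:E)%E.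
  under eq_integral => t.
    rewrite inE /= in_itv /= => /andP[t0 tT].
    have -> : majorant B T t = B ^+ 2 / T ^+ 4 by rewrite /majorant ger0_norm// max_l// ltW.
    over.
  rewrite integral_cst//= lebesgue_measure_itv /= lte_fin T0 sube0 -EFinM; congr EFin.
  by field; rewrite gt_eqF.
have -> : (\int[leb]_(t in `[T, +oo[) (majorant B T t)%:E = (B ^+ 2 / (3 * T ^+ 3))%:E)%E.
  pose F (t : R) : R := - (B ^+ 2 / 3) * (t^-1) ^+ 3.
  have dF (t : R) : 0 < t -> is_derive t 1 F (B ^+ 2 / t ^+ 4).
    move=> t0; have ? : is_derive t 1 (fun u : R => u^-1) (- t ^- 2 *: 1).
      by apply: is_deriveV; rewrite gt_eqF.
    by apply: is_derive_eq; rewrite /GRing.scale /=; field; rewrite gt_eqF.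
  rewrite (@ge0_continuous_FTC2y _ _ F T 0).
  - rewrite sub0e -EFinN; congr EFin; rewrite /F; field; rewrite gt_eqF//.
  - by move=> t _; exact: majorant_ge0.
  - by apply: continuous_subspaceT; exact: cm.
  - rewrite -[X in _ --> X](mulr0 (- (B ^+ 2 / 3))); apply: cvgMr.
    have c0 : (t : R)^-1 @[t --> +oo] --> (0 : R).
      by apply/(gtr0_cvgV0 (f := fun t : R => t)); [exact: nbhs_pinfty_gt|exact: cvg_id].
    have c3 : (t : R)^-1 * (t^-1 * t^-1) @[t --> +oo] --> (0 : R) * (0 * 0).
      by apply: cvgM => //; apply: cvgM.
    by rewrite !mulr0 in c3; exact: c3.
  - move=> t Tt; have := dF t (lt_trans T0 Tt) => ?; exact: ex_derive.
  - have := dF T T0 => dT; apply: cvg_at_right_filter.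
    by apply: differentiable_continuous; apply/derivable1_diffP; exact: ex_derive.
  - move=> t; rewrite in_itv /= andbT => Tt; have := dF t (lt_trans T0 Tt) => dt.
    by rewrite derive1E derive_val /majorant gtr0_norm ?(lt_trans T0)// max_r// ltW.
rewrite -EFinD -EFinM; congr EFin; field; rewrite gt_eqF//.
Qed.

End Majorant.

Section BetaBound.
Context {R : realType}.
Implicit Types a t : R.
Local Notation leb := (@lebesgue_measure R).
Variable s : R.
Hypothesis s01 : 0 < s < 1.

(* With [u = t `^ (s - 1)] and [v = (1 - t) `^ (s - 1)], both at least 1, the integrand
   [u * v] is at least [u + v - 1], whose primitive is explicit. *)

Let s0 : 0 < s. Proof. by case/andP: s01. Qed.
Let s1 : s < 1. Proof. by case/andP: s01. Qed.
Let f t : R := t `^ (s - 1) * (1 - t) `^ (s - 1).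
Let h t : R := t `^ (s - 1) + (1 - t) `^ (s - 1).
Let F t : R := (t `^ s - (1 - t) `^ s) / s.

Let f0 t : 0 <= f t.
Proof. by rewrite mulr_ge0 ?powR_ge0. Qed.

Let h0 t : 0 <= h t.
Proof. by rewrite addr_ge0 ?powR_ge0. Qed.

Let mpow1 : measurable_fun [set: R] (fun t : R => t `^ (s - 1)).
Proof. exact: measurable_powR. Qed.

Let mpow2 : measurable_fun [set: R] (fun t : R => (1 - t) `^ (s - 1)).
Proof.
apply: (measurableT_comp (measurable_powR (s - 1))).
by apply: measurable_funB; [exact: measurable_cst|exact: measurable_id].
Qed.

Let mf : measurable_fun [set: R] f.
Proof. exact: measurable_funM. Qed.

Let mh : measurable_fun [set: R] h.
Proof. exact: measurable_funD. Qed.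

Let dpow2 (e t : R) : t < 1 ->
  is_derive t 1 (fun t : R => (1 - t) `^ e) (- (e * (1 - t) `^ (e - 1))).
Proof.
move=> t1.
have ? : is_derive (1 - t) 1 ((@powR R)^~ e) (e * (1 - t) `^ (e - 1)).
  by apply: is_derive1_powR; rewrite subr_gt0.
apply: is_derive_eq (is_derive1_comp (f := (@powR R)^~ e) (g := fun t : R => 1 - t) _ _) _.
by rewrite /GRing.scale /=; ring.
Qed.

Let dF t : 0 < t < 1 -> is_derive t 1 F (h t).
Proof.
move=> /andP[t0 t1]; have ? := @is_derive1_powR R s t t0; have ? := dpow2 s t1.
by apply: is_derive_eq; rewrite /GRing.scale /= /h; field; rewrite gt_eqF.
Qed.

Let ch t : 0 < t < 1 -> {for t, continuous h}.
Proof.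
move=> /andP[t0 t1]; have d1 := @is_derive1_powR R (s - 1) t t0; have d2 := dpow2 (s - 1) t1.
apply: differentiable_continuous; apply/derivable1_diffP; rewrite /h.
exact: ex_derive.
Qed.

Let cF t : 0 < t < 1 -> {for t, continuous F}.
Proof.
move=> /dF d; apply: differentiable_continuous; apply/derivable1_diffP; exact: ex_derive.
Qed.

Let in01 a t : 0 < a -> a <= t <= 1 - a -> 0 < t < 1.
Proof. by move=> ? /andP[? ?]; apply/andP; split; lra. Qed.

(** The integrand is unbounded at both ends of [0, 1] when extended continuously, so the fundamental
    theorem is applied away from them. *)
Let int_h a : 0 < a < 1 / 2 ->
  (\int[leb]_(t in `[a, (1 - a)%R]) (h t)%:E)%E = (2 / s * ((1 - a) `^ s - a `^ s))%:E :> \bar R.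
Proof.
move=> /andP[a0 a2].
rewrite (@continuous_FTC2 _ h F).
- rewrite -EFinB; congr EFin; rewrite /F subKr; field; rewrite gt_eqF//.
- by lra.
- apply: continuous_in_subspaceT => t; rewrite inE /= in_itv /= => /(in01 a0); exact: ch.
- split.
  + move=> t; rewrite in_itv /= => /andP[/ltW at_ /ltW ta].
    have t01 : 0 < t < 1 by apply: (@in01 a) => //; rewrite at_.
    by have ? := dF t01; exact: ex_derive.
  + by apply: cvg_at_right_filter; apply: cF; apply/andP; split; lra.
  + by apply: cvg_at_left_filter; apply: cF; apply/andP; split; lra.
- move=> t; rewrite in_itv /= => /andP[/ltW at_ /ltW ta].
  have t01 : 0 < t < 1 by apply: (@in01 a) => //; rewrite at_.
  by have ? := dF t01; rewrite derive1E derive_val.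
Qed.

Let pow_ge1 t : 0 < t <= 1 -> 1 <= t `^ (s - 1).
Proof.
by move=> t01; rewrite -[leLHS](powRr0 t); apply: ger_powR => //; rewrite subr_le0 ltW.
Qed.

Let pow_le2 t : 1 / 2 <= t -> t `^ (s - 1) <= 2.
Proof.
move=> t2; have t0 : 0 < t by lra.
have -> : s - 1 = - (1 - s) by ring.
rewrite powRN; apply: (@le_trans _ _ ((1 / 2 : R) `^ (1 - s))^-1).
  have h2 : (1 / 2 : R) `^ (1 - s) <= t `^ (1 - s).
    have ? : 0 <= 1 - s by rewrite subr_ge0 ltW.
    by apply: ge0_ler_powR; rewrite ?nnegrE//; lra.
  by rewrite lef_pV2 ?posrE ?powR_gt0//; lra.
rewrite -[leRHS]invrK lef_pV2 ?posrE; last 2 first.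
- by rewrite powR_gt0//; lra.
- by lra.
apply: (@le_trans _ _ ((1 / 2 : R) `^ 1)); first by rewrite powRr1 ?div1r//; lra.
apply: ger_powR; [by apply/andP; split; lra|by rewrite gerBl ltW].
Qed.

(** Left: (u - 1)(v - 1) >= 0. Right: one of t and 1 - t is at least 1/2, so one of u and v is at
    most 2. *)
Let fh t : 0 < t < 1 -> h t - 1 <= f t <= 2 * h t.
Proof.
move=> /andP[t0 t1]; rewrite /f /h.
have x1 : 1 <= t `^ (s - 1) by rewrite pow_ge1// t0 ltW.
have y1 : 1 <= (1 - t) `^ (s - 1) by rewrite pow_ge1//; apply/andP; lra.
have xy : t `^ (s - 1) <= 2 \/ (1 - t) `^ (s - 1) <= 2.
  by have [t2|t2] := leP (1 / 2) t; [left|right]; apply: pow_le2; lra.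
by apply/andP; split; [|case: xy]; nra.
Qed.

Let int_f_le a : 0 < a < 1 / 2 ->
  (\int[leb]_(t in `[a, (1 - a)%R]) (f t)%:E <= (4 / s)%:E)%E.
Proof.
move=> a02; have /andP[a0 a2] := a02.
apply: (@le_trans _ _ (\int[leb]_(t in `[a, (1 - a)%R]) (2 * h t)%R%:E)%E).
  apply: ge0_le_integral => //=.
  - by move=> t _; rewrite lee_fin.
  - by apply/measurable_EFinP; apply: measurable_funTS.
  - by apply/measurable_EFinP; apply: measurable_funTS; apply: measurable_funM.
  - by move=> t; rewrite in_itv /= lee_fin => /(in01 a0) /fh /andP[].
under eq_integral do rewrite EFinM.
rewrite ge0_integralZl//=; last 2 first.
- by apply/measurable_EFinP; apply: measurable_funTS.
- by move=> t _; rewrite lee_fin.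
rewrite int_h// -EFinM lee_fin.
have : (1 - a) `^ s <= 1.
  rewrite -[leRHS](powRr0 (1 - a)); apply: ger_powR; last exact: ltW.
  by apply/andP; split; lra.
have := powR_ge0 a s; move: (a `^ s) ((1 - a) `^ s) => x y x0 y1.
have -> : 4 / s = 2 / s * 2 by field; rewrite gt_eqF.
rewrite mulrCA; apply: ler_wpM2l; last by lra.
by apply: divr_ge0 => //; exact: ltW.
Qed.

(** [Beta] is the real part of an extended integral, with value 0 if that were infinite; a lower
    bound on [Beta] therefore needs finiteness first. *)
Let int_f_fin : (\int[leb]_(t in `[0%R, 1%R]) (f t)%:E < +oo)%E.
Proof.
pose G n : set R := `[(n.+3%:R)^-1, 1 - (n.+3%:R)^-1]%classic.
have a02 n : 0 < (n.+3%:R : R)^-1 < 1 / 2.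
  apply/andP; split; first by rewrite invr_gt0 ltr0n.
  by rewrite (div1r 2) ltf_pV2 ?posrE ?ltr0n// ltr_nat.
rewrite integral_itv_bndoo; last by apply/measurable_EFinP; apply: measurable_funTS.
have -> : `]0%R, 1%R[%classic = \bigcup_n G n.
  apply/seteqP; split => t /=; rewrite ?in_itv /=.
    move=> /andP[t0 t1]; have t1' : 0 < 1 - t by rewrite subr_gt0.
    pose m := Num.truncn ((Num.min t (1 - t))^-1).
    exists m => //; rewrite /G /= in_itv /=.
    have mp : 0 < Num.min t (1 - t) by rewrite lt_min t0.
    have hm : (m.+3%:R : R)^-1 <= Num.min t (1 - t).
      rewrite -[leRHS]invrK lef_pV2 ?posrE ?invr_gt0 ?ltr0n//.
      apply: le_trans (ltW (truncnS_gt _)) _; rewrite ler_nat.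
      by rewrite ltnS leqW.
    by move: hm; rewrite le_min; move: (m.+3%:R^-1) => r /andP[h1 h2]; rewrite h1 /=; lra.
  move=> [n _]; rewrite /G /= in_itv /=; apply: in01.
  by rewrite invr_gt0 ltr0n.
have mG n : measurable (G n) by exact: measurable_itv.
have c : (\int[leb]_(t in G n) (f t)%:E @[n --> \oo] -->
    \int[leb]_(t in \bigcup_n G n) (f t)%:E)%E.
  apply: ge0_nondecreasing_set_cvg_integral => //.
  - move=> n m nm; apply/subsetPset => t; rewrite /G /= !in_itv /= => /andP[h1 h2].
    have : (m.+3%:R : R)^-1 <= n.+3%:R^-1 by rewrite lef_pV2 ?posrE ?ltr0n// ler_nat.
    by move: (m.+3%:R^-1) (n.+3%:R^-1) h1 h2 => u v *; apply/andP; split; lra.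
  - by move=> n; apply/measurable_EFinP; apply: measurable_funTS.
  - by move=> n t _; rewrite lee_fin.
apply: (@le_lt_trans _ _ (4 / s)%:E); last exact: ltry.
rewrite -(cvg_lim _ c)//; apply: lime_le; first exact: (cvgP _ c).
by near=> n; exact: int_f_le.
Unshelve. all: by end_near. Qed.

Lemma Beta_ge : 2 / s - 1 <= Beta s s.
Proof.
have If : (\int[leb]_(t in `[0%R, 1%R]) (f t)%:E)%E \is a fin_num.
  rewrite ge0_fin_numE//; apply: integral_ge0 => t _; rewrite lee_fin; exact: f0.
apply/ler_addgt0Pr => e e0.
pose d := Num.min (1 / 4) (s * e / 4).
have d0 : 0 < d by rewrite lt_min !divr_gt0// mulr_gt0.
have d4 : d <= 1 / 4 by rewrite ge_min lexx.
have de : d <= s * e / 4 by rewrite ge_min lexx orbT.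
(* This makes both a^s and 1 - (1 - a)^s at most d, so truncation costs at most (2/s)(2d) <= e. *)
pose a := Num.min d (d `^ s^-1).
have a0 : 0 < a by rewrite lt_min d0 powR_gt0.
have ad : a <= d by rewrite ge_min lexx.
have asd : a `^ s <= d.
  apply: (@le_trans _ _ ((d `^ s^-1) `^ s)).
    apply: (ge0_ler_powR (ltW s0)); rewrite ?nnegrE ?powR_ge0 ?(ltW a0)//.
    by rewrite /a ge_min lexx orbT.
  by rewrite -powRrM mulVf ?gt_eqF// powRr1// ltW.
have a02 : 0 < a < 1 / 2 by rewrite a0 /=; lra.
have a1s : 1 - d <= (1 - a) `^ s.
  apply: (@le_trans _ _ (1 - a)); first by lra.
  by apply: ger1_powR; [apply/andP; split; lra|exact: ltW].
suff : ((2 / s * ((1 - a) `^ s - a `^ s) - 1)%R%:E <=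
    \int[leb]_(t in `[0%R, 1%R]) (f t)%:E)%E.
  rewrite -(fineK If) lee_fin -[fine _]/(Beta s s) => H.
  rewrite -lerBlDr; apply: le_trans H.
  have s20 : 0 <= 2 / s by apply: divr_ge0 => //; exact: ltW.
  have : 2 / s * (1 - d - d) <= 2 / s * ((1 - a) `^ s - a `^ s).
    by apply: ler_wpM2l => //; lra.
  have : 2 / s * (d + d) <= e.
    apply: (@le_trans _ _ (2 / s * (s * e / 4 + s * e / 4))).
      by apply: ler_wpM2l => //; lra.
    by rewrite le_eqVlt; apply/orP; left; apply/eqP; field; rewrite gt_eqF.
  by move: (2 / s) => w *; lra.
apply: (@le_trans _ _ (\int[leb]_(t in `[a, (1 - a)%R]) (f t)%:E)%E); last first.
  apply: ge0_subset_integral => //.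
  - by apply/measurable_EFinP; apply: measurable_funTS.
  - by move=> t _; rewrite lee_fin.
  - move=> t /=; rewrite !in_itv /= => /(in01 a0) /andP[/ltW -> /ltW ->] //.
rewrite EFinB -int_h// leeBlDr//.
have -> : (1%:E = \int[leb]_(t in `[0%R, 1%R]) (cst 1%:E t) :> \bar R)%E.
  by rewrite integral_cst//= lebesgue_measure_itv /= lte_fin ltr01 sube0 mule1.
apply: (@le_trans _ _ (\int[leb]_(t in `[a, (1 - a)%R]) (f t + 1)%R%:E)%E).
  apply: ge0_le_integral => //=.
  - by move=> t _; rewrite lee_fin.
  - by apply/measurable_EFinP; apply: measurable_funTS.
  - by apply/measurable_EFinP; apply: measurable_funTS; apply: measurable_funD.
  - by move=> t; rewrite in_itv /= lee_fin => /(in01 a0) /fh /andP[]; lra.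
under eq_integral do rewrite EFinD.
rewrite ge0_integralD//=; last 2 first.
- by move=> t _; rewrite lee_fin.
- by apply/measurable_EFinP; apply: measurable_funTS.
rewrite leeD2l//; apply: ge0_subset_integral => //=.
by move=> t /=; rewrite !in_itv /= => /(in01 a0) /andP[/ltW -> /ltW ->].
Qed.

End BetaBound.

(** * The constant of the theorem *)

Section Constant.
Context {R : realType}.
Implicit Types p x : R.

Lemma ln2_ge : 2 / 3 <= ln (2 : R).
Proof.
have h := @expR_N23 R.
have : ln (1 / 2 : R) <= ln (expR (- (2 / 3))) by rewrite ler_ln ?posrE ?expR_gt0//; lra.
by rewrite div1r lnV ?posrE// expRK; lra.
Qed.

Lemma ln_ge_sub_inv p : 0 < p -> 1 - p^-1 <= ln p.
Proof.
move=> p0; have : ln (1 + (p^-1 - 1)) <= p^-1 - 1.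
  apply: le_ln1Dx; have : 0 < p^-1 by rewrite invr_gt0.
  by lra.
by rewrite addrC subrK lnV ?posrE//; lra.
Qed.

(** With u = 1/p, ln p >= 1 - u and ln 2 >= 2/3, the exponent is at least 1 - (5/6) u + u^2 / 2,
    minimal at u = 5/6 with value above 65/100. The target 13/7 is 13/2 divided by 7/2. *)
Lemma numeric_const_ge p : 1 < p <= 2 -> 13 / 7 <= expR (ln 2 / p + (1 - 1 / (2 * p)) * ln p).
Proof.
move=> /andP[p1 p2]; have p0 : 0 < p by lra.
have l2 := ln2_ge; have lp := ln_ge_sub_inv p0.
have -> : 1 / (2 * p) = p^-1 / 2 by field; rewrite gt_eqF.
have : p^-1 < 1 by rewrite invf_lt1.
have : 0 < p^-1 by rewrite invr_gt0.
move: (p^-1) lp => u lp u0 u1.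
have hz : 65 / 100 <= ln 2 * u + (1 - u / 2) * ln p.
  have a1 : 2 / 3 * u <= ln 2 * u by rewrite ler_pM2r.
  have a2 : (1 - u / 2) * (1 - u) <= (1 - u / 2) * ln p by apply: ler_wpM2l => //; lra.
  by have := sqr_ge0 (u - 5 / 6); nra.
apply: (@le_trans _ _ (expR (65 / 100))); last by rewrite ler_expR.
have := @expR_taylor_ge R 4 (65 / 100); rewrite !big_nat_recr //= big_nil.
by rewrite !factS fact0; lra.
Qed.

(** Since y^(-1/(2p)) = 2^(-3/(4p)) x^(-1/(4p)), replacing the beta value by 7 p leaves exactly
    (7/2) 2^(1/p) p^(1 - 1/(2p)) to compare with 13/2. *)
Lemma bound_const p x : 1 < p <= 2 -> 0 < x ->
  13 / 2 * (2 * Num.sqrt (2 * x)) `^ (- (1 / (2 * p))) <=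
  2 `^ (1 / (4 * p) - 1) * p `^ (- (1 / (2 * p))) * x `^ (- (1 / (4 * p)))
    * Beta (1 / (4 * p)) (1 / (4 * p)).
Proof.
move=> p12 x0; have /andP[p1 p2] := p12; have p0 : 0 < p by lra.
have Bs : 7 * p <= Beta (1 / (4 * p)) (1 / (4 * p)).
  apply: le_trans (Beta_ge _); last first.
    apply/andP; split; first by rewrite divr_gt0// mulr_gt0.
    by rewrite ltr_pdivrMr ?mulr_gt0//; lra.
  have -> : 2 / (1 / (4 * p)) = 8 * p by field; rewrite gt_eqF.
  by lra.
have y0 : 0 < 2 * Num.sqrt (2 * x) by rewrite mulr_gt0// sqrtr_gt0 mulr_gt0.
have yE : ln (2 * Num.sqrt (2 * x)) = 3 / 2 * ln 2 + ln x / 2.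
  have e : (2 * Num.sqrt (2 * x)) ^+ 2 = 2 ^+ 3 * x.
    by rewrite exprMn sqr_sqrtr ?mulr_ge0 ?ltW//; ring.
  have := congr1 (@ln R) e; rewrite lnXn// lnM ?posrE// ?exprn_gt0// lnXn//.
  by rewrite -[X in X = _]mulr_natl -[X in _ = X + _]mulr_natl; lra.
have h := numeric_const_ge p12.
rewrite /powR !gt_eqF// yE.
apply: le_trans (ler_wpM2l _ Bs); last by rewrite !mulr_ge0 ?expR_ge0.
rewrite -[X in _ <= _ * (7 * X)](lnK (_ : p \in Num.pos))//.
have -> : - (1 / (2 * p)) * (3 / 2 * ln 2 + ln x / 2) =
  - (3 / (4 * p)) * ln 2 + - (1 / (4 * p)) * ln x by field; rewrite gt_eqF.
have e2 : expR (- ln 2) = 1 / 2 :> R by rewrite expRN lnK ?posrE// div1r.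
have -> : expR ((1 / (4 * p) - 1) * ln 2) * expR (- (1 / (2 * p)) * ln p) *
  expR (- (1 / (4 * p)) * ln x) * (7 * expR (ln p)) =
  7 / 2 * (expR (ln 2 / p + (1 - 1 / (2 * p)) * ln p)) *
  (expR (- (3 / (4 * p)) * ln 2) * expR (- (1 / (4 * p)) * ln x)).
  have -> : (1 / (4 * p) - 1) * ln 2 = ln 2 / p + - (3 / (4 * p)) * ln 2 + - ln 2.
    by field; rewrite gt_eqF.
  have -> : (1 - 1 / (2 * p)) * ln p = - (1 / (2 * p)) * ln p + ln p by ring.
  by rewrite !expRD e2; field.
rewrite expRD; apply: ler_wpM2r; first by rewrite mulr_ge0 ?expR_ge0.
by lra.
Qed.

End Constant.

(** * Norms of the kernel and conclusion *)

Section KernelNorm.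
Context {R : realType}.
Implicit Types x tau q M r : R.
Local Notation leb := (@lebesgue_measure R).

Lemma kern0 x : kern x 0 = 0.
Proof. by rewrite /kern mulr0 mul0r sinh0 mulr0 invr0 mulr0. Qed.

Lemma kern_estimates x : 0 < x -> let Y := Num.sqrt (2 * Num.sqrt (2 * x)) in
  (forall tau, `|kern x tau| <= 13 / 2 / Y) /\
  (\int[leb]_tau ((kern x tau) ^+ 2)%:E <= ((13 / 2) ^+ 2 / Y)%:E)%E.
Proof.
move=> x0; have y0 : 0 < 2 * Num.sqrt (2 * x) by rewrite mulr_gt0// sqrtr_gt0 mulr_gt0.
rewrite /=; have [B [T [B0 T0 hb BT IT]]] := kernel_profile y0.
have k1 tau : `|kern x tau| <= B / T ^+ 2 /\ `|kern x tau| * tau ^+ 2 <= B.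
  wlog : tau / 0 <= tau.
    move=> H; have [/H//|t0] := leP 0 tau.
    by rewrite -kernN -(sqrrN tau); apply: H; rewrite oppr_ge0 ltW.
  (* At [tau = 0] the kernel is 0 by the convention on division by zero; negative [tau] were reduced
     to positive ones by evenness. *)
  rewrite le_eqVlt => /predU1P[<-|t0].
    by rewrite kern0 normr0 mul0r; split; rewrite ?divr_ge0 ?sqr_ge0// ltW.
  have [h1 h2] := hb _ t0; split; first exact: le_trans (kern_le x t0) h1.
  by rewrite -ler_pdivlMr ?exprn_gt0//; exact: le_trans (kern_le x t0) h2.
split=> [tau|]; first by apply: le_trans (proj1 (k1 tau)) BT.
have IT' : ((8 / 3 * B ^+ 2 / T ^+ 3)%R%:E <=
  ((13 / 2) ^+ 2 / Num.sqrt (2 * Num.sqrt (2 * x)))%R%:E)%E by rewrite lee_fin.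
apply: le_trans IT'.
rewrite -integral_majorant//; apply: ge0_le_integral => //=.
- by move=> t _; rewrite lee_fin sqr_ge0.
- apply/measurable_EFinP; apply: measurable_funX; exact: measurable_kern.
- by apply/measurable_EFinP; apply: continuous_measurable_fun; exact: continuous_majorant.
move=> t _; rewrite lee_fin /majorant.
have m0 := majorant_gt0 t T0.
rewrite -(real_normK (num_real (kern x t))) ler_pdivlMr ?exprn_gt0//.
rewrite (exprM _ 2 2) -exprMn; have [h1 h2] := k1 t.
apply: lerXn2r; rewrite ?nnegrE.
- by apply: mulr_ge0 => //; exact: sqr_ge0.
- exact: ltW.
have [_|_] := leP `|t| T; first by rewrite -ler_pdivlMr ?exprn_gt0.
by rewrite real_normK ?num_real.
Qed.

End KernelNorm.

Section KernelLq.
Context {R : realType}.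
Implicit Types x p q c D : R.
Local Notation leb := (@lebesgue_measure R).

(** Pointwise |f|^q <= c^(q-2) f^2. *)
Lemma Lnorm_le_L2_Linfty (f : R -> R) q c D : measurable_fun [set: R] f -> 2 <= q ->
  (forall t, `|f t| <= c) -> (\int[leb]_t (f t ^+ 2)%:E <= D%:E)%E ->
  (Lnorm leb q%:E (EFin \o f) <= ((c `^ (q - 2) * D) `^ q^-1)%:E)%E.
Proof.
move=> mf q2 fc fD; have c0 : 0 <= c by apply: le_trans (fc 0).
have D0 : 0 <= D.
  by rewrite -lee_fin; apply: le_trans fD; apply: integral_ge0 => t _; rewrite lee_fin sqr_ge0.
rewrite unlock -poweR_EFin; apply: gt0_ler_poweR.
- by rewrite invr_ge0; lra.
- rewrite in_itv /= leey andbT.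
  have : (0 <= \int[leb]_t `|(f t)%:E| `^ q)%E by apply: integral_ge0 => t _; exact: poweR_ge0.
  exact.
- by rewrite in_itv /= leey andbT lee_fin mulr_ge0 ?powR_ge0.
have mf2 : measurable_fun [set: R] (fun t => f t ^+ 2) by exact: measurable_funX.
apply: (@le_trans _ _ (\int[leb]_t ((c `^ (q - 2))%:E * (f t ^+ 2)%:E))%E).
  apply: ge0_le_integral => //=.
  - apply/measurable_EFinP.
    have -> : (fun t => `|f t| `^ q) = (@powR R)^~ q \o (fun t => `|f t|) by [].
    apply: (measurableT_comp (measurable_powR q)); exact: measurableT_comp.
  - by apply/measurable_EFinP; apply: measurable_funM => //; exact: measurable_cst.
  move=> t _; rewrite -EFinM lee_fin.
  have [->|f0] := eqVneq (f t) 0.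
    by rewrite normr0 powR0 ?expr0n ?mulr0//; apply/eqP; lra.
  rewrite -[in leLHS](subrK 2 q) (@powRD _ `|f t|) ?normr_eq0 ?f0 ?implybT//.
  rewrite -(real_normK (num_real (f t))) -powR_mulrn//.
  by apply: ler_wpM2r; [exact: powR_ge0|apply: ge0_ler_powR; rewrite ?nnegrE ?subr_ge0].
rewrite ge0_integralZl//=; last 3 first.
- by apply/measurable_EFinP.
- by move=> t _; rewrite lee_fin sqr_ge0.
- by rewrite lee_fin powR_ge0.
by rewrite EFinM; apply: lee_wpmul2l => //; rewrite lee_fin powR_ge0.
Qed.

(** With r = y^(1/2), (M/r)^(q-2) M^2/r = M^q r^(-(q-1)), and (q-1)/q = 1/p. The condition p <= 2 is
    what gives q >= 2. *)
Lemma kern_Lnorm x p q : 1 < p <= 2 -> p^-1 + q^-1 = 1 -> 0 < q -> 0 < x ->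
  (Lnorm leb q%:E (EFin \o kern x) <=
   (13 / 2 * (2 * Num.sqrt (2 * x)) `^ (- (1 / (2 * p))))%:E)%E.
Proof.
move=> /andP[p1 p2] pq q0 x0; have p0 : 0 < p by lra.
have q2 : 2 <= q.
  have : 2^-1 <= p^-1 by rewrite lef_pV2 ?posrE.
  move=> ?; have : q^-1 <= 2^-1 by lra.
  by rewrite lef_pV2 ?posrE.
have [kc kD] := kern_estimates x0.
apply: le_trans (Lnorm_le_L2_Linfty (measurable_kern x) q2 kc kD) _.
have y0 : 0 < 2 * Num.sqrt (2 * x) by rewrite mulr_gt0// sqrtr_gt0 mulr_gt0.
move: (2 * Num.sqrt (2 * x)) y0 => y y0.
have r0 : 0 < Num.sqrt y by rewrite sqrtr_gt0.
have -> : y `^ (- (1 / (2 * p))) = Num.sqrt y `^ (- p^-1).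
  by rewrite -powR12_sqrt ?ltW// -powRrM; congr (_ `^ _); field; rewrite gt_eqF.
move: (Num.sqrt y) r0 => r r0; rewrite lee_fin.
have M0 : 0 < 13 / 2 :> R by lra.
move: (13 / 2 : R) M0 => M M0.
have -> : (M / r) `^ (q - 2) * (M ^+ 2 / r) = (M * r `^ (- p^-1)) `^ q.
  have p'E : p^-1 = 1 - q^-1 by lra.
  rewrite -[M](lnK M0) -[r](lnK r0) -expRN -expRD -expRM_natl -!expRD /powR !gt_eqF ?expR_gt0// ?mulr_gt0 ?expR_gt0// !expRK.
  rewrite -!expRD !expRK; congr expR; rewrite p'E; field; rewrite gt_eqF//.
by rewrite -powRrM mulfV ?gt_eqF// powRr1// mulr_ge0 ?powR_ge0 ?ltW.
Qed.

End KernelLq.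

(** * Integrals of complex-valued functions *)

Section ComplexIntegral.
Context {R : realType}.
Implicit Types f g : R -> R[i].
Local Notation leb := (@lebesgue_measure R).

Lemma measurable_normc f : Cmeasurable_fun f -> measurable_fun [set: R] (fun t => normc (f t)).
Proof.
move=> [mr mi]; under eq_fun do rewrite normcE_sqrt.
apply: (@measurableT_comp _ _ _ _ _ _ (@Num.sqrt R)).
  by apply: continuous_measurable_fun; exact: sqrt_continuous.
by apply: measurable_funD; exact: measurable_funX.
Qed.

Lemma normc_scale (k : R) (z : R[i]) : normc (k%:C%C * z) = `|k| * normc z.
Proof.
case: z => u v; rewrite !normcE_sqrt /= !mul0r subr0 addr0 -sqrtr_sqr -sqrtrM ?sqr_ge0//.
by congr Num.sqrt; ring.
Qed.

Lemma Cintegrable_normc f : Cmeasurable_fun f ->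
  (\int[leb]_t (normc (f t))%:E < +oo)%E ->
  leb.-integrable setT (fun t => (normc (f t))%:E) /\ Cintegrable f.
Proof.
move=> mf fy; have mn := measurable_normc mf; have [mr mi] := mf.
have n0 t : 0 <= normc (f t) by rewrite normcE_sqrt sqrtr_ge0.
have fi : leb.-integrable setT (fun t => (normc (f t))%:E).
  apply/integrableP; split; first exact/measurable_EFinP.
  by under eq_integral do rewrite gee0_abs ?lee_fin//.
split=> //; split; apply: (le_integrable _ _ _ fi) => //=; try exact/measurable_EFinP.
- move=> t _; rewrite lee_fin [leRHS]ger0_norm// normcE_sqrt -sqrtr_sqr ler_wsqrtr//.
  by rewrite lerDl sqr_ge0.
- move=> t _; rewrite lee_fin [leRHS]ger0_norm// normcE_sqrt -sqrtr_sqr ler_wsqrtr//.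
  by rewrite lerDr sqr_ge0.
Qed.

(* With I the integral, |I|^2 = Re I * int (Re f) + Im I * int (Im f) <= |I| * int |f| *)
Lemma normc_Cintegral f : leb.-integrable setT (fun t => (normc (f t))%:E) -> Cintegrable f ->
  normc (Cintegral f) <= \int[leb]_t normc (f t).
Proof.
move=> fi [ri ii]; rewrite normcE_sqrt /=.
set a := (\int[leb]_t complex.Re (f t)); set b := (\int[leb]_t complex.Im (f t)).
set c := Num.sqrt _.
have n0 t : 0 <= normc (f t) by rewrite normcE_sqrt sqrtr_ge0.
have I0 : 0 <= \int[leb]_t normc (f t) by apply: Rintegral_ge0 => t _; exact: n0.
have c0 : 0 <= c by exact: sqrtr_ge0.
have cE : c ^+ 2 = a ^+ 2 + b ^+ 2 by rewrite sqr_sqrtr// addr_ge0 ?sqr_ge0.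
have [->//|cn0] := eqVneq c 0.
have cp : 0 < c by rewrite lt_def cn0.
suff : c ^+ 2 <= c * \int[leb]_t normc (f t) by rewrite expr2 ler_pM2l.
rewrite cE !expr2 {2}/a {2}/b.
have iZ (k : R) (u : R -> R) : leb.-integrable setT (EFin \o u) ->
    leb.-integrable setT (EFin \o (fun t => k * u t)).
  move=> /(integrableZl measurableT k); exact: eq_integrable.
rewrite -!RintegralZl//= -RintegralD//; try exact: iZ.
apply: le_Rintegral => //=.
- have := integrableD measurableT (iZ a _ ri) (iZ b _ ii).
  by apply: eq_integrable => // t _; rewrite /= EFinD.
- exact: iZ.
move=> t _; rewrite normcE_sqrt /c -/a -/b -sqrtrM ?addr_ge0 ?sqr_ge0//.
apply: le_trans (ler_norm _) _; rewrite -sqrtr_sqr ler_wsqrtr//.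
by have := sqr_ge0 (a * complex.Im (f t) - b * complex.Re (f t)); nra.
Qed.

End ComplexIntegral.

Section Transform.
Context {R : realType}.
Local Notation leb := (@lebesgue_measure R).
Variables (p : R) (g : R -> R[i]).
Hypotheses (p12 : 1 < p <= 2) (hg : in_Lp p g).

Lemma G_integrand_bound x : 0 < x ->
  Cmeasurable_fun (G_integrand g x) /\
  (\int[leb]_t (normc (G_integrand g x t))%:E <=
   (13 / 2 * (2 * Num.sqrt (2 * x)) `^ (- (1 / (2 * p))) * Lp_norm p g)%:E)%E.
Proof.
move=> x0; have [mg gy] := hg; have [mr mi] := mg; have /andP[p1 p2] := p12.
have gE : G_integrand g x = fun t => (kern x t)%:C%C * g t.
  by apply/funext => t; exact: G_integrandE.
have mk := measurable_kern x.
split.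
  rewrite gE; split.
    have -> : (fun t => complex.Re ((kern x t)%:C%C * g t)) = (fun t => kern x t * complex.Re (g t)).
      by apply/funext => t; case: (g t) => u v /=; rewrite mul0r subr0.
    exact: measurable_funM.
  have -> : (fun t => complex.Im ((kern x t)%:C%C * g t)) = (fun t => kern x t * complex.Im (g t)).
    by apply/funext => t; case: (g t) => u v /=; rewrite mul0r addr0.
  exact: measurable_funM.
have p0 : 0 < p by lra.
pose q := (1 - p^-1)^-1.
have q0 : 0 < q by rewrite invr_gt0 subr_gt0 invf_lt1.
have pq : p^-1 + q^-1 = 1 by rewrite invrK addrC subrK.
have gf : Lp_enorm p g = (Lp_norm p g)%:E.
  by rewrite fineK// ge0_fin_numE ?Lnorm_ge0.
have := @hoelder _ _ R leb (kern x) (fun t => normc (g t)) q p mk (measurable_normc mg) q0 p0.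
rewrite addrC => /(_ pq) H.
rewrite EFinM -gf; apply: le_trans (lee_wpmul2r _ (kern_Lnorm p12 pq q0 x0)); last first.
  by rewrite /Lp_enorm Lnorm_ge0.
apply: le_trans H; rewrite Lnorm1 le_eqVlt; apply/orP; left; apply/eqP.
apply: eq_integral => t _; rewrite gE normc_scale.
have n0 : 0 <= normc (g t) by rewrite normcE_sqrt sqrtr_ge0.
by rewrite -{1}(ger0_norm n0) -normrM.
Qed.

End Transform.

Theorem theorem4 (R : realType) (p : R) (g : R -> complex R)
    (hp1 : 1 < p) (hp2 : p <= 2) (hg : in_Lp p g) :
  (forall x : R, 0 < x -> Cintegrable (G_integrand g x)) /\
  (forall x : R, 0 < x ->
    normc (G_op g x) <=
      2 `^ (1 / (4 * p) - 1) * p `^ (- (1 / (2 * p))) * x `^ (- (1 / (4 * p)))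
      * Beta (1 / (4 * p)) (1 / (4 * p)) * Lp_norm p g).
Proof.
have p12 : 1 < p <= 2 by rewrite hp1.
have key x (x0 : 0 < x) :
    (@lebesgue_measure R).-integrable setT (fun t => (normc (G_integrand g x t))%:E) /\ Cintegrable (G_integrand g x).
  have [mG bG] := G_integrand_bound p12 hg x0.
  by apply: Cintegrable_normc => //; exact: le_lt_trans bG (ltry _).
split=> x x0; first by have [] := key x x0.
have [nG iG] := key x x0; have [_ bG] := G_integrand_bound p12 hg x0.
apply: le_trans (normc_Cintegral nG iG) _.
apply: (@le_trans _ _ (13 / 2 * (2 * Num.sqrt (2 * x)) `^ (- (1 / (2 * p))) * Lp_norm p g)).
  have fin : (\int[@lebesgue_measure R]_t (normc (G_integrand g x t))%:E)%E \is a fin_num.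
    exact: integrable_fin_num.
  by rewrite -lee_fin fineK.
apply: ler_wpM2r; last exact: bound_const.
by rewrite fine_ge0// Lnorm_ge0.
Qed.
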